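(* Let $\beta\ge 1$. Consider a germ of smooth $\beta$-Gevrey vector field at the origin of $\mathbb{R}^n$, a hyperbolic fixed point: $$\frac{dx}{dt}=Ax+g(x),$$ where $A$ is a hyperbolic matrix and $g$ is a smooth $\beta$-Gevrey vector field in a neighborhood of $0$ with $g(0)=0$, $Dg(0)=0$. Let $\phi^t(w)$ denote its flow. Then there exists a neighborhood $\mathcal{V}$ of the origin such that $$W^s_{\mathrm{loc}}=\{x\in\mathcal{V} : (t\mapsto\phi^t(x))\in C^1_b(\mathbb{R}^+)\},\qquad W^u_{\mathrm{loc}}=\{x\in\mathcal{V} : (t\mapsto\phi^t(x))\in C^1_b(\mathbb{R}^-)\}$$ are smooth $\beta$-Gevrey manifolds passing through $0$ and tangent at $0$ to $E^s$ and $E^u$ respectively.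
   Context: ''Smooth'' means $C^\infty$. A smooth function $f$ on an open set $\Omega\subset\mathbb{R}^n$ is $\beta$-Gevrey ($\beta\ge 1$) if for any compact $K\subset\Omega$ there are constants $M,C$ such that $\sup_{x\in K}|D^kf(x)|\le M C^{|k|}(|k|!)^{\beta}$ for all $k\in\mathbb{N}^n$; maps and vector fields are $\beta$-Gevrey if their components are, and a manifold is $\beta$-Gevrey smooth if it is locally the graph of a $\beta$-Gevrey map. A matrix is hyperbolic if all its eigenvalues have nonzero real part. $E^s$ (resp. $E^u$) is the sum of the generalized eigenspaces of $A$ associated with the eigenvalues with negative (resp. positive) real part. $C^1_b(\mathbb{R}^{\pm})$ is the space of bounded $C^1$ functions with bounded derivative on $\mathbb{R}^+=[0,+\infty)$, resp. $\mathbb{R}^-=(-\infty,0]$ (with values in $\mathbb{R}^n$). *)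

(* Defs.v *)
From HB Require Import structures.
From mathcomp Require Import all_boot all_order all_algebra.
From mathcomp Require Import all_classical all_reals all_analysis.
From mathcomp.real_closed Require Import complex.

Set Implicit Arguments.
Unset Strict Implicit.
Unset Printing Implicit Defensive.

Import Order.TTheory GRing.Theory Num.Theory.
Import numFieldNormedType.Exports.

Local Open Scope classical_set_scope.
Local Open Scope ring_scope.

(* Vectors of R^n are column vectors, so that the linear field is A *m x. *)

Section Gevrey.
Context {R : realType}.

Definition partial {n} (i : 'I_n) (f : 'cV[R]_n -> R) : 'cV[R]_n -> R :=
  fun x => 'D_(delta_mx i 0) f x.

Definition iter_partial {n} (s : seq 'I_n) (f : 'cV[R]_n -> R)
  : 'cV[R]_n -> R := foldr partial f s.

Definition smooth_on {n} (U : set 'cV[R]_n) (f : 'cV[R]_n -> R) : Prop :=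
  forall (s : seq 'I_n) (x : 'cV[R]_n), U x ->
    {for x, continuous (iter_partial s f)} /\
    (forall i : 'I_n, derivable (iter_partial s f) x (delta_mx i 0)).

Definition multi_partial {n} (k : 'I_n -> nat) (f : 'cV[R]_n -> R)
  : 'cV[R]_n -> R :=
  iter_partial (flatten [seq nseq (k i) i | i <- enum 'I_n]) f.

Definition multi_order {n} (k : 'I_n -> nat) : nat := (\sum_(i < n) k i)%N.

Definition gevrey_on {n} (beta : R) (U : set 'cV[R]_n) (f : 'cV[R]_n -> R)
  : Prop :=
  smooth_on U f /\
  forall K : set 'cV[R]_n, compact K -> K `<=` U ->
    exists M C : R, forall (k : 'I_n -> nat) (x : 'cV[R]_n), K x ->
      `|multi_partial k f x| <= M * C ^+ multi_order k * ((multi_order k)`!%:R `^ beta).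

Definition gevrey_map_on {n m} (beta : R) (U : set 'cV[R]_n)
    (f : 'cV[R]_n -> 'cV[R]_m) : Prop :=
  forall i : 'I_m, gevrey_on beta U (fun x => f x i 0).

(* Near each of its points, W is the graph of a Gevrey map from an open subset
   of the span of the columns of P to the span of the columns of Q, where
   R^n is the direct sum of these two spans. *)
Definition gevrey_manifold {n} (beta : R) (W : set 'cV[R]_n) : Prop :=
  exists d m : nat, (d + m = n)%N /\
  forall p : 'cV[R]_n, W p ->
    exists (P : 'M[R]_(n, d)) (Q : 'M[R]_(n, m)) (U : set 'cV[R]_n)
           (O : set 'cV[R]_d) (h : 'cV[R]_d -> 'cV[R]_m),
      [/\ \rank (row_mx P Q) = n, open_nbhs p U, open O,
          gevrey_map_on beta O h
        & W `&` U = [set P *m y + Q *m h y | y in O]].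

(* The velocities at p of the curves in W that pass through p at time 0. *)
Definition tangent_space {n} (W : set 'cV[R]_n) (p : 'cV[R]_n)
  : set 'cV[R]_n :=
  [set v | exists c : R -> 'cV[R]_n,
     [/\ c 0 = p, \forall t \near (0 : R), W (c t) & is_derive (0 : R) 1 c v]].

End Gevrey.

Section Flow.
Context {R : realType} {n : nat}.
Implicit Types (J : set R) (u v : R -> 'cV[R]_n) (U : set 'cV[R]_n)
  (F : 'cV[R]_n -> 'cV[R]_n).

(* Derivative of u at t along J, hence one-sided at an endpoint of J. *)
Definition has_deriv_within J u (t : R) (w : 'cV[R]_n) : Prop :=
  (fun s => (s - t)^-1 *: (u s - u t)) @ within J (t^') --> w.

Definition C1b J u : Prop :=
  exists v, [/\ forall t, J t -> has_deriv_within J u t (v t),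
                {within J, continuous v},
                [bounded u t | t in J] & [bounded v t | t in J]].

Definition integral_curve U F J u : Prop :=
  forall t, J t -> U (u t) /\ has_deriv_within J u t (F (u t)).

(* y is reached at time t from x along an integral curve of the vector field F
   on U; the integral curve may not leave U between the times 0 and t. *)
Definition flows_to U F (t : R) (x y : 'cV[R]_n) : Prop :=
  exists u, [/\ u 0 = x,
    integral_curve U F [set s | Num.min 0 t <= s <= Num.max 0 t] u & u t = y].

Definition flow_defined U F (t : R) (x : 'cV[R]_n) : Prop :=
  exists y, flows_to U F t x y.

(* Meaningful only when flow_defined U F t x holds. *)
Definition flow U F (t : R) (x : 'cV[R]_n) : 'cV[R]_n :=
  xget 0 (flows_to U F t x).

(* The flow is that of the restriction of F to V, so the orbits stay in V:
   otherwise an orbit could leave V and remain bounded far from 0, as for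
   x' = x - x^2 on the line, where the orbit of every x > 0 is bounded on
   [0, +oo) although 0 is a source. *)
Definition W_loc (V : set 'cV[R]_n) F J : set 'cV[R]_n :=
  [set x | [/\ V x, forall t, J t -> flow_defined V F t x
             & C1b J (fun t => flow V F t x)]].

End Flow.

Section Spectrum.
Context {R : realType} {n : nat}.
Implicit Types A : 'M[R]_n.

Definition complexify {m p} (B : 'M[R]_(m, p)) : 'M[complex R]_(m, p) :=
  map_mx (real_complex R) B.

Definition hyperbolic A : Prop :=
  forall l : complex R, eigenvalue (complexify A) l -> complex.Re l != 0.

(* The real vectors in the sum of the generalized eigenspaces of A for the
   eigenvalues whose real part satisfies S.  As geigenspace is a space of row
   vectors, it is applied to the transpose of A. *)
Definition spectral_space A (S : R -> Prop) : set 'cV[R]_n :=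
  [set x | exists s : seq (complex R),
     (forall l, l \in s -> eigenvalue (complexify A) l /\ S (complex.Re l)) /\
     ((complexify x)^T <=
        \sum_(l <- s) geigenspace (complexify A)^T l)%MS].

Definition stable_space A := spectral_space A (fun r => r < 0).
Definition unstable_space A := spectral_space A (fun r => 0 < r).

End Spectrum.

(* Main.v *)
(* The hyperbolic splitting is real because the characteristic polynomial divides
   the product of two coprime real polynomials, one with roots in each open half
   plane; each part carries a norm in which explicit Euler steps contract.
   An orbit that stays in a small box for all t >= 0 solves the Lyapunov-Perron
   problem: its stable part is given at time 0 and computed forwards, its unstable
   part is computed backwards from a far time. Discretizing time by Euler steps of
   length 2^-p on [0, 2^p], this problem is solved by a finite Picard iteration
   which only uses sums and compositions with g, so no differentiation under an
   integral is needed. The derivatives of the iterates with respect to the stable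
   datum y satisfy, uniformly in p and in the number of iterations, bounds of the
   form a rho^j (j!)^beta / j^2, which are stable under composition with a Gevrey
   map (Faa di Bruno) when the derivative of g and the number a are small. A
   discrete pinching estimate shows that the iterates converge to the unique orbit
   of the box with stable datum y, so that the local stable set is the graph of a
   limit with the same bounds on its derivatives, hence Gevrey. Since g vanishes to
   order two, this graph is tangent to the stable space. The unstable case follows
   by reversing time. *)
Require Import Defs.
From HB Require Import structures.
From mathcomp Require Import all_boot all_order all_algebra.
From mathcomp Require Import all_classical all_reals all_analysis.
From mathcomp.real_closed Require Import complex.
From mathcomp Require Import zify ring lra.
From mathcomp Require Import spectral.

Set Implicit Arguments.
Unset Strict Implicit.
Unset Printing Implicit Defensive.

Import Order.TTheory GRing.Theory Num.Theory.
Import numFieldNormedType.Exports.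

Local Open Scope classical_set_scope.
Local Open Scope ring_scope.

(** * Majorants of iterated partial derivatives *)

(** One class of sequences carries the dynamics: points of the box whose one-step defect is at most
    a constant times the square of the mesh ([approx]). It contains the Picard iterates, every
    second point of a trajectory of half the mesh, and the samples of true orbits. A single
    comparison, with the stable datum fixed at time 0 and mere boundedness at the far end, thus
    gives both the Cauchy property of the trajectories and uniqueness. For the derivatives,
    composition with g must return bounds of the same form, small relative to the contraction rate.
    The linear part of the Faa di Bruno formula costs the size of Dg, small in a small box; the rest
    is quadratic in a, hence negligible against a once a is small. The parameter rho does not enter
    these conditions: it is chosen last, so that a rho dominates the first derivatives of the
    identity map. As the constants do not depend on the order of derivation, each finite order can
    be treated separately, with polynomials in place of power series. *)

Section Majorants.
Context {R : realType} {d : nat}.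
Implicit Types (O : set 'cV[R]_d) (phi psi : nat -> R).

Local Notation e_ i := (delta_mx i 0 : 'cV[R]_d).

(** Product of exponential generating series, that is, the Leibniz rule for bounds on derivatives;
    the shift [\o S] plays the part of differentiation. *)
Definition bconv phi psi (j : nat) : R :=
  \sum_(i < j.+1) 'C(j, i)%:R * phi i * psi (j - i)%N.

Lemma bconvS phi psi j :
  bconv phi psi j.+1 = bconv (phi \o S) psi j + bconv phi (psi \o S) j.
Proof.
rewrite /bconv big_ord_recl /= bin0 subn0.
have -> : \sum_(i < j.+1) 'C(j.+1, bump 0 i)%:R * phi (bump 0 i) * psi (j.+1 - bump 0 i)%N =
    \sum_(i < j.+1) 'C(j, i)%:R * phi i.+1 * psi (j - i)%N +
    \sum_(i < j.+1) 'C(j, i.+1)%:R * phi i.+1 * psi (j - i)%N.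
  rewrite -big_split /=; apply: eq_bigr => i _.
  by rewrite /bump /= add1n binS natrD !mulrDl subSS addrC.
rewrite addrCA; congr (_ + _).
rewrite [RHS]big_ord_recl big_ord_recr /= bin_small // !mul0r addr0 bin0 subn0.
congr (_ + _); apply: eq_bigr => i _.
by rewrite /bump /= add1n subnSK.
Qed.

(* All iterated partial derivatives of f of order at most k exist on O, and
   nu of those of order j is bounded by phi j. *)
Fixpoint maj (W : normedModType R) (k : nat) O (nu : W -> R)
    (f : 'cV[R]_d -> W) phi : Prop :=
  (forall x, O x -> nu (f x) <= phi 0%N) /\
  if k is k'.+1 then
    forall i, (forall x, O x -> derivable f x (e_ i)) /\
              maj k' O nu ('D_(e_ i) f) (phi \o S)
  else True.

Lemma maj_ext (W : normedModType R) k O (nu : W -> R) f f' phi : open O ->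
  (forall x, O x -> f x = f' x) -> maj k O nu f phi -> maj k O nu f' phi.
Proof.
move=> oO; elim: k f f' phi => [|k IH] f f' phi ff' [H1 H2].
  by split=> // x Ox; rewrite -ff' //; exact: H1.
have near_ff' x : O x -> \near x, f x = f' x.
  by move=> Ox; apply: filterS (open_nbhs_nbhs (conj oO Ox)).
split=> [x Ox|i]; first by rewrite -ff' //; exact: H1.
have [H3 H4] := H2 i; split=> [x Ox|].
  by apply: near_eq_derivable (H3 x Ox); exact: near_ff'.
by apply: IH H4 => x Ox; apply: near_eq_derive; exact: near_ff'.
Qed.

Lemma maj_le (W : normedModType R) k O (nu : W -> R) f phi psi :
  (forall j, (j <= k)%N -> phi j <= psi j) -> maj k O nu f phi -> maj k O nu f psi.
Proof.
elim: k f phi psi => [|k IH] f phi psi le [H1 H2].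
  by split=> // x Ox; apply: le_trans (H1 _ Ox) (le _ _).
split=> [x Ox|i]; first by apply: le_trans (H1 _ Ox) (le _ _).
by have [H3 H4] := H2 i; split=> //; apply: IH H4 => j jk; exact: le.
Qed.

Lemma majW (W : normedModType R) k O (nu : W -> R) f phi :
  maj k.+1 O nu f phi -> maj k O nu f phi.
Proof.
elim: k f phi => [|k IH] f phi [A B]; first by [].
by split=> // i; have [D E] := B i; split=> //; exact: IH.
Qed.

(** Differentiation commutes with continuous linear maps, so one norm inequality for [L1 w1 + L2 w2]
    passes to all orders. Two source norms are allowed because stable and unstable components are
    measured separately. *)
Lemma maj_lin (W1 W2 W : normedModType R) (L1 : {linear W1 -> W})
    (L2 : {linear W2 -> W}) (nu1 : W1 -> R) (nu2 : W2 -> R) (nu : W -> R) (a b : R)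
    k O f1 f2 phi1 phi2 :
  continuous L1 -> continuous L2 -> 0 <= a -> 0 <= b ->
  (forall w1 w2, nu (L1 w1 + L2 w2) <= a * nu1 w1 + b * nu2 w2) -> open O ->
  maj k O nu1 f1 phi1 -> maj k O nu2 f2 phi2 ->
  maj k O nu (fun x => L1 (f1 x) + L2 (f2 x)) (fun j => a * phi1 j + b * phi2 j).
Proof.
move=> cL1 cL2 a0 b0 H oO.
have dL (W' : normedModType R) (L : {linear W' -> W}) f x i : continuous L ->
    derivable f x (e_ i) -> derivable (L \o f) x (e_ i) /\
    'D_(e_ i) (L \o f) x = L ('D_(e_ i) f x).
  move=> cL df.
  suff lim : h^-1 *: ((L \o f \o shift x) (h *: e_ i) - (L \o f) x) @[h --> 0^'] -->
      L ('D_(e_ i) f x).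
    by split; [apply/cvg_ex; eexists; exact: lim|exact/cvg_lim].
  rewrite [X in X @ _ --> _](_ : _ = L \o
    (fun h => h^-1 *: ((f \o shift x) (h *: e_ i) - f x))); last first.
    by rewrite funeqE => h /=; rewrite [RHS]linearZ /=; congr (_ *: _); rewrite linearB.
  by apply: continuous_cvg; [exact: cL|exact: df].
elim: k f1 f2 phi1 phi2 => [|k IH] f1 f2 phi1 phi2 [M1 M1'] [M2 M2'].
  split=> // x Ox; apply: le_trans (H _ _) _.
  by rewrite lerD // ler_wpM2l //; [exact: M1|exact: M2].
split=> [x Ox|i].
  apply: le_trans (H _ _) _.
  by rewrite lerD // ler_wpM2l //; [exact: M1|exact: M2].
have [D1 E1] := M1' i; have [D2 E2] := M2' i; split=> [x Ox|].
  apply: (@derivableD _ _ _ (L1 \o f1) (L2 \o f2)).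
    exact: (dL _ _ _ _ _ cL1 (D1 x Ox)).1.
  exact: (dL _ _ _ _ _ cL2 (D2 x Ox)).1.
apply: maj_ext (IH _ _ _ _ E1 E2) => //= x Ox.
have [d1 {}E1] := dL _ _ _ _ _ cL1 (D1 x Ox).
have [d2 {}E2] := dL _ _ _ _ _ cL2 (D2 x Ox).
by rewrite -E1 -E2 -deriveD.
Qed.

Lemma majD k O (f1 f2 : 'cV[R]_d -> R) phi1 phi2 : open O ->
  maj k O Num.norm f1 phi1 -> maj k O Num.norm f2 phi2 ->
  maj k O Num.norm (fun x => f1 x + f2 x) (fun j => phi1 j + phi2 j).
Proof.
move=> oO M1 M2.
have c1 : continuous (idfun : R -> R) by move=> x; exact: cvg_id.
have H (w1 w2 : R) : `|idfun w1 + idfun w2| <= 1 * `|w1| + 1 * `|w2|.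
  by rewrite !mul1r; exact: ler_normD.
apply: maj_le (maj_lin c1 c1 ler01 ler01 H oO M1 M2) => j _ /=.
by rewrite !mul1r.
Qed.

Lemma maj_sum n k O (f : 'I_n -> 'cV[R]_d -> R) (phi : 'I_n -> nat -> R) : open O ->
  (forall l, maj k O Num.norm (f l) (phi l)) ->
  maj k O Num.norm (fun x => \sum_l f l x) (fun j => \sum_l phi l j).
Proof.
move=> oO; elim: n f phi => [|n IH] f phi H.
  have Z : forall k, maj k O Num.norm (fun=> 0 : R) (fun=> 0).
    elim=> [|k' IHk]; (split; first by move=> x _; rewrite normr0) => // i.
    split=> [x _|]; first exact: derivable_cst.
    by rewrite (_ : 'D_(e_ i) _ = fun=> 0) //; apply/funext => x; exact: derive_cst.
  apply: (maj_ext oO _ (maj_le _ (Z k))) => [x _|j _]; by rewrite big_ord0.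
apply: (maj_ext oO _ (maj_le _ (majD oO (H ord0) (IH _ _ (fun l => H (lift ord0 l)))))).
  by move=> x _; rewrite big_ord_recl.
by move=> j _; rewrite big_ord_recl.
Qed.

Lemma majM k O (f1 f2 : 'cV[R]_d -> R) phi1 phi2 : open O ->
  maj k O Num.norm f1 phi1 -> maj k O Num.norm f2 phi2 ->
  maj k O Num.norm (fun x => f1 x * f2 x) (bconv phi1 phi2).
Proof.
move=> oO; elim: k f1 f2 phi1 phi2 => [|k IH] f1 f2 phi1 phi2 M1 M2.
  split=> // x Ox; rewrite /bconv big_ord1 bin0 mul1r subn0 normrM.
  by apply: ler_pM => //; [exact: (proj1 M1)|exact: (proj1 M2)].
split=> [x Ox|i].
  rewrite /bconv big_ord1 bin0 mul1r subn0 normrM.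
  by apply: ler_pM => //; [exact: (proj1 M1)|exact: (proj1 M2)].
have [D1 E1] := (proj2 M1) i; have [D2 E2] := (proj2 M2) i.
split=> [x Ox|]; first by apply: derivableM; [exact: D1|exact: D2].
have := majD oO (IH _ _ _ _ E1 (majW M2)) (IH _ _ _ _ (majW M1) E2).
move=> H; apply: (maj_ext oO _ (maj_le _ H)) => [x Ox|j _ /=]; last by rewrite bconvS.
by rewrite (deriveM (D1 x Ox) (D2 x Ox)) /= [RHS]addrC [X in X + _ = _]mulrC.
Qed.

End Majorants.

Section Composition.
Context {R : realType}.

(** On the line through [x] with direction [v] there is one real variable, so directional
    derivatives of the coordinates of [X] suffice, whereas [f] must be differentiable at [X x]. *)
Lemma chain_partial d n (f : 'cV[R]_n -> R) (X : 'cV[R]_d -> 'cV[R]_n) x v :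
  differentiable f (X x) -> (forall l, derivable (fun x => X x l 0) x v) ->
  derivable (f \o X) x v /\
  'D_v (f \o X) x = \sum_l 'D_v (fun x => X x l 0) x * 'D_(delta_mx l 0) f (X x).
Proof.
move=> df dX.
have dX' : derivable X x v.
  by apply/derivable_mxP => i j; rewrite (ord1 j); exact: dX.
pose c (h : R) := X (h *: v + x).
have dc : differentiable c 0.
  by apply/derivable1_diffP; move/derivable1P: dX'.
have c0 : c 0 = X x by rewrite /c scale0r add0r.
have df' : differentiable f (c 0) by rewrite c0.
have dfc : differentiable (f \o c) 0 by exact: differentiable_comp.
split; first by apply/derivable1P; move/derivable1_diffP: dfc.
have dE (W : normedModType R) (F : 'cV[R]_d -> W) :
    'D_v F x = 'D_1 (fun h : R => F (h *: v + x)) 0.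
  rewrite /derive; set g1 := fun h => h^-1 *: _; set g2 := fun h => h^-1 *: _.
  suff -> : g1 = g2 by []; rewrite funeqE /g1 /g2 => h /=.
  by rewrite addr0 scale0r add0r [_%:A]mulr1.
have -> : 'D_v (f \o X) x = 'D_1 (f \o c) 0 by exact: dE.
rewrite (deriveE _ dfc) diff_comp //= -(deriveE _ dc) c0.
have <- : 'D_v X x = 'D_1 c 0 by exact: dE.
have -> : 'D_v X x = \sum_l 'D_v (fun x => X x l 0) x *: delta_mx l 0.
  rewrite derive_mx // [LHS]matrix_sum_delta; apply: eq_bigr => l _.
  by rewrite big_ord1 mxE.
rewrite linear_sum; apply: eq_bigr => l _.
by rewrite (deriveE _ df) linearZ.
Qed.

(* Faa di Bruno for majorants: if B q j bounds the j-th coefficient of the q-th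
   divided power of the series with derivatives b, the derivatives of order j
   of g \o X are bounded by \sum_q G q * n^q * B q j. *)
Lemma maj_comp d n (O : set 'cV[R]_d) (U : set 'cV[R]_n) (g : 'cV[R]_n -> R)
    (G : nat -> R) (X : 'cV[R]_d -> 'cV[R]_n) (b : nat -> R) (B : nat -> nat -> R) k :
  open O -> (forall x, O x -> U (X x)) ->
  (forall s x, U x -> differentiable (iter_partial s g) x /\
                      `|iter_partial s g x| <= G (size s)) ->
  (forall q, 0 <= G q) -> (forall q j, 0 <= B q j) -> B 0%N 0%N = 1 ->
  (forall q j, (q <= j)%N -> \sum_(i < j.+1 | (q <= i)%N)
       'C(j, i)%:R * B q i * b (j - i).+1 <= B q.+1 j.+1) ->
  (forall l, maj k O Num.norm (fun x => X x l 0) b) ->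
  maj k O Num.norm (g \o X) (fun j => \sum_(q < j.+1) G q * n%:R ^+ q * B q j).
Proof.
move=> oO OU Hg G0 B0 B00 HB.
(* The induction ranges over the word [s] already applied to [g], since each differentiation of the
   composite prolongs it by one letter. *)
suff H s : (forall l, maj k O Num.norm (fun x => X x l 0) b) ->
    maj k O Num.norm (iter_partial s g \o X)
      (fun j => \sum_(q < j.+1) G (size s + q)%N * n%:R ^+ q * B q j).
  exact: (H [::]).
elim: k s => [|k IH] s HX.
  split=> // x Ox; rewrite big_ord1 addn0 expr0 mulr1 B00 mulr1.
  by have [] := Hg s _ (OU _ Ox).
have dX x i l : O x -> derivable (fun x => X x l 0) x (delta_mx i 0).
  by move=> Ox; have [_ /(_ i) []] := HX l; move=> /(_ _ Ox).
split=> [x Ox|i].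
  rewrite big_ord1 addn0 expr0 mulr1 B00 mulr1.
  by have [] := Hg s _ (OU _ Ox).
have dc x : O x -> _ := fun Ox =>
  chain_partial (proj1 (Hg s _ (OU _ Ox))) (fun l => dX x i l Ox).
split=> [x Ox|]; first by have [] := dc x Ox.
have IHk l := IH (l :: s) (fun l => majW (HX l)).
have HXi l : maj k O Num.norm ('D_(delta_mx i 0) (fun x => X x l 0)) (b \o S).
  by have [_ /(_ i) []] := HX l.
have HM := maj_sum oO (fun l => majM oO (IHk l) (HXi l)).
apply: maj_ext (maj_le _ HM) => //= [x Ox|j _].
  by rewrite (dc x Ox).2; apply: eq_bigr => l _; rewrite mulrC.
(* The [n] letters give equal bounds, hence one factor n per differentiation. The term q = 0 on the
   right is nonnegative and is dropped, which shifts the index by one. *)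
rewrite sumr_const card_ord /bconv -[leLHS]mulr_natl.
rewrite [leRHS]big_ord_recl /=.
apply: (@le_trans _ _ (\sum_(q < j.+1) G (size s + q.+1)%N * n%:R ^+ q.+1 * B q.+1 j.+1)); last first.
  rewrite -[leLHS]add0r lerD ?mulr_ge0 ?exprn_ge0 //.
apply: (@le_trans _ _ (\sum_(q < j.+1) G (size s + q.+1)%N * n%:R ^+ q.+1 *
   (\sum_(i < j.+1 | (q <= i)%N) 'C(j, i)%:R * B q i * b (j - i).+1))); last first.
  apply: ler_sum => q _; rewrite ler_wpM2l ?mulr_ge0 ?exprn_ge0 //.
  by apply: HB; rewrite -ltnS.
under [leRHS]eq_bigr do rewrite mulr_sumr big_mkcond.
rewrite exchange_big mulr_sumr /=; apply: ler_sum => u _.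
rewrite -big_mkcond /= mulr_sumr mulr_suml mulr_sumr.
rewrite (big_ord_widen j.+1 (fun q => n%:R * ('C(j, u)%:R *
  (G ((size s).+1 + q)%N * n%:R ^+ q * B q u) * b (j - u).+1))) //.
apply: ler_sum => q _; rewrite exprS addSnnS le_eqVlt.
by apply/orP; left; apply/eqP; ring.
Qed.

End Composition.

(** * Stability of Gevrey bounds under composition *)

Section GevreyComposition.
Context {R : realType}.

Lemma sum_inv_sq (j : nat) : \sum_(i < j.+1) (i%:R ^+ 2)^-1 <= 2 :> R.
Proof.
(* The estimate 1/x^2 <= 1/(x-1) - 1/x telescopes only if the remainder is kept in the induction;
   the term of index 0 is 0. *)
suff H : \sum_(i < j.+2) (i%:R ^+ 2)^-1 <= 2 - (j.+1%:R)^-1 :> R.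
  apply: (@le_trans _ _ (2 - j.+1%:R^-1)); last by rewrite gerBl invr_ge0.
  apply: le_trans H; rewrite [leRHS]big_ord_recr /= lerDl.
  by rewrite invr_ge0 exprn_ge0.
elim: j => [|j IH]; first by rewrite big_ord_recr big_ord1 expr0n invr0 /= expr1n invr1; lra.
rewrite big_ord_recr /=; apply: (le_trans (lerD IH (lexx _))).
have j1 : 0 < j.+1%:R :> R by rewrite ltr0n.
have j2 : j.+2%:R = j.+1%:R + 1 :> R by rewrite natr1.
rewrite j2 -subr_ge0; set x := j.+1%:R in j1 *.
rewrite (_ : _ - _ = (x * (x + 1) ^+ 2)^-1); last by field; rewrite !lt0r_neq0 //; lra.
by rewrite invr_ge0 mulr_ge0 ?exprn_ge0; lra.
Qed.

(** From (x + y)^2 <= 2 (x^2 + y^2), a product of inverse squares is at most 2 / (x + y)^2 times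
    their sum, and each of the two resulting sums is at most 2. *)
Lemma conv_inv_sq (j : nat) :
  \sum_(i < j.+1) (i%:R ^+ 2)^-1 * ((j - i)%:R ^+ 2)^-1 <= 8 / (j%:R ^+ 2) :> R.
Proof.
have [->|j0] := posnP j.
  by rewrite big_ord1 subnn expr0n invr0 !mulr0.
have j0' : 0 < j%:R :> R by rewrite ltr0n.
apply: (@le_trans _ _ (\sum_(i < j.+1) 2 / j%:R ^+ 2 *
    ((i%:R ^+ 2)^-1 + ((j - i)%:R ^+ 2)^-1))).
  apply: ler_sum => i _.
  have [->|i0] := posnP i.
    rewrite expr0n invr0 mul0r mulr_ge0 ?divr_ge0 ?addr_ge0 ?invr_ge0 ?exprn_ge0 //.
  have [->|k0] := posnP (j - i)%N.
    by rewrite expr0n invr0 mulr0 mulr_ge0 ?divr_ge0 ?addr_ge0 ?invr_ge0 ?exprn_ge0.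
  have ij : (i <= j)%N by rewrite -ltnS.
  have -> : j%:R = i%:R + (j - i)%:R :> R by rewrite -natrD subnKC.
  have : 0 < i%:R :> R by rewrite ltr0n.
  have : 0 < (j - i)%:R :> R by rewrite ltr0n.
  move: (i%:R : R) ((j - i)%:R : R) => x y y0 x0.
  rewrite -subr_ge0 (_ : _ - _ = (x - y) ^+ 2 / (x * y * (x + y)) ^+ 2); last first.
    by field; rewrite !lt0r_neq0 //; lra.
  by rewrite divr_ge0 ?sqr_ge0.
rewrite -mulr_sumr big_split /=.
have -> : \sum_(i < j.+1) ((j - i)%:R ^+ 2)^-1 = \sum_(i < j.+1) (i%:R ^+ 2)^-1 :> R.
  rewrite (reindex_inj rev_ord_inj) /=; apply: eq_bigr => i _.
  by rewrite subSS subKn // -ltnS.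
apply: le_trans (ler_wpM2l _ (lerD (sum_inv_sq j) (sum_inv_sq j))) _.
  by rewrite divr_ge0 ?exprn_ge0.
by rewrite le_eqVlt; apply/orP; left; apply/eqP; ring.
Qed.

Lemma geo_sum_le2 (t : R) m : 0 <= t -> t <= 2^-1 -> \sum_(i < m) t ^+ i <= 2.
Proof.
move=> t0 t1; elim: m => [|m IH]; first by rewrite big_ord0.
rewrite big_ord_recl expr0; under eq_bigr do rewrite /= /bump add1n exprS.
by rewrite -mulr_sumr; have := ler_pM t0 (sumr_ge0 _ (fun i _ => exprn_ge0 _ t0)) t1 IH; lra.
Qed.

Variables (beta A rho : R).
Hypotheses (beta1 : 1 <= beta) (A0 : 0 <= A) (rho0 : 0 <= rho).

(* The junk value 1 / 0 = 0 makes the coefficient of order 0 vanish. *)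
Let p j : R := A * rho ^+ j / j%:R ^+ 2.

Let p0 : p 0 = 0. Proof. by rewrite /p expr0n invr0 mulr0. Qed.

Let p_ge0 j : 0 <= p j.
Proof. by rewrite /p divr_ge0 ?mulr_ge0 ?exprn_ge0. Qed.

Variable N : nat.
(** Generating series of the bounds, cut off so that polynomial powers and derivatives apply; the
    cut is harmless as long as [N] exceeds the orders considered. *)
Let P : {poly R} := \poly_(i < N) p i.

Let P_ge0 j : 0 <= P`_j.
Proof. by rewrite coef_poly; case: ifP. Qed.

Let P_le j : P`_j <= p j.
Proof. by rewrite coef_poly; case: ifP. Qed.

Let PX_ge0 q j : 0 <= (P ^+ q)`_j.
Proof.
elim: q j => [|q IH] j; first by rewrite expr0 coef1; case: eqP.
by rewrite exprS coefM sumr_ge0 // => i _; rewrite mulr_ge0.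
Qed.

(** Each further multiplication by [P] costs one factor 8, by [conv_inv_sq]. *)
Let PX_le q j : (P ^+ q.+1)`_j <= A ^+ q.+1 * 8 ^+ q * rho ^+ j / j%:R ^+ 2.
Proof.
elim: q j => [|q IH] j; first by rewrite !expr1 expr0 mulr1; exact: P_le.
rewrite exprSr coefM.
apply: (@le_trans _ _ (\sum_(i < j.+1) A ^+ q.+2 * 8 ^+ q * rho ^+ j *
   ((i%:R ^+ 2)^-1 * ((j - i)%:R ^+ 2)^-1))).
  apply: ler_sum => i _.
  apply: le_trans (ler_pM (PX_ge0 _ _) (P_ge0 _) (IH i) (P_le _)) _.
  have ij : (i <= j)%N by rewrite -ltnS.
  have -> : rho ^+ j = rho ^+ i * rho ^+ (j - i) by rewrite -exprD subnKC.
  rewrite /p [A ^+ q.+2]exprS le_eqVlt.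
  by apply/orP; left; apply/eqP; ring.
rewrite -mulr_sumr; apply: le_trans (ler_wpM2l _ (conv_inv_sq j)) _.
  by apply: mulr_ge0; [apply: mulr_ge0|]; exact: exprn_ge0.
by rewrite [in leRHS](exprS (8 : R) q) le_eqVlt; apply/orP; left; apply/eqP; ring.
Qed.

(** For [beta] equal to 1 this is a partial Bell polynomial, the j-th derivative at 0 of P^q / q!.
    In general only the quotient of factorials is raised to the power. *)
Let B q j : R := (j`!%:R / q`!%:R) `^ beta * (P ^+ q)`_j.

Let B_ge0 q j : 0 <= B q j.
Proof. by rewrite mulr_ge0 ?powR_ge0. Qed.

Let b j : R := j`!%:R `^ beta * P`_j.

(** For [beta] equal to 1 this is an equality, the coefficient form of (P^(q+1))' = (q+1) P' P^q.
    The excess power [beta - 1] is nonnegative and is taken out of the sum by monotonicity. *)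
Let B_rec q j : (q <= j)%N ->
  \sum_(i < j.+1 | (q <= i)%N) 'C(j, i)%:R * B q i * b (j - i).+1 <= B q.+1 j.+1.
Proof.
move=> qj; set T : R := j.+1`!%:R / q.+1`!%:R.
have T0 : 0 < T by rewrite divr_gt0.
have powE t : 0 < t -> t `^ beta = t * t `^ (beta - 1).
  move=> t0; rewrite -{2}(powRr1 (ltW t0)) -powRD; first by congr (_ `^ _); lra.
  by apply/implyP => _; rewrite lt0r_neq0.
apply: (@le_trans _ _ (\sum_(i < j.+1) T `^ (beta - 1) * (j`!%:R / q`!%:R) *
    ((P`_(j - i).+1 *+ (j - i).+1) * (P ^+ q)`_i))).
  rewrite big_mkcond /=; apply: ler_sum => i _; case: ifP => [qi|_]; last first.
    by rewrite !mulr_ge0 ?powR_ge0 ?divr_ge0 ?mulrn_wge0.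
  have ij : (i <= j)%N by rewrite -ltnS.
  set t : R := i`!%:R / q`!%:R * (j - i).+1`!%:R.
  have t0 : 0 < t by rewrite mulr_gt0 ?divr_gt0.
  have -> : 'C(j, i)%:R * B q i * b (j - i).+1 =
      'C(j, i)%:R * t `^ beta * (P`_(j - i).+1 * (P ^+ q)`_i).
    have -> : t `^ beta = (i`!%:R / q`!%:R) `^ beta * ((j - i).+1)`!%:R `^ beta.
      by rewrite /t powRM ?divr_ge0.
    by rewrite /B /b; ring.
  have Ct : 'C(j, i)%:R * t = j`!%:R / q`!%:R * (j - i).+1%:R.
    rewrite /t -(bin_fact ij) factS !natrM.
    by field; rewrite lt0r_neq0.
  rewrite powE // [_ * (t * _)]mulrA Ct -[P`__ *+ _]mulr_natl.
  rewrite [leRHS](_ : _ = j`!%:R / q`!%:R * (j - i).+1%:R * T `^ (beta - 1) *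
    (P`_(j - i).+1 * (P ^+ q)`_i)); last by ring.
  apply: ler_wpM2r; first exact: mulr_ge0.
  apply: ler_wpM2l; first by rewrite mulr_ge0 ?divr_ge0.
  apply: ge0_ler_powR; [by rewrite subr_ge0|by rewrite nnegrE ltW|by rewrite nnegrE ltW|].
  rewrite /t /T ler_pdivlMr // [X in X <= _](_ : _ = (i`! * (j - i).+1`! * q.+1)%:R); last first.
    by rewrite factS !natrM; field; rewrite lt0r_neq0.
  (* What remains is q + 1 <= C(j+1, i), true because q <= i and C(j+1, i) >= C(i+1, i) = i + 1. *)
  rewrite ler_nat -subSn // -(@bin_fact j.+1 i (leqW ij)) mulnC leq_mul2r; apply/orP; right.
  apply: leq_trans (_ : i.+1 <= _)%N; first by rewrite ltnS.
  by rewrite -[X in (X <= _)%N]binSn leq_bin2l.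
rewrite -mulr_sumr.
have -> : \sum_(i < j.+1) (P`_(j - i).+1 *+ (j - i).+1) * (P ^+ q)`_i =
    (P ^+ q.+1)`_j.+1 *+ j.+1 / q.+1%:R.
  have := congr1 (fun r : {poly R} => r`_j) (deriv_exp P q.+1).
  rewrite coef_deriv coefMn mulrC coefM /= => ->.
  under [in RHS]eq_bigr do rewrite coef_deriv.
  rewrite -[X in _ = X / _]mulr_natr mulfK ?pnatr_eq0 //.
  by apply: eq_bigr => i _; exact: mulrC.
rewrite /B -/T powE // -mulr_natl /T !factS !natrM le_eqVlt.
by apply/orP; left; apply/eqP; field; rewrite !lt0r_neq0 // ltr0n.
Qed.

(** The sum over q in [maj_comp] has three parts: q = 0 contributes at order 0 only; q = 1 uses the
    small bound [eps] on first derivatives; the terms q >= 2 are dominated by a geometric series of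
    ratio 8 n C A <= 1/2, which leaves a contribution quadratic in A. *)
Lemma maj_gevrey_comp d n (O : set 'cV[R]_d) (U : set 'cV[R]_n) (g : 'cV[R]_n -> R)
    (M C eps b0 : R) (X : 'cV[R]_d -> 'cV[R]_n) k :
  open O -> (forall x, O x -> U (X x)) -> 0 <= M -> 0 <= C -> 0 <= eps ->
  (forall s x, U x -> differentiable (iter_partial s g) x /\
     `|iter_partial s g x| <= M * C ^+ size s * (size s)`!%:R `^ beta) ->
  (forall l x, U x -> `|partial l g x| <= eps) ->
  16 * n%:R * C * A <= 1 -> (k < N)%N ->
  (forall l, maj k O Num.norm (fun x => X x l 0)
     (fun j => if j == 0%N then b0
               else j`!%:R `^ beta * (A * rho ^+ j / j%:R ^+ 2))) ->
  maj k O Num.norm (g \o X)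
     (fun j => if j == 0%N then M
               else j`!%:R `^ beta * (rho ^+ j / j%:R ^+ 2) *
                    (eps * n%:R * A + 16 * M * (n%:R * C * A) ^+ 2)).
Proof.
move=> oO OU M0 C0 eps0 Hg Hg1 small kN HX.
pose G q := if q == 1%N then eps else M * C ^+ q * q`!%:R `^ beta.
have G0 q : 0 <= G q.
  by rewrite /G; case: eqP => // _; rewrite !mulr_ge0 ?exprn_ge0 ?powR_ge0.
have HX' l : maj k O Num.norm (fun x => X x l 0) (fun j => if j == 0%N then b0 else b j).
  apply: maj_le (HX l) => j jk; case: eqP => // _.
  by rewrite /b coef_poly (leq_ltn_trans jk kN).
have HG s x : U x -> differentiable (iter_partial s g) x /\
    `|iter_partial s g x| <= G (size s).
  move=> Ux; have [d1 d2] := Hg s x Ux; split=> //; rewrite /G.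
  case: s d1 d2 => [|i [|? ?]] //= _ _; exact: Hg1.
have B00 : B 0 0 = 1 by rewrite /B expr0 coef1 mulr1 divr1 powR1.
have b'E j : (if j.+1 == 0%N then b0 else b j.+1) = b j.+1 by [].
have := @maj_comp R d n O U g G X (fun j => if j == 0%N then b0 else b j) B k
  oO OU HG G0 B_ge0 B00 B_rec HX'.
apply: maj_le => -[|j] jk.
  by rewrite big_ord1 B00 /G /= !expr0 !mulr1 powR1 mulr1.
rewrite [_ == _]/=.
have Q0 : 0 <= j.+1`!%:R `^ beta * (rho ^+ j.+1 / j.+1%:R ^+ 2).
  by rewrite mulr_ge0 ?powR_ge0 ?divr_ge0 ?exprn_ge0.
set Q := (X in 0 <= X) in Q0 *.
set th := 8 * (n%:R * C * A).
have th0 : 0 <= th by rewrite !mulr_ge0.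
have th1 : th <= 2^-1 by rewrite /th; lra.
rewrite 2!big_ord_recl /= /bump /=.
have -> : B 0 j.+1 = 0 by rewrite /B expr0 coef1 mulr0.
rewrite mulr0 add0r mulrDr; apply: lerD.
  rewrite /G /= expr1 /B addn0 divr1 expr1.
  apply: le_trans (_ : eps * n%:R * (j.+1`!%:R `^ beta * p j.+1) <= _).
    by rewrite ler_wpM2l ?mulr_ge0 // ler_wpM2l ?powR_ge0 //; exact: P_le.
  by rewrite /Q /p le_eqVlt; apply/orP; left; apply/eqP; ring.
apply: le_trans (_ : \sum_(i < j) Q * (8 * M * (n%:R * C * A) ^+ 2) * th ^+ i <= _); last first.
  rewrite -mulr_sumr; apply: le_trans (ler_wpM2l _ (geo_sum_le2 j th0 th1)) _.
    by rewrite !mulr_ge0 ?exprn_ge0 ?mulr_ge0.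
  by rewrite /Q le_eqVlt; apply/orP; left; apply/eqP; ring.
apply: ler_sum => q _; rewrite !add1n /G /=.
set r := q.+2; have -> : M * C ^+ r * r`!%:R `^ beta * n%:R ^+ r * B r j.+1 =
  M * C ^+ r * n%:R ^+ r * j.+1`!%:R `^ beta * (P ^+ r)`_j.+1.
  have -> : j.+1`!%:R `^ beta = r`!%:R `^ beta * (j.+1`!%:R / r`!%:R) `^ beta.
    by rewrite -powRM ?divr_ge0 // [r`!%:R * _]mulrC divfK // lt0r_neq0.
  by rewrite /B; ring.
apply: le_trans (ler_wpM2l _ (PX_le q.+1 j.+1)) _.
  apply: mulr_ge0; last exact: powR_ge0.
  apply: mulr_ge0; last exact: exprn_ge0.
  by apply: mulr_ge0 => //; exact: exprn_ge0.
rewrite /Q /th !exprMn /r !exprS le_eqVlt; apply/orP; left; apply/eqP; ring.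
Qed.

End GevreyComposition.

(** * Differential calculus in coordinates *)

Section Smooth.
Context {R : realType}.

(** The intermediate point is a fraction [t] of the increment [s], which treats both signs of [s]
    alike. *)
Lemma mvt_dir (V : normedModType R) (f : V -> R) (p e : V) (s : R) :
  (forall t, 0 <= t <= 1 -> derivable f ((t * s) *: e + p) e) ->
  exists2 t, 0 <= t <= 1 & f (s *: e + p) - f p = s * 'D_e f ((t * s) *: e + p).
Proof.
pose psi (t : R) := f (t *: e + p).
have dpsi t : derivable f (t *: e + p) e ->
    is_derive t 1 psi ('D_e f (t *: e + p)).
  move=> df; have E : (fun h : R => h^-1 *: ((psi \o shift t) (h *: 1) - psi t)) =
      (fun h : R => h^-1 *: ((f \o shift (t *: e + p)) (h *: e) - f (t *: e + p))).
    by rewrite funeqE => h /=; rewrite /psi [_%:A]mulr1 scalerDl addrA.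
  by apply: DeriveDef; rewrite /derivable /derive E.
have psi_cont (a b : R) : (forall t, t \in `[a, b] -> derivable f (t *: e + p) e) ->
    {within `[a, b], continuous psi}.
  by move=> H; apply: derivable_within_continuous => t /H /dpsi [].
move=> H; have f0 : f p = psi 0 by rewrite /psi scale0r add0r.
have [s0|s0|s0] := ltgtP 0 s.
- have der t : t \in `[0, s] -> derivable f (t *: e + p) e.
    rewrite in_itv /= => /andP[t0 ts].
    have := H (t / s); rewrite divfK ?gt_eqF // divr_ge0 ?(ltW s0) //=.
    by rewrite ler_pdivrMr // mul1r; exact.
  have [|c] := @MVT_segment R psi (fun t => 'D_e f (t *: e + p)) 0 s (ltW s0) _ (psi_cont _ _ der).
    by move=> t /subset_itv_oo_cc /der /dpsi.
  rewrite in_itv /= => /andP[c0 cs] E; exists (c / s).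
    by rewrite divr_ge0 ?(ltW s0) //= ler_pdivrMr // mul1r.
  by rewrite f0 -[f _]/(psi s) E divfK ?gt_eqF // subr0 mulrC.
- have der t : t \in `[s, 0] -> derivable f (t *: e + p) e.
    rewrite in_itv /= => /andP[ts t0].
    have := H (t / s); rewrite divfK ?lt_eqF //; apply.
    by rewrite -mulrNN -invrN divr_ge0 ?oppr_ge0 ?(ltW s0) //= ler_pdivrMr ?oppr_gt0 // mul1r lerN2.
  have [|c] := @MVT_segment R psi (fun t => 'D_e f (t *: e + p)) s 0 (ltW s0) _ (psi_cont _ _ der).
    by move=> t /subset_itv_oo_cc /der /dpsi.
  rewrite in_itv /= => /andP[cs c0] E; exists (c / s).
    by rewrite -mulrNN -invrN divr_ge0 ?oppr_ge0 ?(ltW s0) //= ler_pdivrMr ?oppr_gt0 // mul1r lerN2.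
  by rewrite f0 -[f _]/(psi s) -opprB E divfK ?lt_eqF // sub0r mulrN opprK mulrC.
- exists 0; first by rewrite lexx ler01.
  by rewrite -s0 mul0r scale0r add0r subrr.
Qed.

Lemma differentiable_eps (V W : normedModType R) (f : V -> W) a (L : {linear V -> W}) :
  continuous L ->
  (forall eps, 0 < eps -> \forall h \near (0 : V), `|f (h + a) - f a - L h| <= eps * `|h|) ->
  differentiable f a.
Proof.
move=> cL H.
have E : f \o shift a = cst (f a) + L +o_ (0 : V) id.
  apply/eqaddoP => eps eps0; have := H _ eps0.
  by apply: filterS => h /=; rewrite !fctE opprD addrA.
by apply/diff_locallyP; rewrite (diff_unique cL E).
Qed.

Lemma differentiable_epsE (V W : normedModType R) (f : V -> W) a eps :
  differentiable f a -> 0 < eps ->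
  \forall h \near (0 : V), `|f (h + a) - f a - 'd f a h| <= eps * `|h|.
Proof.
move=> /diff_locallyP [_ /eqaddoP H] eps0; have := H _ eps0.
by apply: filterS => h /=; rewrite !fctE opprD addrA.
Qed.

Lemma cV_entry_le n (x : 'cV[R]_n) i : `|x i 0| <= `|x|.
Proof.
rewrite [leRHS]/Num.Def.normr /= mx_normrE.
exact: (le_bigmax _ (fun ij : 'I_n * 'I_1 => `|x ij.1 ij.2|) (i, 0)).
Qed.

Lemma cV_norm_le n (x : 'cV[R]_n) c : 0 <= c -> (forall i, `|x i 0| <= c) -> `|x| <= c.
Proof.
move=> c0 H; rewrite [leLHS]/Num.Def.normr /= mx_normrE.
by apply: bigmax_le => // -[i j] _ /=; rewrite (ord1 j).
Qed.

Lemma cV_linear_bounded n (W : normedModType R) (L : {linear 'cV[R]_n -> W}) :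
  exists2 c : R, 0 <= c & forall x, `|L x| <= c * `|x|.
Proof.
exists (\sum_i `|L (delta_mx i 0)|) => [|x]; first exact: sumr_ge0.
rewrite {1}[x]matrix_sum_delta linear_sum mulr_suml.
apply: le_trans (ler_norm_sum _ _ _) _; apply: ler_sum => i _.
by rewrite big_ord1 linearZ normrZ mulrC ler_wpM2l // cV_entry_le.
Qed.

Lemma cV_linear_continuous n (W : normedModType R) (L : {linear 'cV[R]_n -> W}) :
  continuous L.
Proof.
apply/bounded_linear_continuous/bounded_funP => r.
have [c c0 H] := cV_linear_bounded L; exists (c * r) => x xr.
by apply: le_trans (H x) _; rewrite ler_wpM2l.
Qed.

Lemma norm_delta_mx n (i : 'I_n) : `|delta_mx i 0 : 'cV[R]_n| <= 1.
Proof. by apply: cV_norm_le => // j; rewrite mxE eqxx andbT; case: eqP; rewrite ?normr1 ?normr0. Qed.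

(** The increment is cut into moves parallel to the axes. The corners [tr k] stay in the ball
    because replacing coordinates by 0 does not increase the maximum norm. *)
Lemma mean_value_coords n (f : 'cV[R]_n -> R) a r v :
  (forall x, ball a r x -> forall i, derivable f x (delta_mx i 0)) -> `|v| < r ->
  exists2 c : 'I_n -> 'cV[R]_n, (forall i, ball a r (c i)) &
    f (v + a) - f a = \sum_i v i 0 * partial i f (c i).
Proof.
move=> df vr.
pose tr k : 'cV[R]_n := \col_i (if (i < k)%N then v i 0 else 0).
have trS (i : 'I_n) : tr i.+1 = v i 0 *: delta_mx i 0 + tr i.
  apply/matrixP => j l; rewrite (ord1 l) !mxE eqxx andbT ltnS leq_eqVlt.
  have [->|ji] := eqVneq j i; first by rewrite eqxx ltnn mulr1 addr0.
  by rewrite mulr0 add0r (_ : (j == i :> nat) = false) //; apply/negbTE.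
have trn : tr n = v by apply/matrixP => j l; rewrite (ord1 l) !mxE ltn_ord.
have tr0 : tr 0%N = 0 by apply/matrixP => j l; rewrite !mxE.
have step (i : 'I_n) : exists c, ball a r c /\
    f (tr i.+1 + a) - f (tr i + a) = v i 0 * partial i f c.
  have inb t : 0 <= t <= 1 -> ball a r ((t * v i 0) *: delta_mx i 0 + (tr i + a)).
    move=> /andP[t0 t1]; rewrite -ball_normE /= distrC addrA addrK.
    apply: le_lt_trans vr; apply: cV_norm_le => // j; rewrite !mxE eqxx andbT.
    have [->|_] := eqVneq j i.
      rewrite ltnn mulr1 addr0 normrM ger0_norm //.
      by apply: le_trans (cV_entry_le v i); rewrite ler_piMl.
    by rewrite mulr0 add0r; case: ifP => _; rewrite ?normr0 // cV_entry_le.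
  have [|t t01 E] := @mvt_dir _ f (tr i + a) (delta_mx i 0) (v i 0).
    by move=> t /inb /df /(_ i).
  exists ((t * v i 0) *: delta_mx i 0 + (tr i + a)); split; first exact: inb.
  by rewrite trS -[_ + tr i + a]addrA E.
exists (fun i => projT1 (cid (step i))) => [i|]; first by case: cid => /= c [].
rewrite (eq_bigr (fun i : 'I_n => f (tr i.+1 + a) - f (tr i + a))) => [|i _]; last first.
  by case: cid => /= c [].
rewrite -(big_mkord xpredT (fun i => f (tr i.+1 + a) - f (tr i + a))) telescope_sumr //.
by rewrite trn tr0 add0r.
Qed.

(** Mean values along the axes give a Lipschitz estimate at [a]. This supplies the continuity
    required by [smooth_on] for limits of which only derivatives and their bounds are known. *)
Lemma bounded_partials_continuous n (f : 'cV[R]_n -> R) a B :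
  (\forall x \near a, forall i, derivable f x (delta_mx i 0) /\ `|partial i f x| <= B) ->
  {for a, continuous f}.
Proof.
move=> /nbhs_ballP[r /= r0 H].
have B0 : 0 <= `|B| by [].
apply/(@cvgrPdist_le _ _ _ (nbhs a)) => e e0.
have : \forall x \near a, ball a (Num.min r (e / (n%:R * `|B| + 1))) x.
  by apply: nbhsx_ballx; rewrite lt_min r0 divr_gt0 // ltr_wpDl ?mulr_ge0.
apply: filterS => x; rewrite -ball_normE /= distrC lt_min => /andP[xr xe].
have [|c cr] := @mean_value_coords n f a r (x - a) _ xr; first by move=> y /H + i => /(_ i) [].
rewrite subrK distrC => ->.
apply: (@le_trans _ _ (\sum_(i < n) `|x - a| * `|B|)).
  apply: le_trans (ler_norm_sum _ _ _) _; apply: ler_sum => i _.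
  rewrite normrM ler_pM //; first exact: cV_entry_le.
  have [_ h] := H _ (cr i) i; exact: le_trans h (ler_norm _).
rewrite sumr_const card_ord -mulr_natl mulrCA.
have D : 0 < n%:R * `|B| + 1 by rewrite ltr_wpDl ?mulr_ge0.
apply: (@le_trans _ _ (e / (n%:R * `|B| + 1) * (n%:R * `|B|))).
  by rewrite ler_wpM2r ?mulr_ge0 // ltW.
by rewrite mulrAC ler_pdivrMr // ler_wpM2l ?ltW // ltrDl.
Qed.

Lemma continuous_partials_differentiable n (f : 'cV[R]_n -> R) a :
  (\forall x \near a, forall i, derivable f x (delta_mx i 0)) ->
  (forall i, {for a, continuous (partial i f)}) ->
  differentiable f a.
Proof.
move=> df cf.
pose L0 (v : 'cV[R]_n) : R := \sum_i v i 0 * partial i f a.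
have linL0 : linear L0.
  move=> c u v; rewrite /L0 scaler_sumr -big_split /=; apply: eq_bigr => i _.
  by rewrite !mxE mulrDl -mulrA.
pose L : {linear 'cV[R]_n -> R} := HB.pack L0 (GRing.isLinear.Build _ _ _ _ L0 linL0).
apply: (@differentiable_eps _ _ f a L); first exact: cV_linear_continuous.
move=> eps eps0; pose eps' := eps / n.+1%:R.
have eps'0 : 0 < eps' by rewrite divr_gt0.
have near_a : \forall x \near a, forall i, derivable f x (delta_mx i 0) /\
    `|partial i f x - partial i f a| <= eps'.
  apply: filter_app df; have : \forall x \near a, forall i, `|partial i f x - partial i f a| <= eps'.
    have H (i : 'I_n) : \forall x \near a, `|partial i f x - partial i f a| <= eps'.
      have /cvgrPdist_le /(_ _ eps'0) H := cf i.
      by near=> x; rewrite distrC; near: x; exact: H.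
    exact: filter_forall H.
  by apply: filterS => x H1 H2 i; split.
move: near_a => /nbhs_ballP[r /= r0 Hr].
apply/nbhs_ballP; exists r => //= v; rewrite -ball_normE /= sub0r normrN => vr.
have [|c cr ->] := @mean_value_coords n f a r v _ vr; first by move=> x /Hr + i => /(_ i) [].
rewrite /L0 -sumrB; apply: le_trans (ler_norm_sum _ _ _) _.
apply: (@le_trans _ _ (\sum_(i < n) eps' * `|v|)).
  apply: ler_sum => i _; rewrite -mulrBr normrM mulrC ler_pM //; last exact: cV_entry_le.
  by have [_] := Hr _ (cr i) i.
rewrite sumr_const card_ord -mulr_natl mulrA ler_wpM2r //.
by rewrite /eps' mulrCA ler_piMr ?(ltW eps0) // ler_pdivrMr // mul1r ler_nat.
Unshelve. all: by end_near. Qed.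

(** The second difference [D] is symmetric in the two directions and, divided by t^2, tends to the
    mixed derivative in either order. The mean value theorem is applied in one direction; the other
    is handled by differentiability of a first partial at [a]. *)
Lemma schwarz n (f : 'cV[R]_n -> R) a i j :
  (\forall x \near a, forall i, derivable f x (delta_mx i 0)) ->
  (forall i, differentiable (partial i f) a) ->
  partial j (partial i f) a = partial i (partial j f) a.
Proof.
move=> df d2.
pose D (t : R) (i j : 'I_n) := f (t *: delta_mx i 0 + (t *: delta_mx j 0 + a)) -
   f (t *: delta_mx j 0 + a) - (f (t *: delta_mx i 0 + a) - f a).
suff H (i0 j0 : 'I_n) eps : 0 < eps -> \forall t \near 0^'+,
    `|D t i0 j0 - t ^+ 2 * partial j0 (partial i0 f) a| <= eps * t ^+ 2.
  apply/eqP; rewrite -subr_eq0 -normr_le0; apply/ler_addgt0Pr => eps eps0.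
  have e2 : 0 < eps / 2 by rewrite divr_gt0.
  have [t [[H1 H2] t0]] : exists t, (`|D t i j - t ^+ 2 * partial j (partial i f) a| <= eps / 2 * t ^+ 2 /\
      `|D t j i - t ^+ 2 * partial i (partial j f) a| <= eps / 2 * t ^+ 2) /\ 0 < t.
    apply: (@filter_ex _ (0 : R)^'+); apply: filterI; last exact: nbhs_right_gt.
    by apply: filterI; [exact: (H i j _ e2)|exact: (H j i _ e2)].
  have DC : D t i j = D t j i by rewrite /D addrCA; ring.
  rewrite DC in H1; rewrite add0r -(ler_pM2r (exprn_gt0 2 t0)).
  move: H1 H2; move: (D t j i) (partial j (partial i f) a) (partial i (partial j f) a).
  move=> z u v H1 H2.
  have -> : `|u - v| * t ^+ 2 = `|(z - t ^+ 2 * v) - (z - t ^+ 2 * u)|.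
    by rewrite -[X in _ * X]gtr0_norm ?exprn_gt0 // -normrM; congr `|_|; ring.
  by apply: le_trans (ler_normB _ _) _; apply: le_trans (lerD H2 H1) _; rewrite -mulrDl -splitr.
(* Differentiability is used at two vectors, of norm at most 2 t and t, hence the 3. *)
move=> eps0; have e6 : 0 < eps / 3 by rewrite divr_gt0.
have /nbhs_ballP[r2 /= r20 Hr2] := differentiable_epsE (d2 i0) e6.
move: df => /nbhs_ballP[r1 /= r10 Hr1].
near=> t.
have t0 : 0 < t by near: t; exact: nbhs_right_gt.
have tr1 : t * 2 < r1 by rewrite -ltr_pdivlMr //; near: t; apply: nbhs_right_lt; rewrite divr_gt0.
have tr2 : t * 2 < r2 by rewrite -ltr_pdivlMr //; near: t; apply: nbhs_right_lt; rewrite divr_gt0.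
pose F x := f (x + t *: delta_mx j0 0) - f x.
have ne c (k : 'I_n) : 0 <= c <= 1 -> `|(c * t) *: delta_mx k 0 : 'cV[R]_n| <= t.
  move=> /andP[c0 c1]; rewrite normrZ -[leRHS]mulr1 ler_pM ?norm_delta_mx //.
  by rewrite ger0_norm ?mulr_ge0 ?(ltW t0) // ler_piMl ?(ltW t0).
have nt (k : 'I_n) : `|t *: delta_mx k 0 : 'cV[R]_n| <= t.
  by have := ne 1 k; rewrite mul1r; apply; rewrite ler01 lexx.
have dF c : 0 <= c <= 1 -> is_derive ((c * t) *: delta_mx i0 0 + a) (delta_mx i0 0) F
    (partial i0 f ((c * t) *: delta_mx i0 0 + a + t *: delta_mx j0 0) -
     partial i0 f ((c * t) *: delta_mx i0 0 + a)).
  move=> c01; set p := _ + a.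
  have d1 : derivable f p (delta_mx i0 0).
    apply: Hr1; rewrite -ball_normE /= distrC addrK.
    by apply: le_lt_trans (ne _ _ c01) _; lra.
  have d2' : derivable f (p + t *: delta_mx j0 0) (delta_mx i0 0).
    apply: Hr1; rewrite -ball_normE /= distrC addrAC addrK.
    apply: le_lt_trans (ler_normD _ _) _; apply: le_lt_trans (lerD (ne _ _ c01) (nt _)) _.
    by lra.
  apply: is_deriveB; last exact/derivableP.
  have E : (fun h : R => h^-1 *: (((fun x => f (x + t *: delta_mx j0 0)) \o shift p) (h *: delta_mx i0 0) - f (p + t *: delta_mx j0 0))) =
      (fun h : R => h^-1 *: ((f \o shift (p + t *: delta_mx j0 0)) (h *: delta_mx i0 0) - f (p + t *: delta_mx j0 0))).
    by rewrite funeqE => h /=; rewrite -(addrA (h *: _) p).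
  by apply: DeriveDef; [rewrite /derivable E; exact: d2'|rewrite /partial /derive E].
have [c /dF []|c c01 E] := @mvt_dir _ F a (delta_mx i0 0) t; first by [].
have -> : D t i0 j0 = t * 'D_(delta_mx i0 0) F ((c * t) *: delta_mx i0 0 + a).
  rewrite -E /D /F -(addrA (t *: _) a) ![a + _]addrC.
  by move: (f _) (f _) (f _) (f _) => *; ring.
rewrite (@derive_val _ _ _ _ _ _ _ (dF c c01)).
set u := (c * t) *: delta_mx i0 0.
have nu1 : `|u| <= t by exact: ne.
have ub : ball (0 : 'cV[R]_n) r2 u by rewrite -ball_normE /= sub0r normrN; lra.
have nu2 : `|u + t *: delta_mx j0 0| <= t * 2.
  by apply: le_trans (ler_normD _ _) _; apply: le_trans (lerD nu1 (nt _)) _; lra.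
have ub2 : ball (0 : 'cV[R]_n) r2 (u + t *: delta_mx j0 0).
  by rewrite -ball_normE /= sub0r normrN; lra.
have G1 := Hr2 _ ub; have G2 := Hr2 _ ub2.
have -> : partial j0 (partial i0 f) a = 'd (partial i0 f) a (delta_mx j0 0).
  by rewrite /partial deriveE //; exact: d2.
rewrite -addrA [a + _]addrC addrA.
clearbody u; move: G1 G2; rewrite /= linearD linearZ /=.
set q := partial i0 f (u + _ + a); set q1 := partial i0 f (u + a).
set q0 := partial i0 f a; set l := 'd _ a u; set l' := 'd _ a (delta_mx j0 0).
move=> G1 G2.
rewrite [X in `|X|](_ : _ = t * ((q - q0 - (l + t *: l')) - (q1 - q0 - l))); last first.
  by rewrite -[t *: l']/(t * l'); ring.
rewrite normrM gtr0_norm // expr2 mulrA mulrC ler_wpM2r ?(ltW t0) //.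
apply: le_trans (ler_normB _ _) _; apply: le_trans (lerD G2 G1) _.
rewrite -mulrDr; apply: le_trans (ler_wpM2l (ltW e6) (lerD nu2 nu1)) _; lra.
Unshelve. all: by end_near. Qed.

End Smooth.

(** * Words of partial derivatives, and limits of smooth functions *)

Section SmoothWords.
Context {R : realType}.

Lemma smooth_on_differentiable n (U : set 'cV[R]_n) f s x :
  open U -> smooth_on U f -> U x -> differentiable (iter_partial s f) x.
Proof.
move=> oU sf Ux; apply: continuous_partials_differentiable => [|i].
  have : nbhs x U by exact: open_nbhs_nbhs.
  by apply: filterS => y Uy i; have [_] := sf s y Uy.
by have [] := sf (i :: s) x Ux.
Qed.

Lemma partial_ext n (U : set 'cV[R]_n) (f f' : 'cV[R]_n -> R) i x :
  open U -> (forall y, U y -> f y = f' y) -> U x -> partial i f x = partial i f' x.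
Proof.
move=> oU ff' Ux; apply: near_eq_derive.
by apply: filterS (open_nbhs_nbhs (conj oU Ux)).
Qed.

Lemma iter_partial_perm n (U : set 'cV[R]_n) f s t :
  open U -> smooth_on U f -> perm_eq s t ->
  forall x, U x -> iter_partial s f x = iter_partial t f x.
Proof.
move=> oU sf.
have swap i s1 s2 : forall x, U x ->
    iter_partial (s1 ++ i :: s2) f x = iter_partial (i :: s1 ++ s2) f x.
  elim: s1 => [//|a s1 IH] x Ux; rewrite /=.
  rewrite (partial_ext a oU IH Ux) /=; apply: schwarz => [|l].
    have : nbhs x U by exact: open_nbhs_nbhs.
    by apply: filterS => y Uy l; have [_] := sf (s1 ++ s2) y Uy.
  exact: (@smooth_on_differentiable _ U f (l :: s1 ++ s2) x oU sf Ux).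
elim: s t => [|i s IH] t st x Ux; first by rewrite perm_sym in st; move/perm_nilP: st => ->.
have it : i \in t by rewrite -(perm_mem st) mem_head.
move: st; case/splitPr: it => t1 t2 st.
rewrite swap //=; apply: partial_ext (oU) _ Ux; apply: IH.
by move: st; rewrite -cat1s perm_sym -[i :: t2]cat1s perm_catCA perm_cat2l perm_sym.
Qed.

(** The Gevrey condition concerns one ordered word per multi-index, while the chain rule produces
    arbitrary words; symmetry of derivatives bridges the two. *)
Lemma multi_partial_count n (U : set 'cV[R]_n) f s x :
  open U -> smooth_on U f -> U x ->
  iter_partial s f x = multi_partial (fun i => count_mem i s) f x /\
  multi_order (fun i => count_mem i s) = size s.
Proof.
move=> oU sf Ux; set w := flatten [seq nseq (count_mem i s) i | i <- enum 'I_n].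
have sw : perm_eq s w.
  apply/allP => j _ /=; apply/eqP; rewrite /w count_flatten -map_comp.
  rewrite sumnE big_map big_enum /= (bigD1 j) //= count_nseq /= eqxx mul1n.
  rewrite big1 ?addn0 // => i ij; rewrite count_nseq /=.
  by rewrite (negbTE ij) mul0n.
split; first exact: (iter_partial_perm oU sf sw).
rewrite (perm_size sw) size_flatten /shape -map_comp sumnE big_map big_enum /=.
by apply: eq_bigr => i _; rewrite size_nseq.
Qed.

Lemma compact_closed_ball_cV n (r : R) : compact [set x : 'cV[R]_n | `|x| <= r].
Proof.
have E : forall m p (v : 'M[R]_(m, p)), `|v^T| = `|v|.
  have le m p (v : 'M[R]_(m, p)) : `|v^T| <= `|v|.
    have := normr_ge0 v; rewrite ![`|_|]/Num.Def.normr /= !mx_normrE => v0.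
    apply: bigmax_le => // -[i j] _ /=; rewrite mxE.
    exact: (le_bigmax _ (fun ij : 'I_m * 'I_p => `|v ij.1 ij.2|) (j, i)).
  by move=> m p v; apply/eqP; rewrite eq_le le -{1}[v]trmxK le.
have -> : [set x : 'cV[R]_n | `|x| <= r] = trmx @` [set x : 'rV[R]_n | `|x| <= r].
  apply/seteqP; split=> [x /= xr|_ [x /= xr <-]]; last by rewrite /= E.
  by exists x^T; rewrite ?E ?trmxK.
apply: continuous_compact.
  apply: continuous_subspaceT => x; apply/(@cvgrPdist_le _ _ _ (nbhs x)) => e e0.
  have : \forall y \near x, ball x e y by exact: nbhsx_ballx.
  by apply: filterS => y; rewrite -ball_normE /= -linearB E => /ltW.
apply: bounded_closed_compact.
  exists r; split; first exact: num_real.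
  by move=> M rM x /= xr; apply: le_trans xr (ltW rM).
have -> : [set x : 'rV[R]_n | `|x| <= r] = Num.norm @^-1` [set t | t <= r] by [].
by apply: closed_comp => [x _|]; [exact: norm_continuous|exact: closed_le].
Unshelve. all: by end_near. Qed.

Lemma gevrey_words n beta (U : set 'cV[R]_n) f r :
  open U -> gevrey_on beta U f -> [set x | `|x| <= r] `<=` U ->
  exists M C : R, [/\ 0 <= M, 0 <= C & forall s x, `|x| <= r ->
    differentiable (iter_partial s f) x /\
    `|iter_partial s f x| <= M * C ^+ size s * (size s)`!%:R `^ beta].
Proof.
move=> oU [sf gf] rU; have [M [C H]] := gf _ (compact_closed_ball_cV (r := r)) rU.
exists `|M|, `|C|; split=> // s x xr; split.
  exact: smooth_on_differentiable (rU _ xr).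
have [E1 E2] := multi_partial_count s oU sf (rU _ xr).
rewrite E1; apply: le_trans (H _ _ xr) _; rewrite E2 ler_wpM2r ?powR_ge0 //.
by apply: le_trans (ler_norm _) _; rewrite normrM normrX.
Qed.

Lemma lipschitz_partial n (f : 'cV[R]_n -> R) (eps : R) (x y : 'cV[R]_n) :
  (forall t, 0 <= t <= 1 -> differentiable f (t *: (x - y) + y) /\
     forall i, `|partial i f (t *: (x - y) + y)| <= eps) ->
  `|f x - f y| <= n%:R * eps * `|x - y|.
Proof.
move=> H.
have [t t01|t t01 E] := @mvt_dir R _ f y (x - y) 1.
  by rewrite mulr1; apply: diff_derivable; have [] := H t t01.
move: E; rewrite scale1r subrK mul1r mulr1 => ->.
have [] := H t t01; move: (t *: (x - y) + y) => p d e.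
rewrite deriveE // {1}[x - y]matrix_sum_delta linear_sum.
rewrite (_ : n%:R * eps * `|x - y| = \sum_(i < n) eps * `|x - y|); last first.
  by rewrite sumr_const card_ord -[RHS]mulr_natl mulrA.
apply: le_trans (ler_norm_sum _ _ _) _; apply: ler_sum => i _.
rewrite big_ord1 linearZ normrM mulrC ler_pM //; last exact: cV_entry_le.
by have := e i; rewrite /partial deriveE.
Qed.

Lemma maj_partial d (O : set 'cV[R]_d) k f phi s :
  (forall k, maj k O Num.norm f phi) ->
  maj k O Num.norm (iter_partial s f) (fun j => phi (size s + j)%N).
Proof.
(* [maj] strips the innermost derivative first, and that is the last letter of the word. *)
move=> H; elim/last_ind: s f phi H => [|s i IH] f phi H; first exact: H.
rewrite /iter_partial foldr_rcons size_rcons.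
apply: (IH _ (phi \o S)) => k'; have [_ /(_ i) []] := H k'.+1; by [].
Qed.

(* Bounds on the second derivatives make the difference quotients converge
   uniformly in m, so that pointwise convergence passes to the partial
   derivatives, and then to those of all orders by induction. *)
Lemma lim_partial d (O : set 'cV[R]_d) (f_ : nat -> 'cV[R]_d -> R) f phi :
  open O -> (forall m k, maj k O Num.norm (f_ m) phi) ->
  (forall x, O x -> (f_ m x @[m --> \oo] --> f x)) ->
  forall i x, O x -> derivable f x (delta_mx i 0) /\
    (partial i (f_ m) x @[m --> \oo] --> partial i f x).
Proof.
move=> oO Hm Hf i x Ox.
have [r /= r0 rO] : exists2 r : R, 0 < r & ball x r `<=` O.
  by have /nbhs_ballP[r r0 rO] := open_nbhs_nbhs (conj oO Ox); exists r.
have phi2 : 0 <= phi 2%N.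
  have [_ /(_ i) [_ [_ /(_ i) [_ [H _]]]]] := Hm 0%N 2%N.
  exact: le_trans (H x Ox).
have inb c : `|c| < r -> O (c *: delta_mx i 0 + x).
  move=> cr; apply: rO; rewrite -ball_normE /= distrC addrK normrZ.
  by apply: le_lt_trans cr; rewrite ler_piMr // norm_delta_mx.
have taylor m t : `|t| < r ->
    `|f_ m (t *: delta_mx i 0 + x) - f_ m x - t * partial i (f_ m) x| <= phi 2%N * t ^+ 2.
  move=> tr; have [_ /(_ i) [D1 [_ /(_ i) [D2 [B2 _]]]]] := Hm m 2%N.
  have ts s : 0 <= s <= 1 -> `|s * t| <= `|t|.
    by move=> /andP[s0 s1]; rewrite normrM ger0_norm // ler_piMl.
  have [s s01|s s01 ->] := @mvt_dir R _ (f_ m) x (delta_mx i 0) t.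
    by apply: D1; apply: inb; apply: le_lt_trans tr; exact: ts.
  have [s' s'01|s' s'01 E] := @mvt_dir R _ (partial i (f_ m)) x (delta_mx i 0) (s * t).
    apply: D2; apply: inb; apply: le_lt_trans tr; apply: le_trans (ts _ s01).
    by rewrite normrM ler_piMl // ger0_norm; case/andP: s'01.
  rewrite -mulrBr E normrM normrM -[t ^+ 2]real_normK ?num_real // mulrC expr2.
  rewrite mulrC [leRHS]mulrC -!mulrA ler_wpM2l //; apply: ler_pM => //; first exact: ts.
  apply: B2; apply: inb; apply: le_lt_trans tr; apply: le_trans (ts _ s01).
  by rewrite normrM ler_piMl // ger0_norm; case/andP: s'01.
have cauchyD : cvg (partial i (f_ m) x @[m --> \oo]).
  apply/cauchy_cvgP/cauchyP => e e0.
  (* First [t] is fixed so that two Taylor remainders cost less than e t / 2; then [N] is taken so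
     large that each of the four function values is within e t / 8 of its limit. *)
  near (0 : R)^'+ => t.
  have t0 : 0 < t by near: t; exact: nbhs_right_gt.
  have tr : `|t| < r by rewrite gtr0_norm //; near: t; exact: nbhs_right_lt.
  have te : phi 2%N * t * 2 < e / 2.
    have tP : t * (phi 2%N + 1) < e / 4.
      by rewrite -ltr_pdivlMr ?ltr_wpDl //; near: t; apply: nbhs_right_lt; rewrite !divr_gt0 // ltr_wpDl.
    by move: tP; rewrite mulrDr mulr1 [t * _]mulrC; lra.
  have et : 0 < e * t / 8 by rewrite divr_gt0 ?mulr_gt0.
  have /cvgrPdist_lt /(_ _ et) [N1 _ H1] := Hf x Ox.
  have /cvgrPdist_lt /(_ _ et) [N2 _ H2] := Hf _ (inb t tr).
  pose N := maxn N1 N2; exists (partial i (f_ N) x).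
  exists N => // m /= Nm; rewrite -ball_normE /=.
  have b1 p : (N <= p)%N -> `|f x - f_ p x| < e * t / 8.
    by move=> Np; apply: H1 => /=; apply: leq_trans Np; exact: leq_maxl.
  have b2 p : (N <= p)%N -> `|f (t *: delta_mx i 0 + x) - f_ p (t *: delta_mx i 0 + x)| < e * t / 8.
    by move=> Np; apply: H2 => /=; apply: leq_trans Np; exact: leq_maxr.
  have := taylor N t tr; have := taylor m t tr.
  have := b1 _ (leqnn N); have := b1 _ Nm; have := b2 _ (leqnn N); have := b2 _ Nm.
  set y := t *: _ + x.
  rewrite -(ltr_pM2l t0) -[X in X * `|_|]gtr0_norm // -normrM mulrBr.
  move: (f x) (f y) (f_ N x) (f_ N y) (f_ m x) (f_ m y) => a b c d' a' b'.
  move: (t * _) (t * _) => u v.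
  have : phi 2%N * t ^+ 2 * 2 < e / 2 * t by rewrite expr2; nra.
  move: (phi 2%N * t ^+ 2) => q; rewrite [t * e]mulrC.
  rewrite (_ : e / 2 * t = e * t / 2); last by ring.
  move: (e * t) => z; rewrite !ltr_norml !ler_norml; lra.
have := cauchyD; set l := lim _ => Hl.
suff H : h^-1 *: ((f \o shift x) (h *: delta_mx i 0) - f x) @[h --> 0^'] --> l.
  have E : partial i f x = l by apply/cvg_lim.
  by rewrite E; split; [apply/cvg_ex; exists l|exact: Hl].
apply/cvgrPdist_le => e e0; near=> h.
have h0 : h != 0 by near: h; exact: nbhs_dnbhs_neq.
have hr : `|h| < r by near: h; exact: dnbhs0_lt.
have he : phi 2%N * `|h| <= e.
  have : `|h| * (phi 2%N + 1) <= e.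
    by rewrite -ler_pdivlMr ?ltr_wpDl //; near: h; apply: dnbhs0_le; rewrite divr_gt0 // ltr_wpDl.
  by rewrite mulrDr mulr1 [`|h| * _]mulrC; have := normr_ge0 h; lra.
have T : `|f (h *: delta_mx i 0 + x) - f x - h * l| <= phi 2%N * h ^+ 2.
  have C : `|f_ m (h *: delta_mx i 0 + x) - f_ m x - h * partial i (f_ m) x| @[m --> \oo] -->
      `|f (h *: delta_mx i 0 + x) - f x - h * l|.
    apply: cvg_norm; apply: cvgB; last by apply: cvgM => //; exact: cvg_cst.
    by apply: cvgB; apply: Hf => //; exact: inb.
  apply: (cvgr_to_le C); near=> m; exact: taylor.
rewrite -(ler_pM2l (_ : 0 < `|h|)) ?normr_gt0 // -normrM mulrBr.
rewrite /= [h * (h^-1 *: _)]mulVKf // distrC; apply: le_trans T _.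
by rewrite -[h ^+ 2]real_normK ?num_real // expr2 mulrA mulrC ler_wpM2l.
Unshelve. all: by end_near. Qed.

Lemma lim_smooth_on d (O : set 'cV[R]_d) (f_ : nat -> 'cV[R]_d -> R) f phi :
  open O -> (forall m k, maj k O Num.norm (f_ m) phi) ->
  (forall x, O x -> (f_ m x @[m --> \oo] --> f x)) ->
  smooth_on O f /\ forall s x, O x -> `|iter_partial s f x| <= phi (size s).
Proof.
move=> oO Hm Hf.
have C s : forall x, O x -> (iter_partial s (f_ m) x @[m --> \oo] --> iter_partial s f x).
  elim: s => [//|i s IH] x Ox /=.
  by have [] := lim_partial oO (fun m k => maj_partial k s (Hm m)) IH i Ox.
have B s x : O x -> `|iter_partial s f x| <= phi (size s).
  move=> Ox; apply: (cvgr_to_le (cvg_norm (C s x Ox))); near=> m.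
  have [H _] := maj_partial 0 s (Hm m); by have := H x Ox; rewrite addn0.
split=> // s x Ox; split; last first.
  move=> i; by have [] := lim_partial oO (fun m k => maj_partial k s (Hm m)) (C s) i Ox.
apply: (@bounded_partials_continuous _ _ _ _ (phi (size s).+1)).
have : nbhs x O by exact: open_nbhs_nbhs.
apply: filterS => y Oy i; split; last exact: (B (i :: s)).
by have [] := lim_partial oO (fun m k => maj_partial k s (Hm m)) (C s) i Oy.
Unshelve. all: by end_near. Qed.

End SmoothWords.

(** * The discretized Lyapunov-Perron problem *)

Section Pinching.
Context {R : realType}.

(* D k = K0 * dl + R0 * (1 - dl * lam / 2) ^+ (K - k) is a strict
   supersolution of the two recursions, so the maximal ratio of the
   sequences to D cannot exceed 1. *)
Lemma pinching (a b : nat -> R) (K : nat) (dl lam eps H R0 : R) :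
  0 < dl -> 0 < lam -> dl * lam <= 1 -> 0 <= eps -> eps <= lam / 4 -> 0 <= H -> 0 <= R0 ->
  (forall k, (k <= K)%N -> a k <= R0 /\ b k <= R0) -> a 0%N <= 0 ->
  (forall k, (k < K)%N ->
     a k.+1 <= (1 - dl * lam) * a k + dl * eps * Num.max (a k) (b k) + H * dl ^+ 2) ->
  (forall k, (k < K)%N ->
     b k <= (1 - dl * lam) * b k.+1 + dl * eps * Num.max (a k) (b k) + H * dl ^+ 2) ->
  forall k, (k <= K)%N -> Num.max (a k) (b k) <=
    (4 * H / lam + 1) * dl + R0 * (1 - dl * lam / 2) ^+ (K - k).
Proof.
move=> dl0 lam0 dllam eps0 eps1 H0 R00 bnd a0 Ha Hb.
(* The summand 1 makes H dl^2 strictly smaller than dl lam / 4 times K0 dl, which is what turns the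
   inequalities below into strict ones. *)
set K0 := 4 * H / lam + 1; set q := 1 - dl * lam / 2.
have q0 : 0 < q by rewrite /q; lra.
have q1 : q <= 1 by rewrite /q; have := mulr_gt0 dl0 lam0; lra.
have K00 : 0 < K0 by rewrite /K0 ltr_wpDl // divr_ge0 // ?mulr_ge0 // ltW.
pose D k := K0 * dl + R0 * q ^+ (K - k).
have Dge k : K0 * dl <= D k by rewrite /D lerDl mulr_ge0 // exprn_ge0 // ltW.
have D0 k : 0 < D k by apply: lt_le_trans (Dge k); rewrite mulr_gt0.
have DS k : (k < K)%N -> q * D k.+1 <= D k <= D k.+1.
  move=> kK; rewrite /D -(subnSK kK) exprS.
  have E : 0 <= R0 * q ^+ (K - k.+1) by rewrite mulr_ge0 // exprn_ge0 // ltW.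
  have : 0 < K0 * dl by rewrite mulr_gt0.
  rewrite [R0 * (q * _)]mulrCA; move: (R0 * _) E (K0 * dl) => u u0 v v0.
  by apply/andP; split; nra.
pose M k := Num.max (a k) (b k).
have [k0 Hmax] : exists k0 : 'I_K.+1, forall k : 'I_K.+1, M k / D k <= M k0 / D k0.
  case: (@Order.TotalTheory.arg_maxP _ R _ (@ord0 K) xpredT (fun k : 'I_K.+1 => M k / D k) isT).
  by move=> k0 _ Hm; exists k0 => k; exact: Hm.
set S := M k0 / D k0 in Hmax.
have MS k : (k <= K)%N -> M k <= S * D k.
  move=> kK; rewrite -ler_pdivrMr //.
  have := Hmax (inord k); by rewrite inordK.
suff S1 : S <= 1.
  move=> k kK; rewrite -/(M k) -/(D k); apply: le_trans (MS k kK) _.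
  by rewrite ler_piMl // ltW.
rewrite leNgt; apply/negP => S1.
have Hsmall k : H * dl ^+ 2 < dl * lam / 4 * (S * D k).
  apply: (@lt_le_trans _ _ (dl * lam / 4 * (K0 * dl))); last first.
    rewrite ler_wpM2l //; first by rewrite divr_ge0 // mulr_ge0 // ltW.
    by apply: le_trans (Dge k) _; rewrite ler_peMl ?(ltW S1) ?(ltW (D0 _)).
  rewrite (_ : dl * lam / 4 * (K0 * dl) = (H + lam / 4) * dl ^+ 2).
    by rewrite ltr_pM2r ?exprn_gt0 //; lra.
  by rewrite /K0; field; rewrite lt0r_neq0.
have SD k : 0 < S * D k by rewrite mulr_gt0 // (lt_trans ltr01).
have strict k : (k <= K)%N -> M k < S * D k.
  move=> kK; rewrite /M gt_max; apply/andP; split.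
    case: k kK => [|k] kK; first exact: le_lt_trans a0 (SD 0%N).
    apply: le_lt_trans (Ha k kK) _.
    have M1 := MS k (ltnW kK); have /andP[_ D2] := DS k kK.
    have aM : a k <= M k by rewrite /M le_max lexx.
    have Hs := Hsmall k; rewrite -/(M k).
    have SD2 : S * D k <= S * D k.+1 by rewrite ler_wpM2l // ltW // (lt_trans ltr01).
    have E1 : (1 - dl * lam) * a k <= (1 - dl * lam) * (S * D k).
      by rewrite ler_wpM2l ?subr_ge0 // (le_trans aM).
    have E2 : dl * eps * M k <= dl * (lam / 4) * (S * D k).
      apply: (@le_trans _ _ (dl * eps * (S * D k))); first by rewrite ler_wpM2l // mulr_ge0 // ltW.
      by rewrite ler_wpM2r ?(ltW (SD _)) // ler_wpM2l // ltW.
    have := mulr_gt0 (mulr_gt0 dl0 lam0) (SD k).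
    move: E1 E2 Hs SD2; move: (S * D k) (S * D k.+1) => u v.
    by rewrite mulrBl mul1r; lra.
  (* At the far end no recursion is available; there the a priori bound [R0] lies below [D K]. *)
  move: kK; rewrite leq_eqVlt => /orP[/eqP ->|kK].
    have [_ /le_lt_trans] := bnd K (leqnn K); apply.
    apply: (@lt_le_trans _ _ (D K)); last by rewrite ler_peMl ?(ltW S1) ?(ltW (D0 _)).
    by rewrite /D subnn mulr1 ltrDr mulr_gt0.
  apply: le_lt_trans (Hb k kK) _.
  have M1 := MS k (ltnW kK); have M2 := MS k.+1 kK; have /andP[D1 _] := DS k kK.
  have bM : b k.+1 <= M k.+1 by rewrite /M le_max lexx orbT.
  have Hs := Hsmall k; rewrite -/(M k).
  have E2 : dl * eps * M k <= dl * (lam / 4) * (S * D k).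
    apply: (@le_trans _ _ (dl * eps * (S * D k))); first by rewrite ler_wpM2l // mulr_ge0 // ltW.
    by rewrite ler_wpM2r ?(ltW (SD _)) // ler_wpM2l // ltW.
  (* Since 1 - dl lam <= q^2, one factor [q] turns D at k + 1 into D at k, and the other leaves a
     gain of dl lam / 2, of which the coupling and the defect take at most a quarter of dl lam
     each. *)
  have E1 : (1 - dl * lam) * b k.+1 <= q * (S * D k).
    apply: (@le_trans _ _ ((1 - dl * lam) * (S * D k.+1))).
      by rewrite ler_wpM2l ?subr_ge0 // (le_trans bM).
    apply: (@le_trans _ _ (q ^+ 2 * (S * D k.+1))).
      by rewrite ler_wpM2r ?(ltW (SD _)) // /q expr2; nra.
    rewrite expr2 -mulrA ler_wpM2l ?(ltW q0) // mulrCA ler_wpM2l //.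
    by rewrite ltW // (lt_trans ltr01).
  move: E1 E2 Hs; move: ((1 - dl * lam) * b k.+1) (S * D k) => e u.
  rewrite /q mulrBl mul1r.
  rewrite (_ : dl * lam / 2 * u = dl * lam * u / 2); last by ring.
  rewrite (_ : dl * (lam / 4) * u = dl * lam * u / 4); last by ring.
  rewrite (_ : dl * lam / 4 * u = dl * lam * u / 4); last by ring.
  by lra.
have := strict k0 (leq_ord k0 : k0 <= K)%N.
by rewrite /S divfK ?ltxx // lt0r_neq0.
Qed.

End Pinching.

(** * Adapted norms, splittings and the box norm *)

Section Splitting.
Context {R : realType}.

(* A norm in which one explicit Euler step of x' = B x contracts by the factor
   1 - dl * lam. *)
Record adapted_norm d (B : 'M[R]_d) (lam : R) := AdaptedNorm {
  anorm :> 'cV[R]_d -> R;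
  anorm_cst : R;
  anorm_step : R;
  anormD : forall y z, anorm (y + z) <= anorm y + anorm z;
  anormZ : forall c y, anorm (c *: y) = `|c| * anorm y;
  anorm_le : forall y, anorm y <= anorm_cst * `|y|;
  anorm_ge : forall y, `|y| <= anorm_cst * anorm y;
  anorm_step_gt0 : 0 < anorm_step;
  anorm_contr : forall dl y, 0 <= dl -> dl <= anorm_step ->
    anorm (y + dl *: (B *m y)) <= (1 - dl * lam) * anorm y }.

Lemma anorm0 d (B : 'M[R]_d) lam (N : adapted_norm B lam) : N 0 = 0.
Proof. by rewrite -(scale0r (0 : 'cV[R]_d)) anormZ normr0 mul0r. Qed.

Lemma anormN d (B : 'M[R]_d) lam (N : adapted_norm B lam) y : N (- y) = N y.
Proof. by rewrite -scaleN1r anormZ normrN normr1 mul1r. Qed.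

Lemma anorm_ge0 d (B : 'M[R]_d) lam (N : adapted_norm B lam) y : 0 <= N y.
Proof. by have := anormD N y (- y); rewrite subrr anorm0 anormN; lra. Qed.

(** Coordinates on the stable and unstable spaces, with [spP], [spQ] as bases and [spLs], [spLu] as
    coordinate maps. The norm [sp_nu] is adapted to [- spAu] because unstable components are
    computed backwards in time. *)
Record splitting n (A : 'M[R]_n) d m := Splitting {
  spP : 'M[R]_(n, d);
  spQ : 'M[R]_(n, m);
  spLs : 'M[R]_(d, n);
  spLu : 'M[R]_(m, n);
  spAs : 'M[R]_d;
  spAu : 'M[R]_m;
  spLsP : spLs *m spP = 1%:M;
  spLuQ : spLu *m spQ = 1%:M;
  spLsQ : spLs *m spQ = 0;
  spLuP : spLu *m spP = 0;
  spPQ : spP *m spLs + spQ *m spLu = 1%:M;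
  spLsA : spLs *m A = spAs *m spLs;
  spLuA : spLu *m A = spAu *m spLu;
  splam : R;
  splam_gt0 : 0 < splam;
  sp_ns : adapted_norm spAs splam;
  sp_nu : adapted_norm (- spAu) splam }.

Section BoxNorm.
Context {n d m : nat} {A : 'M[R]_n} (S : splitting A d m).
Local Notation P := (spP S).
Local Notation Q := (spQ S).
Local Notation Ls := (spLs S).
Local Notation Lu := (spLu S).
Local Notation ns := (sp_ns S).
Local Notation nu := (sp_nu S).

(** With a maximum the balls are boxes, so the stable and unstable components can be kept inside
    separately. *)
Definition bnorm (x : 'cV[R]_n) : R := Num.max (ns (Ls *m x)) (nu (Lu *m x)).
Local Notation N := bnorm.
Implicit Types (x : 'cV[R]_n) (y : 'cV[R]_d) (z : 'cV[R]_m).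

Lemma ns_bnorm x : ns (Ls *m x) <= N x.
Proof. by rewrite le_max lexx. Qed.

Lemma nu_bnorm x : nu (Lu *m x) <= N x.
Proof. by rewrite le_max lexx orbT. Qed.

Lemma bnorm_ge0 x : 0 <= N x.
Proof. exact: le_trans (anorm_ge0 _ _) (ns_bnorm x). Qed.

Lemma bnormD x x' : N (x + x') <= N x + N x'.
Proof.
rewrite ge_max !mulmxDr; apply/andP; split; apply: le_trans (anormD _ _ _) _.
  by rewrite lerD ?ns_bnorm.
by rewrite lerD ?nu_bnorm.
Qed.

Lemma bnormZ c x : N (c *: x) = `|c| * N x.
Proof. by rewrite /N -!scalemxAr !anormZ -maxr_pMr. Qed.

Lemma bnormN x : N (- x) = N x.
Proof. by rewrite -scaleN1r bnormZ normrN normr1 mul1r. Qed.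

Lemma bnormB x x' : N (x - x') <= N x + N x'.
Proof. by rewrite -(bnormN x') bnormD. Qed.

Lemma bnormBC x x' : N (x - x') = N (x' - x).
Proof. by rewrite -bnormN opprB. Qed.

Lemma bnorm0 : N 0 = 0.
Proof. by rewrite -(scale0r (0 : 'cV[R]_n)) bnormZ normr0 mul0r. Qed.

Lemma sp_decomp x : P *m (Ls *m x) + Q *m (Lu *m x) = x.
Proof. by rewrite !mulmxA -mulmxDl spPQ mul1mx. Qed.

Lemma sp_Ls y z : Ls *m (P *m y + Q *m z) = y.
Proof. by rewrite mulmxDr !mulmxA spLsP spLsQ mul1mx mul0mx addr0. Qed.

Lemma sp_Lu y z : Lu *m (P *m y + Q *m z) = z.
Proof. by rewrite mulmxDr !mulmxA spLuP spLuQ mul1mx mul0mx add0r. Qed.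

Lemma bnorm_PQ y z : N (P *m y + Q *m z) = Num.max (ns y) (nu z).
Proof. by rewrite /N sp_Ls sp_Lu. Qed.

Lemma mx_bounded p q (B : 'M[R]_(p, q)) :
  exists2 c : R, 0 <= c & forall x : 'cV[R]_q, `|B *m x| <= c * `|x|.
Proof. exact: (@cV_linear_bounded R q _ (mulmx B : {linear 'cV[R]_q -> 'cV[R]_p})). Qed.

Lemma bnorm_cst : exists2 c : R, 1 <= c & [/\
  forall x, N x <= c * `|x|, forall x, `|x| <= c * N x,
  forall x, N (A *m x) <= c * N x,
  forall x, ns (Ls *m x) <= c * `|x| /\ nu (Lu *m x) <= c * `|x|
  & forall y z i, `|(P *m y + Q *m z) i 0| <= c * ns y + c * nu z].
Proof.
have [cl cl0 Hl] := mx_bounded Ls; have [cu cu0 Hu] := mx_bounded Lu.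
have [cp cp0 Hp] := mx_bounded P; have [cq cq0 Hq] := mx_bounded Q.
have [ca ca0 Ha] := mx_bounded A.
set ks : R := `|anorm_cst ns|; set ku : R := `|anorm_cst nu|.
have ks_le y : ns y <= ks * `|y|.
  by apply: le_trans (anorm_le _ _) _; rewrite ler_wpM2r // ler_norm.
have ku_le z : nu z <= ku * `|z|.
  by apply: le_trans (anorm_le _ _) _; rewrite ler_wpM2r // ler_norm.
have ks_ge y : `|y| <= ks * ns y.
  by apply: le_trans (anorm_ge ns _) _; rewrite ler_wpM2r ?anorm_ge0 // ler_norm.
have ku_ge z : `|z| <= ku * nu z.
  by apply: le_trans (anorm_ge nu _) _; rewrite ler_wpM2r ?anorm_ge0 // ler_norm.
have ks0 : 0 <= ks by exact: normr_ge0.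
have ku0 : 0 <= ku by exact: normr_ge0.
pose c1 := ks * cl + ku * cu.
pose c2 := cp * ks + cq * ku.
have c10 : 0 <= c1 by rewrite addr_ge0 // mulr_ge0.
have c20 : 0 <= c2 by rewrite addr_ge0 // mulr_ge0.
have Hns x : ns (Ls *m x) <= ks * cl * `|x|.
  by apply: le_trans (ks_le _) _; rewrite -mulrA ler_wpM2l.
have Hnu x : nu (Lu *m x) <= ku * cu * `|x|.
  by apply: le_trans (ku_le _) _; rewrite -mulrA ler_wpM2l.
have HN x : N x <= c1 * `|x|.
  rewrite ge_max /c1 mulrDl; apply/andP; split.
    by apply: le_trans (Hns x) _; rewrite lerDl !mulr_ge0.
  by apply: le_trans (Hnu x) _; rewrite lerDr !mulr_ge0.
have HPQ y z : `|P *m y + Q *m z| <= cp * ks * ns y + cq * ku * nu z.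
  apply: le_trans (ler_normD _ _) _; rewrite -!mulrA lerD //.
    by apply: le_trans (Hp _) _; rewrite ler_wpM2l.
  by apply: le_trans (Hq _) _; rewrite ler_wpM2l.
have HNi x : `|x| <= c2 * N x.
  rewrite -{1}[x]sp_decomp; apply: le_trans (HPQ _ _) _.
  by rewrite /c2 mulrDl lerD // ler_wpM2l ?mulr_ge0 ?ns_bnorm ?nu_bnorm.
exists (1 + c1 + c2 + c1 * ca * c2); first by rewrite -!addrA lerDl !addr_ge0 // !mulr_ge0.
have k1 : c1 <= 1 + c1 + c2 + c1 * ca * c2.
  have : 0 <= c1 * ca * c2 by rewrite !mulr_ge0. lra.
have k2 : c2 <= 1 + c1 + c2 + c1 * ca * c2.
  have : 0 <= c1 * ca * c2 by rewrite !mulr_ge0. lra.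
set c := 1 + _ + _ + _ in k1 k2 *.
split=> [x|x|x|x|y z i].
- by apply: le_trans (HN x) _; rewrite ler_wpM2r.
- by apply: le_trans (HNi x) _; rewrite ler_wpM2r ?bnorm_ge0.
- apply: le_trans (HN _) _; apply: (@le_trans _ _ (c1 * ca * c2 * N x)); last first.
    by rewrite ler_wpM2r ?bnorm_ge0 // /c; lra.
  rewrite -!mulrA ler_wpM2l //; apply: le_trans (Ha x) _; by rewrite ler_wpM2l.
- split; first by apply: le_trans (ns_bnorm x) _; apply: le_trans (HN x) _; rewrite ler_wpM2r.
  by apply: le_trans (nu_bnorm x) _; apply: le_trans (HN x) _; rewrite ler_wpM2r.
- apply: le_trans (cV_entry_le _ _) _; apply: le_trans (HPQ _ _) _.
  have h1 : cp * ks <= c2 by rewrite /c2 lerDl mulr_ge0.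
  have h2 : cq * ku <= c2 by rewrite /c2 lerDr mulr_ge0.
  by rewrite lerD // ler_wpM2r ?anorm_ge0 // (le_trans _ k2).
Qed.

End BoxNorm.
End Splitting.

Section Discrete.
Context {R : realType} {n d m : nat} {A : 'M[R]_n} (S : splitting A d m).
Local Notation Ls := (spLs S).
Local Notation Lu := (spLu S).
Local Notation Au := (spAu S).
Local Notation lam := (splam S).
Local Notation ns := (sp_ns S).
Local Notation nu := (sp_nu S).
Local Notation N := (bnorm S).

Definition small_step (dl : R) :=
  [/\ 0 < dl, dl <= anorm_step ns, dl <= anorm_step nu, dl <= 1 & dl * lam <= 1].

Variables (g : 'cV[R]_n -> 'cV[R]_n) (r eps cA : R).
Hypotheses (g0 : g 0 = 0) (r0 : 0 < r) (eps0 : 0 <= eps) (epslam : eps <= lam / 4)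
  (glip : forall x x', N x < r -> N x' < r -> N (g x - g x') <= eps * N (x - x'))
  (cA0 : 0 <= cA) (HcA : forall x, N (A *m x) <= cA * N x).

Local Notation F := (fun x : 'cV[R]_n => A *m x + g x).
Local Notation LF := (cA + eps).

Lemma box_field_lip x x' : N x < r -> N x' < r -> N (F x - F x') <= LF * N (x - x').
Proof.
move=> Nx Nx'; rewrite opprD addrACA -mulmxBr mulrDl.
by apply: le_trans (bnormD _ _ _) _; rewrite lerD ?HcA ?glip.
Qed.

Lemma box_field_le x : N x < r -> N (F x) <= LF * N x.
Proof.
move=> Nx; have N0 : N 0 < r by rewrite bnorm0.
by have := box_field_lip Nx N0; rewrite mulmx0 g0 addr0 !subr0.
Qed.

Lemma box_g_le x : N x < r -> N (g x) <= eps * N x.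
Proof.
move=> Nx; have N0 : N 0 < r by rewrite bnorm0.
by have := glip Nx N0; rewrite g0 !subr0.
Qed.

Definition approx (C dl : R) (K : nat) (x : nat -> 'cV[R]_n) :=
  (forall k, (k <= K)%N -> N (x k) < r) /\
  (forall k, (k < K)%N -> N (x k.+1 - x k - dl *: F (x k)) <= C * dl ^+ 2).

Lemma approx_le C C' dl K x : C <= C' -> approx C dl K x -> approx C' dl K x.
Proof.
move=> CC' [H1 H2]; split=> // k kK; apply: le_trans (H2 k kK) _.
by rewrite ler_wpM2r // sqr_ge0.
Qed.

Let LF0 : 0 <= LF. Proof. exact: addr_ge0. Qed.

Definition approx_speed (C : R) := LF * r + C.

Lemma approx_step C dl K x k l : 0 <= C -> 0 < dl -> dl <= 1 -> approx C dl K x ->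
  (k + l <= K)%N -> N (x (k + l)%N - x k) <= approx_speed C * (l%:R * dl).
Proof.
move=> C0 dl0 dl1 [H1 H2]; elim: l => [|l IH] kl.
  by rewrite addn0 subrr bnorm0 mul0r mulr0.
rewrite addnS in kl *; have klK := ltnW kl.
have -> : x (k + l).+1 - x k = (x (k + l).+1 - x (k + l)%N - dl *: F (x (k + l)%N)) +
    (dl *: F (x (k + l)%N) + (x (k + l)%N - x k)).
  by rewrite addrA subrK addrA subrK.
apply: le_trans (bnormD _ _ _) _; apply: le_trans (lerD (H2 _ kl) (bnormD _ _ _)) _.
have h1 := H1 _ klK; have h2 := IH klK.
have h3 : N (dl *: F (x (k + l)%N)) <= dl * (LF * r).
  rewrite bnormZ gtr0_norm // ler_wpM2l ?(ltW dl0) //.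
  by apply: le_trans (box_field_le h1) _; rewrite ler_wpM2l // ltW.
rewrite -natr1; apply: le_trans (lerD (lexx _) (lerD h3 h2)) _.
rewrite /approx_speed; have : C * dl ^+ 2 <= C * dl by rewrite ler_wpM2l // expr2 ler_piMr // ltW.
rewrite (_ : _ * ((_ + 1) * dl) = (LF * r + C) * (l%:R * dl) + dl * (LF * r) + C * dl); last by ring.
by lra.
Qed.

Definition approx_curv (C : R) := C + LF * approx_speed C.

(** A block of [l] steps is one Euler step of mesh l dl with a defect of the same order, with a
    constant free of [l]. Taking l = 2 compares consecutive dyadic meshes; general [l] gives the
    Taylor estimate of the limit. *)
Lemma approx_multi C dl K x k l : 0 <= C -> 0 < dl -> dl <= 1 -> approx C dl K x ->
  (k + l <= K)%N ->
  N (x (k + l)%N - x k - (l%:R * dl) *: F (x k)) <= approx_curv C * (l%:R * dl) ^+ 2.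
Proof.
move=> C0 dl0 dl1 Hx; have [H1 H2] := Hx; elim: l => [|l IH] kl.
  by rewrite addn0 subrr mul0r scale0r subr0 bnorm0 expr0n mulr0.
rewrite addnS in kl *; have klK := ltnW kl.
set y := x (k + l)%N in IH *; set y' := x _.+1.
have -> : y' - x k - (l.+1%:R * dl) *: F (x k) = (y' - y - dl *: F y) +
    (dl *: (F y - F (x k)) + (y - x k - (l%:R * dl) *: F (x k))).
  rewrite -natr1 mulrDl mul1r scalerDl scalerBr.
  move: (dl *: F y) (dl *: F (x k)) ((l%:R * dl) *: F (x k)) => a b c.
  apply/eqP; rewrite -subr_eq0; apply/eqP; apply/matrixP => i j; rewrite !mxE; ring.
apply: le_trans (bnormD _ _ _) _; apply: le_trans (lerD (H2 _ kl) (bnormD _ _ _)) _.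
have k_le : (k <= K)%N by apply: leq_trans klK; exact: leq_addr.
have h3 : N (dl *: (F y - F (x k))) <= dl * (LF * (approx_speed C * (l%:R * dl))).
  rewrite bnormZ gtr0_norm // ler_wpM2l ?(ltW dl0) //.
  apply: le_trans (box_field_lip (H1 _ klK) (H1 _ k_le)) _.
  by rewrite ler_wpM2l // (approx_step C0 dl0 dl1 Hx).
apply: le_trans (lerD (lexx _) (lerD h3 (IH klK))) _.
rewrite /approx_curv -natr1.
have l0 : 0 <= l%:R :> R by [].
have B0 : 0 <= LF * approx_speed C.
  by rewrite mulr_ge0 // addr_ge0 // mulr_ge0 // ltW.
rewrite (_ : dl * _ = LF * approx_speed C * l%:R * dl ^+ 2); last by ring.
rewrite (_ : C * dl ^+ 2 + _ = (C + LF * approx_speed C * l%:R +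
  (C + LF * approx_speed C) * l%:R ^+ 2) * dl ^+ 2); last by ring.
rewrite [leRHS](_ : _ = (C + LF * approx_speed C) * (l%:R + 1) ^+ 2 * dl ^+ 2); last by ring.
rewrite ler_wpM2r ?sqr_ge0 //.
by move: (LF * approx_speed C) B0 (l%:R) l0 => B B0 t t0; nra.
Qed.

(** The constant 4 H / lam + 1 of [pinching]. In H, 2 C is the sum of two defects; the rest is the
    cost of evaluating the unstable linear part at the end of a step rather than at its
    beginning. *)
Definition compare_cst (C : R) :=
  4 * (2 * C + cA * (LF * (2 * r) + 2 * C)) / lam + 1.

(** The difference of the sequences fulfils the recursions of [pinching]: its stable part starts at
    0, and its unstable part is solved backwards, which is explicit up to an error of order dl^2. *)
Lemma approx_compare C dl K x x' : 0 <= C -> small_step dl ->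
  approx C dl K x -> approx C dl K x' -> Ls *m x 0%N = Ls *m x' 0%N ->
  forall k, (k <= K)%N -> N (x k - x' k) <=
    compare_cst C * dl + 2 * r * (1 - dl * lam / 2) ^+ (K - k).
Proof.
move=> C0 [dl0 dls dlu dl1 dllam] [H1 H2] [H1' H2'] E0.
pose w k := x k - x' k.
have lam0 := splam_gt0 S.
have Hw k : (k <= K)%N -> N (w k) <= 2 * r.
  move=> kK; apply: le_trans (bnormB _ _ _) _.
  by have := H1 k kK; have := H1' k kK; lra.
pose e k := (x k.+1 - x k - dl *: F (x k)) - (x' k.+1 - x' k - dl *: F (x' k)).
have He k : (k < K)%N -> N (e k) <= 2 * C * dl ^+ 2.
  move=> kK; apply: le_trans (bnormB _ _ _) _.
  by have := H2 k kK; have := H2' k kK; lra.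
have wS k : w k.+1 = w k + dl *: (A *m w k) + (dl *: (g (x k) - g (x' k)) + e k).
  rewrite /w /e !mulmxBr; move: (A *m x k) (A *m x' k) => u v.
  by apply/matrixP => i j; rewrite !mxE; ring.
have Hg k : (k < K)%N -> N (dl *: (g (x k) - g (x' k))) <= dl * (eps * N (w k)).
  move=> kK; rewrite bnormZ gtr0_norm // ler_wpM2l ?(ltW dl0) //.
  by apply: glip; [apply: H1|apply: H1']; exact: ltnW.
pose H := 2 * C + cA * (LF * (2 * r) + 2 * C).
have r2 : 0 <= 2 * r by rewrite mulr_ge0 // ltW.
have Hc : 0 <= cA * (LF * (2 * r) + 2 * C).
  by apply: mulr_ge0 => //; apply: addr_ge0; apply: mulr_ge0.
have H0 : 0 <= H by apply: addr_ge0 => //; apply: mulr_ge0.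
have Ha k : (k < K)%N -> ns (Ls *m w k.+1) <= (1 - dl * lam) * ns (Ls *m w k) +
    dl * eps * Num.max (ns (Ls *m w k)) (nu (Lu *m w k)) + H * dl ^+ 2.
  move=> kK; rewrite wS mulmxDr mulmxDr -scalemxAr mulmxA spLsA -mulmxA -[X in _ <= X]addrA.
  apply: le_trans (anormD _ _ _) _; apply: lerD; first exact: anorm_contr (ltW dl0) dls.
  apply: le_trans (ns_bnorm _ _) _; apply: le_trans (bnormD _ _ _) _.
  rewrite -mulrA; apply: lerD; first exact: Hg.
  apply: le_trans (He k kK) _; by rewrite ler_wpM2r ?sqr_ge0 // /H lerDl.
have genD u v : Lu *m (u + dl *: (A *m u) + v) = Lu *m u + dl *: (Au *m (Lu *m u)) + Lu *m v.
  by rewrite !mulmxDr -scalemxAr !mulmxA spLuA.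
have genB u v : Lu *m (A *m (u - v)) = Au *m (Lu *m u) - Au *m (Lu *m v).
  by rewrite !mulmxBr !mulmxA spLuA.
have Hb k : (k < K)%N -> nu (Lu *m w k) <= (1 - dl * lam) * nu (Lu *m w k.+1) +
    dl * eps * Num.max (ns (Ls *m w k)) (nu (Lu *m w k)) + H * dl ^+ 2.
  move=> kK; set z := Lu *m w k.+1.
  have E : Lu *m w k = (z + dl *: (- Au *m z)) +
      (dl *: (Lu *m (A *m (w k.+1 - w k))) - Lu *m (dl *: (g (x k) - g (x' k)) + e k)).
    have hz : z = Lu *m w k + dl *: (Au *m (Lu *m w k)) + Lu *m (dl *: (g (x k) - g (x' k)) + e k).
      by rewrite /z (wS k); exact: genD.
    have hA : Lu *m (A *m (w k.+1 - w k)) = Au *m z - Au *m (Lu *m w k).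
      exact: genB.
    rewrite hA mulNmx; move: (Au *m z) => az; rewrite hz.
    move: (Lu *m w k) (Au *m (Lu *m w k)) (Lu *m (dl *: _ + _)) => u v t.
    by apply/matrixP => i j; rewrite !mxE; ring.
  rewrite {1}E -[X in _ <= X]addrA.
  apply: le_trans (anormD _ _ _) _; apply: lerD; first exact: anorm_contr (ltW dl0) dlu.
  rewrite scalemxAr -mulmxBr.
  apply: le_trans (nu_bnorm _ _) _; apply: le_trans (bnormB _ _ _) _.
  have h1 : N (dl *: (A *m (w k.+1 - w k))) <= cA * (LF * (2 * r) + 2 * C) * dl ^+ 2.
    rewrite bnormZ gtr0_norm //; apply: (@le_trans _ _ (dl * (cA * (dl * (LF * (2 * r) + 2 * C))))); last first.
      by rewrite le_eqVlt; apply/orP; left; apply/eqP; ring.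
    rewrite ler_wpM2l ?(ltW dl0) //; apply: le_trans (HcA _) _; rewrite ler_wpM2l //.
    have -> : w k.+1 - w k = dl *: (A *m w k) + dl *: (g (x k) - g (x' k)) + e k.
      by rewrite (wS k) -[w k + _ + _]addrA [w k + _]addrC addrK addrA.
    apply: le_trans (bnormD _ _ _) _; apply: le_trans (lerD (bnormD _ _ _) (lexx _)) _.
    have := Hg k kK; have := He k kK; have := Hw k (ltnW kK).
    have hA : N (dl *: (A *m w k)) <= dl * (cA * N (w k)).
      by rewrite bnormZ gtr0_norm // ler_wpM2l ?(ltW dl0).
    have hd : C * dl ^+ 2 <= C * dl by rewrite ler_wpM2l // expr2 ler_piMr // ltW.
    move=> a1 a2 a3; apply: le_trans (lerD (lerD hA a3) a2) _.
    have : dl * (LF * N (w k)) <= dl * (LF * (2 * r)).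
      by rewrite ler_wpM2l ?(ltW dl0) // ler_wpM2l.
    by rewrite !mulrDl !mulrDr; lra.
  have h2 : N (dl *: (g (x k) - g (x' k)) + e k) <= dl * eps * N (w k) + 2 * C * dl ^+ 2.
    by apply: le_trans (bnormD _ _ _) _; rewrite -mulrA lerD ?Hg ?He.
  apply: le_trans (lerD h1 h2) _; rewrite -/(N (w k)) /H; lra.
have := @pinching R (fun k => ns (Ls *m w k)) (fun k => nu (Lu *m w k)) K dl lam eps H (2 * r).
apply => //.
- by move=> k kK; split; apply: le_trans (Hw k kK); [exact: ns_bnorm|exact: nu_bnorm].
- by rewrite /w mulmxBr E0 subrr anorm0.
Qed.

(** Discrete Gronwall inequality: the defects add up and are amplified by at most (1 + dl LF)^K. *)
Lemma approx_unique C dl K x x' : 0 <= C -> 0 < dl -> approx C dl K x ->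
  approx C dl K x' -> x 0%N = x' 0%N ->
  N (x K - x' K) <= 2 * C * dl ^+ 2 * K%:R * (1 + dl * LF) ^+ K.
Proof.
move=> C0 dl0 [H1 H2] [H1' H2'] E0.
have q1 : 1 <= 1 + dl * LF by rewrite lerDl mulr_ge0 // ltW.
suff H k : (k <= K)%N -> N (x k - x' k) <= 2 * C * dl ^+ 2 * k%:R * (1 + dl * LF) ^+ k.
  exact: H.
elim: k => [|k IH] kK; first by rewrite E0 subrr bnorm0 mulr0 mul0r.
have -> : x k.+1 - x' k.+1 = (x k - x' k) + (dl *: (F (x k) - F (x' k)) +
    ((x k.+1 - x k - dl *: F (x k)) - (x' k.+1 - x' k - dl *: F (x' k)))).
  rewrite scalerBr; move: (dl *: F (x k)) (dl *: F (x' k)) => u v.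
  by apply/matrixP => i j; rewrite !mxE; ring.
apply: le_trans (bnormD _ _ _) _; apply: le_trans (lerD (lexx _) (bnormD _ _ _)) _.
have h1 : N (dl *: (F (x k) - F (x' k))) <= dl * LF * N (x k - x' k).
  rewrite bnormZ gtr0_norm // -mulrA ler_wpM2l ?(ltW dl0) // box_field_lip //.
    by apply: H1; exact: ltnW.
  by apply: H1'; exact: ltnW.
have h2 : N ((x k.+1 - x k - dl *: F (x k)) - (x' k.+1 - x' k - dl *: F (x' k))) <= 2 * C * dl ^+ 2.
  by apply: le_trans (bnormB _ _ _) _; have := H2 k kK; have := H2' k kK; lra.
apply: le_trans (lerD (lexx _) (lerD h1 h2)) _.
have q0 : 0 <= 1 + dl * LF by apply: le_trans q1.
have h3 := ler_wpM2l q0 (IH (ltnW kK)).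
have h4 : 2 * C * dl ^+ 2 <= 2 * C * dl ^+ 2 * (1 + dl * LF) ^+ k.+1.
  have p : 0 <= 2 * C * dl ^+ 2 by rewrite mulr_ge0 ?sqr_ge0 // mulr_ge0.
  have e := exprn_ege1 k.+1 q1; by rewrite ler_peMr.
move: h3 h4; rewrite -natr1 (exprS (1 + dl * LF) k).
move: ((1 + dl * LF) ^+ k) (N (x k - x' k)) => u v h3 h4.
rewrite [leRHS](_ : _ = (1 + dl * LF) * (2 * C * dl ^+ 2 * k%:R * u) +
  2 * C * dl ^+ 2 * ((1 + dl * LF) * u)); last by ring.
by apply: le_trans _ (lerD h3 h4); rewrite [in leRHS]mulrDl mul1r addrA.
Qed.

End Discrete.

Section Picard.
Context {R : realType} {n d m : nat} {A : 'M[R]_n} (S : splitting A d m).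
Local Notation P := (spP S).
Local Notation Q := (spQ S).
Local Notation Ls := (spLs S).
Local Notation Lu := (spLu S).
Local Notation As := (spAs S).
Local Notation Au := (spAu S).
Local Notation lam := (splam S).
Local Notation ns := (sp_ns S).
Local Notation nu := (sp_nu S).
Local Notation N := (bnorm S).

Variables (g : 'cV[R]_n -> 'cV[R]_n) (r eps cA : R).

Fixpoint fwd (dl : R) (gam : nat -> 'cV[R]_n) (y : 'cV[R]_d) (k : nat) : 'cV[R]_d :=
  if k is k'.+1 then
    fwd dl gam y k' + dl *: (As *m fwd dl gam y k') + dl *: (Ls *m gam k')
  else y.

(** Here [l] counts steps back from [K]. The linear part is taken at the later time, which makes the
    backward step explicit; the forcing is taken at the time K - l of the new value. *)
Fixpoint bwd (dl : R) (gam : nat -> 'cV[R]_n) (K l : nat) : 'cV[R]_m :=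
  if l is l'.+1 then
    bwd dl gam K l' + dl *: (- Au *m bwd dl gam K l') - dl *: (Lu *m gam (K - l)%N)
  else 0.

(* Picard iterates for the discretized Lyapunov-Perron problem on {0, ..., K}:
   the stable component, equal to y at time 0, is computed forwards, the
   unstable one, equal to 0 at time K, backwards. *)
Fixpoint picard (dl : R) (K j : nat) (y : 'cV[R]_d) (k : nat) : 'cV[R]_n :=
  if j is j'.+1 then
    P *m fwd dl (fun i => g (picard dl K j' y i)) y k +
    Q *m bwd dl (fun i => g (picard dl K j' y i)) K (K - k)
  else 0.

(** A step shrinks the ball of radius [e] by dl lam e, exactly the room required by the forcing. *)
Lemma fwd_le dl gam y K e : small_step S dl -> ns y <= e ->
  (forall k, (k < K)%N -> N (gam k) <= lam * e) ->
  forall k, (k <= K)%N -> ns (fwd dl gam y k) <= e.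
Proof.
move=> [dl0 dls _ _ dllam] ye He; elim=> [//|k IH] kK /=.
apply: le_trans (anormD _ _ _) _.
have h1 := @anorm_contr _ _ _ _ ns dl (fwd dl gam y k) (ltW dl0) dls.
have h2 : ns (dl *: (Ls *m gam k)) <= dl * (lam * e).
  by rewrite anormZ gtr0_norm // ler_wpM2l ?(ltW dl0) // (le_trans (ns_bnorm _ _)) ?He.
apply: le_trans (lerD h1 h2) _.
have h3 : (1 - dl * lam) * ns (fwd dl gam y k) <= (1 - dl * lam) * e.
  by rewrite ler_wpM2l ?subr_ge0 // IH // ltnW.
by apply: le_trans (lerD h3 (lexx _)) _; rewrite mulrBl mul1r mulrA subrK.
Qed.

Lemma bwd_le dl gam K e : small_step S dl -> 0 <= e ->
  (forall k, (k < K)%N -> N (gam k) <= lam * e) ->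
  forall l, (l <= K)%N -> nu (bwd dl gam K l) <= e.
Proof.
move=> [dl0 _ dlu _ dllam] e0 He; elim=> [_|l IH lK] /=; first by rewrite anorm0.
apply: le_trans (anormD _ _ _) _; rewrite anormN.
have h1 := @anorm_contr _ _ _ _ nu dl (bwd dl gam K l) (ltW dl0) dlu.
have h2 : nu (dl *: (Lu *m gam (K - l.+1)%N)) <= dl * (lam * e).
  rewrite anormZ gtr0_norm // ler_wpM2l ?(ltW dl0) // (le_trans (nu_bnorm _ _)) ?He //.
  by rewrite ltn_subrL (leq_ltn_trans _ lK).
apply: le_trans (lerD h1 h2) _.
have h3 : (1 - dl * lam) * nu (bwd dl gam K l) <= (1 - dl * lam) * e.
  by rewrite ler_wpM2l ?subr_ge0 // IH // ltnW.
by apply: le_trans (lerD h3 (lexx _)) _; rewrite mulrBl mul1r mulrA subrK.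
Qed.

Lemma fwdB dl gam gam' y y' k :
  fwd dl gam y k - fwd dl gam' y' k = fwd dl (fun i => gam i - gam' i) (y - y') k.
Proof.
elim: k => [//|k IH] /=; rewrite -IH !mulmxBr !scalerBr.
by apply/matrixP => i j; rewrite !mxE; ring.
Qed.

Lemma bwdB dl gam gam' K l :
  bwd dl gam K l - bwd dl gam' K l = bwd dl (fun i => gam i - gam' i) K l.
Proof.
elim: l => [|l IH] /=; first by rewrite subr0.
rewrite -IH !mulNmx !mulmxBr !scalerN !scalerBr.
by apply/matrixP => i j; rewrite !mxE; ring.
Qed.

Lemma picard_s dl K j y k :
  Ls *m picard dl K j.+1 y k = fwd dl (fun i => g (picard dl K j y i)) y k.
Proof. exact: sp_Ls. Qed.

Lemma picard_u dl K j y k :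
  Lu *m picard dl K j.+1 y k = bwd dl (fun i => g (picard dl K j y i)) K (K - k).
Proof. exact: sp_Lu. Qed.

Hypotheses (g0 : g 0 = 0) (r0 : 0 < r) (eps0 : 0 <= eps) (epslam : eps <= lam / 4)
  (glip : forall x x', N x < r -> N x' < r -> N (g x - g x') <= eps * N (x - x'))
  (cA0 : 0 <= cA) (HcA : forall x, N (A *m x) <= cA * N x).

Let lam0 : 0 < lam := splam_gt0 S.

(** As [eps <= lam], an iterate of size at most [ns y] produces a forcing that [fwd_le] and [bwd_le]
    absorb with e = [ns y]. No constant is lost from one iteration to the next, so the iterates
    never leave the box where [g] is controlled. *)
Lemma picard_le dl K j y k : small_step S dl -> ns y < r -> (k <= K)%N ->
  N (picard dl K j y k) <= ns y.
Proof.
move=> sm yr; elim: j k => [|j IH] k kK; first by rewrite bnorm0 anorm_ge0.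
have Hg i : (i < K)%N -> N (g (picard dl K j y i)) <= lam * ns y.
  move=> iK; have h := IH i (ltnW iK).
  apply: le_trans (box_g_le g0 r0 glip (le_lt_trans h yr)) _.
  apply: (@le_trans _ _ (eps * ns y)); first by rewrite ler_wpM2l.
  by rewrite ler_wpM2r ?anorm_ge0 //; move: epslam lam0; lra.
rewrite /= bnorm_PQ ge_max (fwd_le sm _ Hg) //= (bwd_le sm _ Hg) ?anorm_ge0 //.
exact: leq_subr.
Qed.

(** This is the source of tangency: near 0 the field [g] is superlinearly small, so [e] can be taken
    arbitrarily small on small data. *)
Lemma picard_u_le dl K j y k e : small_step S dl -> ns y < r -> (k <= K)%N -> 0 <= e ->
  (forall x, N x <= ns y -> N (g x) <= lam * e * N x) ->
  nu (Lu *m picard dl K j y k) <= e * ns y.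
Proof.
move=> sm yr kK e0 He; case: j => [|j].
  by rewrite /= mulmx0 anorm0 mulr_ge0 // anorm_ge0.
rewrite picard_u; apply: (bwd_le sm) (leq_subr _ _) => [|i iK].
  by rewrite mulr_ge0 // anorm_ge0.
have h := picard_le j sm yr (ltnW iK).
by apply: le_trans (He _ h) _; rewrite mulrA ler_wpM2l // mulr_ge0 // ltW.
Qed.

(** The iteration contracts by eps / lam <= 1/4; the weaker factor 1/2 matches the dyadic meshes. *)
Lemma picard_diff dl K j y k : small_step S dl -> ns y < r -> (k <= K)%N ->
  N (picard dl K j.+1 y k - picard dl K j y k) <= ns y * 2^-1 ^+ j.
Proof.
move=> sm yr; elim: j k => [|j IH] k kK.
  by rewrite [picard _ _ 0 _ _]/= subr0 expr0 mulr1 picard_le.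
set e := ns y * _.
have e0 : 0 <= e by rewrite mulr_ge0 ?anorm_ge0 ?exprn_ge0.
have Hg i : (i < K)%N -> N (g (picard dl K j.+1 y i) - g (picard dl K j y i)) <= lam * e.
  move=> iK; have h1 := picard_le j.+1 sm yr (ltnW iK); have h2 := picard_le j sm yr (ltnW iK).
  apply: le_trans (glip (le_lt_trans h1 yr) (le_lt_trans h2 yr)) _.
  apply: le_trans (ler_wpM2l eps0 (IH i (ltnW iK))) _.
  rewrite /e exprS; have := epslam; have : 0 <= ns y * 2^-1 ^+ j by rewrite mulr_ge0 ?anorm_ge0 ?exprn_ge0.
  rewrite [ns y * (2^-1 * _)]mulrCA; move: (ns y * _) => t t0 h.
  have := ler_wpM2r t0 h; have := mulr_ge0 (ltW lam0) t0; lra.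
have -> : picard dl K j.+2 y k - picard dl K j.+1 y k =
    P *m fwd dl (fun i => g (picard dl K j.+1 y i) - g (picard dl K j y i)) (y - y) k +
    Q *m bwd dl (fun i => g (picard dl K j.+1 y i) - g (picard dl K j y i)) K (K - k).
  rewrite -fwdB -bwdB !mulmxBr [picard dl K j.+2 y k]/= [picard dl K j.+1 y k in LHS]/=.
  by rewrite opprD addrACA.
rewrite bnorm_PQ ge_max (fwd_le sm _ Hg) ?subrr ?anorm0 //=.
by rewrite (bwd_le sm _ Hg) // leq_subr.
Qed.

Lemma nu_Au z : nu (Au *m z) <= cA * nu z.
Proof.
have E : Au *m z = Lu *m (A *m (Q *m z)).
  by rewrite !mulmxA spLuA -mulmxA -mulmxA [Lu *m _]mulmxA spLuQ mul1mx.
rewrite E; apply: le_trans (nu_bnorm _ _) _; apply: le_trans (HcA _) _.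
rewrite ler_wpM2l // -[Q *m z]add0r -(mulmx0 _ P) bnorm_PQ anorm0 ge_max anorm_ge0 lexx //.
Qed.

(** The first summand comes from taking the unstable linear part at the later time, the second from
    the lag of one Picard iteration, at most 2 dl r. *)
Definition picard_cst := cA * ((cA + eps) * r) + 2 * (eps * r).

Lemma picard_approx dl K j y : small_step S dl -> ns y < r -> 2^-1 ^+ j <= 2 * dl ->
  approx S g r picard_cst dl K (picard dl K j.+1 y).
Proof.
move=> sm yr Hj; have [dl0 _ _ _ _] := sm.
split=> [k kK|k kK]; first exact: le_lt_trans (picard_le j.+1 sm yr kK) yr.
have kK' := ltnW kK.
set X := picard dl K j.+1 y; pose gam i := g (picard dl K j y i).
have Hgd : N (g (picard dl K j y k) - g (X k)) <= eps * (r * (2 * dl)).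
  have h1 := picard_le j.+1 sm yr kK'; have h2 := picard_le j sm yr kK'.
  apply: le_trans (glip (le_lt_trans h2 yr) (le_lt_trans h1 yr)) _.
  rewrite ler_wpM2l // bnormBC; apply: le_trans (picard_diff j sm yr kK') _.
  by rewrite ler_pM ?anorm_ge0 ?exprn_ge0 // ltW.
have D2 : dl * (eps * (r * (2 * dl))) = 2 * (eps * r) * dl ^+ 2 by ring.
have Es u v : Ls *m (u - v - dl *: (A *m v + g v)) =
    Ls *m u - Ls *m v - dl *: (As *m (Ls *m v) + Ls *m g v).
  by rewrite !mulmxBr -scalemxAr mulmxDr !mulmxA spLsA.
have Eu u v : Lu *m (u - v - dl *: (A *m v + g v)) =
    Lu *m u - Lu *m v - dl *: (Au *m (Lu *m v) + Lu *m g v).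
  by rewrite !mulmxBr -scalemxAr mulmxDr !mulmxA spLuA.
rewrite /bnorm ge_max; apply/andP; split.
  have -> : Ls *m (X k.+1 - X k - dl *: (A *m X k + g (X k))) =
      dl *: (Ls *m (gam k - g (X k))).
    rewrite Es [in LHS]/X !picard_s /= -/(gam k) mulmxBr.
    move: (fwd _ _ _ _) (As *m _) (Ls *m gam k) (Ls *m g (X k)) => v v' t t'.
    by apply/matrixP => a b; rewrite !mxE; ring.
  rewrite anormZ gtr0_norm //; apply: (@le_trans _ _ (2 * (eps * r) * dl ^+ 2)).
    by rewrite -D2 ler_wpM2l ?(ltW dl0) // (le_trans (ns_bnorm _ _)).
  rewrite ler_wpM2r ?sqr_ge0 // /picard_cst lerDr; apply: mulr_ge0 => //.
  by apply: mulr_ge0; [exact: addr_ge0|exact: ltW].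
set z' := Lu *m X k.+1; set z := Lu *m X k.
have Ez : z = z' + dl *: (- Au *m z') - dl *: (Lu *m gam k).
  rewrite /z /z' /X !picard_u; rewrite -(subnSK kK) /=.
  by rewrite subnSK // subKn.
have -> : Lu *m (X k.+1 - X k - dl *: (A *m X k + g (X k))) =
    dl *: (Au *m (z' - z)) + dl *: (Lu *m (gam k - g (X k))).
  rewrite Eu -/z -/z' !mulmxBr.
  move: (Au *m z) => az; rewrite Ez mulNmx.
  by apply/matrixP => a b; rewrite !mxE; ring.
apply: le_trans (anormD _ _ _) _; rewrite !anormZ gtr0_norm //.
rewrite /picard_cst mulrDl lerD //; last first.
  by rewrite -D2 ler_wpM2l ?(ltW dl0) // (le_trans (nu_bnorm _ _)).
rewrite (_ : cA * _ * _ = dl * (cA * (dl * ((cA + eps) * r)))); last by ring.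
rewrite ler_wpM2l ?(ltW dl0) //; apply: le_trans (nu_Au _) _; rewrite ler_wpM2l //.
have -> : z' - z = dl *: (Au *m z' + Lu *m gam k).
  by rewrite Ez mulNmx; apply/matrixP => a b; rewrite !mxE; ring.
rewrite anormZ gtr0_norm // ler_wpM2l ?(ltW dl0) //.
apply: le_trans (anormD _ _ _) _; rewrite mulrDl lerD //.
  apply: le_trans (nu_Au _) _; rewrite ler_wpM2l // ltW //.
  by apply: le_lt_trans (nu_bnorm _ _) _; exact: le_lt_trans (picard_le j.+1 sm yr kK) yr.
apply: le_trans (nu_bnorm _ _) _.
have h := picard_le j sm yr kK'.
apply: le_trans (box_g_le g0 r0 glip (le_lt_trans h yr)) _.
by rewrite ler_wpM2l // ltW // (le_lt_trans h).
Qed.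

End Picard.

(** * Uniform Gevrey bounds on the Picard iterates *)

Section PicardMaj.
Context {R : realType}.

Lemma maj_mx d n k (O : set 'cV[R]_d) (f : 'cV[R]_d -> 'cV[R]_n) phi : open O ->
  (forall j, 0 <= phi j) -> (forall l, maj k O Num.norm (fun x => f x l 0) phi) ->
  maj k O Num.norm f phi.
Proof.
move=> oO; elim: k f phi => [|k IH] f phi phi0 H.
  by split=> // x Ox; apply: cV_norm_le => // l; have [Hl _] := H l; exact: Hl.
split=> [x Ox|i].
  by apply: cV_norm_le => // l; have [Hl _] := H l; exact: Hl.
have df x : O x -> derivable f x (delta_mx i 0).
  move=> Ox; apply/derivable_mxP => l l'; rewrite (ord1 l').
  by have [_ /(_ i) [Hd _]] := H l; exact: Hd.
split=> //; apply: IH => [j|l]; first exact: phi0.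
have [_ /(_ i) [_ Hm]] := H l.
by apply: maj_ext Hm => // x Ox; rewrite derive_mx ?mxE //; exact: df.
Qed.

Lemma maj_cst0 d (W : normedModType R) k (O : set 'cV[R]_d) (nu : W -> R) phi :
  nu 0 = 0 -> (forall j, 0 <= phi j) -> maj k O nu (fun=> 0) phi.
Proof.
move=> nu0; elim: k phi => [|k IH] phi phi0; first by split=> // x _; rewrite nu0.
split=> [x _|i]; first by rewrite nu0.
split=> [x _|]; first exact: derivable_cst.
rewrite (_ : 'D_(delta_mx i 0) _ = fun=> 0); last first.
  by rewrite funeqE => x; exact: derive_cst.
by apply: IH => j; exact: phi0.
Qed.

Lemma maj_id d k (O : set 'cV[R]_d) (nu : 'cV[R]_d -> R) phi :
  nu 0 = 0 -> (forall j, 0 <= phi j) -> (forall x, O x -> nu x <= phi 0%N) ->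
  (forall i, nu (delta_mx i 0) <= phi 1%N) -> maj k O nu id phi.
Proof.
move=> nu0 phi0 H0 H1; case: k => [|k]; first by split.
split=> // i; split=> [x _|]; first exact: derivable_id.
rewrite (_ : 'D_(delta_mx i 0) id = fun=> delta_mx i 0); last first.
  by rewrite funeqE => x; exact: derive_id.
case: k => [|k]; first by split=> // x _; exact: H1.
split=> [x _|j]; first exact: H1.
split=> [x _|]; first exact: derivable_cst.
rewrite (_ : 'D_(delta_mx j 0) _ = fun=> 0); last first.
  by rewrite funeqE => x; exact: derive_cst.
by apply: maj_cst0 => // l; exact: phi0.
Qed.

Context {n d m : nat} {A : 'M[R]_n} (S : splitting A d m).
Local Notation P := (spP S).
Local Notation Q := (spQ S).
Local Notation Ls := (spLs S).
Local Notation Lu := (spLu S).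
Local Notation As := (spAs S).
Local Notation Au := (spAu S).
Local Notation lam := (splam S).
Local Notation ns := (sp_ns S).
Local Notation nu := (sp_nu S).
Local Notation N := (bnorm S).

Variables (g : 'cV[R]_n -> 'cV[R]_n) (r eps c beta M C epsg a rho b0 : R).
Hypotheses (g0 : g 0 = 0) (r0 : 0 < r) (eps0 : 0 <= eps) (epslam : eps <= lam / 4)
  (glip : forall x x', N x < r -> N x' < r -> N (g x - g x') <= eps * N (x - x'))
  (beta1 : 1 <= beta) (c1 : 1 <= c) (M0 : 0 <= M) (C0 : 0 <= C) (epsg0 : 0 <= epsg)
  (a0 : 0 <= a) (rho0 : 0 <= rho)
  (HL : forall x, ns (Ls *m x) <= c * `|x| /\ nu (Lu *m x) <= c * `|x|)
  (HPQ : forall y z i, `|(P *m y + Q *m z) i 0| <= c * ns y + c * nu z)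
  (Hg : forall l s x, N x < r -> differentiable (iter_partial s (fun x => g x l 0)) x /\
     `|iter_partial s (fun x => g x l 0) x| <= M * C ^+ size s * (size s)`!%:R `^ beta)
  (Hg1 : forall l i x, N x < r -> `|partial i (fun x => g x l 0) x| <= epsg).

(* The factor j^-2 makes these bounds stable under binomial convolution. Order 0
   is kept apart: it carries no power of rho and need not be small. *)
Definition gbound (j : nat) : R :=
  if j == 0%N then b0 else j`!%:R `^ beta * (a * rho ^+ j / j%:R ^+ 2).

(** [closes] lets the contraction rate absorb the forcing at positive orders, and [b0M] does so at
    order 0. [b0r] and [init] place the stable datum, as a function of itself, under the bound. In 2
    c a each of the two components accounts for one c a. *)
Hypotheses (small : 16 * n%:R * C * (2 * c * a) <= 1) (b0r : r <= b0) (b0M : c * M <= lam * b0)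
  (closes : c * (epsg * n%:R * (2 * c * a) + 16 * M * (n%:R * C * (2 * c * a)) ^+ 2) <= lam * a)
  (init : forall i, ns (delta_mx i 0) <= a * rho).

Local Notation O := [set y : 'cV[R]_d | ns y < r].

Lemma gbound_ge0 j : 0 <= gbound j.
Proof.
rewrite /gbound; case: eqP => _; first by apply: le_trans b0r; exact: ltW.
by rewrite mulr_ge0 ?powR_ge0 // divr_ge0 ?mulr_ge0 ?exprn_ge0.
Qed.

Lemma anorm_continuous p (B : 'M[R]_p) l (nn : adapted_norm B l) : continuous nn.
Proof.
move=> x; apply/(@cvgrPdist_le _ _ _ (nbhs x)) => e e0.
have k0 : 0 < `|anorm_cst nn| + 1 by rewrite ltr_wpDl.
have : \forall y \near x, ball x (e / (`|anorm_cst nn| + 1)) y.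
  by apply: nbhsx_ballx; rewrite divr_gt0.
apply: filterS => y; rewrite -ball_normE /= ltr_pdivlMr // => /ltW xy.
apply: le_trans xy.
have h z : nn z <= `|z| * (`|anorm_cst nn| + 1).
  apply: le_trans (anorm_le _ _) _; rewrite mulrC ler_wpM2l //.
  by apply: le_trans (ler_norm _) _; rewrite lerDl.
have t1 := anormD nn (x - y) y; have t2 := anormD nn (y - x) x.
have h1 := h (x - y); have h2 := h (y - x).
rewrite subrK in t1; rewrite subrK in t2; rewrite [`|y - x|]distrC in h2.
by rewrite ler_norml; lra.
Qed.

Lemma open_anorm_ball : open O.
Proof.
have -> : O = ns @^-1` [set t | t < r] by [].
by apply: open_comp => [y _|]; [exact: anorm_continuous|exact: open_lt].
Qed.

(** By [PhiB], c times the bound on the forcing is at most lam times [gbound]. An Euler step then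
    yields at most (1 - dl lam) gbound + dl lam gbound, so the bound is invariant whatever the mesh,
    the horizon and the iteration. *)
Lemma picard_maj dl K j k kap : small_step S dl -> (k <= K)%N ->
  maj kap O ns (fun y : 'cV[R]_d => Ls *m picard S g dl K j y k) gbound /\
  maj kap O nu (fun y : 'cV[R]_d => Lu *m picard S g dl K j y k) gbound.
Proof.
move=> sm; elim: j k => [|j IH] k kK.
  split; apply: (maj_ext open_anorm_ball (f := fun=> 0)) => [x _|];
    rewrite ?mulmx0 //; apply: maj_cst0; rewrite ?anorm0 //; exact: gbound_ge0.
have [dl0 dls dlu _ dllam] := sm.
pose Phi i := if i == 0%N then M else i`!%:R `^ beta * (rho ^+ i / i%:R ^+ 2) *
  (epsg * n%:R * (2 * c * a) + 16 * M * (n%:R * C * (2 * c * a)) ^+ 2).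
have Phi0 i : 0 <= Phi i.
  rewrite /Phi; case: eqP => // _; apply: mulr_ge0.
    by rewrite mulr_ge0 ?powR_ge0 // divr_ge0 ?exprn_ge0.
  have ca0 : 0 <= 2 * c * a by rewrite mulr_ge0 // mulr_ge0 // (le_trans ler01).
  apply: addr_ge0; apply: mulr_ge0 => //; [exact: mulr_ge0|exact: mulr_ge0|].
  by rewrite sqr_ge0.
have PhiB i : c * Phi i <= lam * gbound i.
  rewrite /Phi /gbound; case: eqP => // _.
  rewrite (_ : lam * _ = i`!%:R `^ beta * (rho ^+ i / i%:R ^+ 2) * (lam * a)); last by ring.
  rewrite mulrCA ler_wpM2l //.
  by rewrite mulr_ge0 ?powR_ge0 // divr_ge0 ?exprn_ge0.
have Hgam i : (i <= K)%N -> maj kap O Num.norm (fun y : 'cV[R]_d => g (picard S g dl K j y i)) Phi.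
  move=> iK; apply: maj_mx; [exact: open_anorm_ball|exact: Phi0|] => l.
  have [IHs IHu] := IH i iK.
  have HX l' : maj kap O Num.norm (fun y : 'cV[R]_d => picard S g dl K j y i l' 0)
      (fun q => if q == 0%N then 2 * c * b0
                else q`!%:R `^ beta * ((2 * c * a) * rho ^+ q / q%:R ^+ 2)).
    pose Le p (B : 'M[R]_(n, p)) (w : 'cV[R]_p) : R := (B *m w) l' 0.
    have linLe p B : linear (@Le p B).
      by move=> t u v; rewrite /Le mulmxDr -scalemxAr !mxE.
    pose LP : {linear 'cV[R]_d -> R} := HB.pack (Le d P) (GRing.isLinear.Build _ _ _ _ (Le d P) (linLe d P)).
    pose LQ : {linear 'cV[R]_m -> R} := HB.pack (Le m Q) (GRing.isLinear.Build _ _ _ _ (Le m Q) (linLe m Q)).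
    have c0 : 0 <= c by exact: le_trans c1.
    have cLP : continuous LP by exact: cV_linear_continuous.
    have cLQ : continuous LQ by exact: cV_linear_continuous.
    have Hle w1 w2 : `|LP w1 + LQ w2| <= c * ns w1 + c * nu w2.
      by have := HPQ w1 w2 l'; rewrite mxE.
    have := maj_lin cLP cLQ c0 c0 Hle open_anorm_ball IHs IHu.
    move=> Hm; apply: (maj_ext open_anorm_ball _ (maj_le _ Hm)) => [x _|q _].
      by rewrite -{3}[picard _ _ _ _ _ x i](sp_decomp S) mxE.
    by rewrite /gbound; case: eqP => _; rewrite le_eqVlt; apply/orP; left; apply/eqP; ring.
  have ca0 : 0 <= 2 * c * a by rewrite mulr_ge0 // mulr_ge0 // (le_trans ler01).
  have OU (y : 'cV[R]_d) : O y -> [set x | N x < r] (picard S g dl K j y i).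
    by move=> yr; exact: le_lt_trans (picard_le g0 r0 eps0 epslam glip j sm yr iK) yr.
  exact: (@maj_gevrey_comp R beta (2 * c * a) rho beta1 ca0 rho0 kap.+1 d n O
    [set x | N x < r] (fun x => g x l 0) M C epsg (2 * c * b0)
    (fun y : 'cV[R]_d => picard S g dl K j y i) kap open_anorm_ball OU M0 C0 epsg0
    (Hg l) (Hg1 l) small (ltnSn kap) HX).
have c0 : 0 <= c by exact: le_trans c1.
have q0 : 0 <= 1 - dl * lam by rewrite subr_ge0.
have dlc : 0 <= dl * c by rewrite mulr_ge0 // ltW.
have close_maj q : (1 - dl * lam) * gbound q + dl * c * Phi q <= gbound q.
  have := ler_wpM2l (ltW dl0) (PhiB q); rewrite !mulrA; lra.
split.
  apply: (@maj_ext R d 'cV[R]_d kap O _ (fun y : 'cV[R]_d => fwd S dl (fun i => g (picard S g dl K j y i)) y k) _ _ open_anorm_ball).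
    by move=> x _; rewrite picard_s.
  elim: k kK => [|k IHk] kK.
    apply: maj_id; [exact: anorm0|exact: gbound_ge0| |].
      by move=> x xr; apply: le_trans b0r; exact: ltW.
    by move=> i; rewrite /gbound /= powR1 mul1r expr1 expr1n divr1.
  pose L1 : {linear 'cV[R]_d -> 'cV[R]_d} := mulmx (1%:M + dl *: As).
  pose L2 : {linear 'cV[R]_n -> 'cV[R]_d} := mulmx (dl *: Ls).
  have cL1 : continuous L1 by exact: cV_linear_continuous.
  have cL2 : continuous L2 by exact: cV_linear_continuous.
  have Hle w1 w2 : ns (L1 w1 + L2 w2) <= (1 - dl * lam) * ns w1 + dl * c * `|w2|.
    apply: le_trans (anormD _ _ _) _; rewrite /= mulmxDl mul1mx -!scalemxAl lerD ?anorm_contr ?(ltW dl0) //.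
    by rewrite anormZ gtr0_norm // -mulrA ler_wpM2l ?(ltW dl0) //; have [] := HL w2.
  have := maj_lin cL1 cL2 q0 dlc Hle open_anorm_ball (IHk (ltnW kK)) (Hgam k (ltnW kK)).
  move=> Hm; apply: (maj_ext open_anorm_ball _ (maj_le _ Hm)) => [x _|q _ //].
  by rewrite /= mulmxDl mul1mx -!scalemxAl.
apply: (@maj_ext R d 'cV[R]_m kap O _ (fun y : 'cV[R]_d => bwd S dl (fun i => g (picard S g dl K j y i)) K (K - k)) _ _ open_anorm_ball).
  by move=> x _; rewrite picard_u.
elim: (K - k)%N (leq_subr k K) => [|l IHl] lK.
  by apply: maj_cst0; [exact: anorm0|exact: gbound_ge0].
pose L1 : {linear 'cV[R]_m -> 'cV[R]_m} := mulmx (1%:M + dl *: (- Au)).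
pose L2 : {linear 'cV[R]_n -> 'cV[R]_m} := mulmx (- (dl *: Lu)).
have cL1 : continuous L1 by exact: cV_linear_continuous.
have cL2 : continuous L2 by exact: cV_linear_continuous.
have Hle w1 w2 : nu (L1 w1 + L2 w2) <= (1 - dl * lam) * nu w1 + dl * c * `|w2|.
  apply: le_trans (anormD _ _ _) _.
  rewrite /= mulmxDl mul1mx mulNmx -!scalemxAl anormN lerD ?anorm_contr ?(ltW dl0) //.
  by rewrite anormZ gtr0_norm // -mulrA ler_wpM2l ?(ltW dl0) //; have [] := HL w2.
have Kl : (K - l.+1 <= K)%N by exact: leq_subr.
have := maj_lin cL1 cL2 q0 dlc Hle open_anorm_ball (IHl (ltnW lK)) (Hgam _ Kl).
move=> Hm; apply: (maj_ext open_anorm_ball _ (maj_le _ Hm)) => [x _|q _ //].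
by rewrite /= mulmxDl mul1mx mulNmx -!scalemxAl.
Qed.

End PicardMaj.

(** * Passage to the limit *)

Lemma pow4_double k p : (k <= 4 ^ p)%N -> (2 * k <= 4 ^ p.+1)%N.
Proof. by move=> h; rewrite expnS; apply: leq_mul. Qed.

Section Dyadic.
Context {R : realType}.

Definition dyad (m : nat) : R := 2^-1 ^+ m.

Lemma dyad_gt0 m : 0 < dyad m.
Proof. by rewrite exprn_gt0 // invr_gt0. Qed.

Lemma dyad_le1 m : dyad m <= 1.
Proof. by rewrite exprn_ile1 // ?invr_ge0 // invf_le1 // ler1n. Qed.

Lemma dyadS m : dyad m = 2 * dyad m.+1.
Proof. by rewrite /dyad exprS mulrA divff // mul1r. Qed.

Lemma dyadV m : 2 ^+ m * dyad m = 1.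
Proof. by rewrite -exprMn divff // expr1n. Qed.

Lemma dyad_small (e : R) : 0 < e -> exists m0, forall m, (m0 <= m)%N -> dyad m <= e.
Proof.
move=> e0; exists (Num.truncn e^-1).+1 => m mm.
have h1 : e^-1 < m%:R.
  by apply: lt_le_trans (truncnS_gt _) _; rewrite ler_nat.
have h2 : m%:R <= 2 ^+ m :> R by rewrite -natrX ler_nat ltnW // ltn_expl.
have p : 0 < 2 ^+ m :> R by rewrite exprn_gt0.
rewrite -(ler_pM2l p) dyadV -[X in X <= _](mulVf (lt0r_neq0 e0)).
by rewrite ler_wpM2r ?(ltW e0) // ltW // (lt_le_trans h1).
Qed.

Lemma le_dyad (a b K : R) m1 : (forall m, (m1 <= m)%N -> a <= b + K * dyad m) -> a <= b.
Proof.
move=> H; apply/ler_addgt0Pr => e e0.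
have [m2 Hm2] := dyad_small (divr_gt0 e0 (ltr_wpDl (normr_ge0 K) ltr01)).
apply: le_trans (H (maxn m1 m2) (leq_maxl _ _)) _; rewrite lerD2l.
have p : 0 < `|K| + 1 by rewrite ltr_wpDl.
have := Hm2 _ (leq_maxr m1 m2); rewrite ler_pdivlMr // => h.
apply: le_trans h; rewrite mulrC ler_wpM2l ?(ltW (dyad_gt0 _)) //.
by apply: le_trans (ler_norm _) _; rewrite lerDl.
Qed.

(** Induction on (1 - x)(1 + (M + 1) x) <= 1 + M x. A decay of order 1 / (M x) is all that
    [compare_rate] asks for. *)
Lemma bernoulli_decay (x : R) M : 0 <= x -> x <= 1 -> (1 - x) ^+ M * (1 + M%:R * x) <= 1.
Proof.
move=> x0 x1; elim: M => [|M IH]; first by rewrite mul0r addr0 mulr1.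
have q0 : 0 <= (1 - x) ^+ M by rewrite exprn_ge0 // subr_ge0.
rewrite exprS -natr1; apply: le_trans IH; rewrite [(1 - x) * _]mulrC -mulrA ler_wpM2l //.
have : 0 <= M%:R :> R by []. move: (M%:R) => t t0; nra.
Qed.

Definition dstep (t : R) (m : nat) : nat := Num.truncn (t * 2 ^+ m).

Lemma dstep_itv t m : 0 <= t -> (dstep t m)%:R * dyad m <= t < (dstep t m).+1%:R * dyad m.
Proof.
move=> t0; have h : 0 <= t * 2 ^+ m by rewrite mulr_ge0 // exprn_ge0.
have /andP[h1 h2] := truncn_itv h.
have E : t = t * 2 ^+ m * dyad m by rewrite -mulrA dyadV mulr1.
by rewrite {2 3}E ler_pM2r ?dyad_gt0 // ltr_pM2r ?dyad_gt0 // h1 h2.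
Qed.

Lemma dstep_le s t m : 0 <= s -> s <= t -> (dstep s m <= dstep t m)%N.
Proof.
move=> s0 st; apply: le_truncn; by rewrite ler_wpM2r // exprn_ge0.
Qed.

Lemma dstepS t m : 0 <= t -> (2 * dstep t m <= dstep t m.+1 <= (2 * dstep t m).+1)%N.
Proof.
move=> t0; have /andP[a1 a2] := dstep_itv m t0; have /andP[b1 b2] := dstep_itv m.+1 t0.
have D := dyad_gt0 m.+1; rewrite dyadS in a1 a2.
have h1 : (2 * dstep t m)%:R < (dstep t m.+1).+1%:R :> R.
  by rewrite -(ltr_pM2r D); apply: le_lt_trans b2; rewrite natrM; lra.
have h2 : (dstep t m.+1)%:R < (2 * (dstep t m).+1)%:R :> R.
  by rewrite -(ltr_pM2r D); apply: le_lt_trans b1 _; rewrite natrM; lra.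
by move: h1 h2; rewrite !ltr_nat; lia.
Qed.

Lemma dstep0 m : dstep 0 m = 0%N.
Proof. by rewrite /dstep mul0r truncn0. Qed.

End Dyadic.

Section Limit.
Context {R : realType} {n d m : nat} {A : 'M[R]_n} (S : splitting A d m).
Local Notation Ls := (spLs S).
Local Notation lam := (splam S).
Local Notation ns := (sp_ns S).
Local Notation nu := (sp_nu S).
Local Notation N := (bnorm S).

Lemma geo_limit (v : nat -> 'cV[R]_n) (K : R) m1 :
  (forall p, (m1 <= p)%N -> N (v p - v p.+1) <= K * dyad p) ->
  exists u, forall p, (m1 <= p)%N -> N (u - v p) <= 2 * K * dyad p.
Proof.
move=> H; have [c c1 [HN HNi _ _ _]] := bnorm_cst S.
have c0 : 0 <= c := le_trans ler01 c1.
have K0 : 0 <= K.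
  have := le_trans (bnorm_ge0 S _) (H m1 (leqnn _)).
  by rewrite pmulr_lge0 // dyad_gt0.
have tel p q : (m1 <= p)%N -> N (v p - v (p + q)%N) <= 2 * K * (dyad p - dyad (p + q)).
  move=> mp; elim: q => [|q IH]; first by rewrite addn0 subrr bnorm0 subrr mulr0.
  have -> : v p - v (p + q.+1)%N = (v p - v (p + q)%N) + (v (p + q)%N - v (p + q.+1)%N).
    by rewrite addrA subrK.
  apply: le_trans (bnormD _ _ _) _; rewrite addnS.
  have := H _ (leq_trans mp (leq_addr q p)); have := dyadS (R := R) (p + q); move: IH.
  move: (dyad p) (dyad (p + q)) (dyad (p + q).+1) => x y z h Ey h'; subst y.
  rewrite (_ : 2 * K * (x - z) = 2 * K * (x - 2 * z) + K * (2 * z)); last by ring.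
  exact: lerD.
have tel' p q : (m1 <= p)%N -> (p <= q)%N -> N (v p - v q) <= 2 * K * dyad p.
  move=> mp pq; rewrite -(subnKC pq); apply: le_trans (tel _ _ mp) _.
  by rewrite ler_wpM2l ?mulr_ge0 // gerBl ltW // dyad_gt0.
have Hc : cvg (v p @[p --> \oo]).
  apply/cauchy_cvgP/cauchyP => e e0.
  have p0 : 0 < e / (c * (2 * K) + 1).
    by rewrite divr_gt0 // ltr_wpDl // mulr_ge0 // mulr_ge0.
  have [m2 Hm2] := dyad_small p0.
  pose p := maxn m1 m2; exists (v p); exists p => // q /= pq.
  rewrite -ball_normE /=; apply: le_lt_trans (HNi _) _.
  apply: le_lt_trans (ler_wpM2l c0 (tel' _ _ (leq_maxl m1 m2) pq)) _.
  have := Hm2 _ (leq_maxr m1 m2); rewrite -/p ler_pdivlMr; last first.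
    by rewrite ltr_wpDl // mulr_ge0 // mulr_ge0.
  by have := dyad_gt0 (R := R) p; rewrite mulrDr mulr1 mulrA [dyad p * _]mulrC; lra.
pose u := lim (v p @[p --> \oo]); exists u => p mp.
apply/ler_addgt0Pr => e e0.
have /(@cvgrPdist_lt _ _ _ (nbhs \oo)) /(_ (e / c)) [] : v p @[p --> \oo] --> u by exact: Hc.
  by rewrite divr_gt0 // (lt_le_trans ltr01).
move=> q0 _ Hq; pose q := maxn p q0.
have -> : u - v p = (u - v q) - (v p - v q) by rewrite opprB addrA subrK.
apply: le_trans (bnormB _ _ _) _; rewrite addrC lerD ?tel' ?leq_maxl //.
apply: le_trans (HN _) _; have := Hq q (leq_maxr p q0) => /ltW /(ler_wpM2l c0) h.
by apply: le_trans h _; rewrite mulrC divfK // gt_eqF // (lt_le_trans ltr01).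
Qed.

Variables (g : 'cV[R]_n -> 'cV[R]_n) (r eps cA : R).
Hypotheses (g0 : g 0 = 0) (r0 : 0 < r) (eps0 : 0 <= eps) (epslam : eps <= lam / 4)
  (glip : forall x x', N x < r -> N x' < r -> N (g x - g x') <= eps * N (x - x'))
  (cA0 : 0 <= cA) (HcA : forall x, N (A *m x) <= cA * N x).
Local Notation LF := (cA + eps).

Let lam0 : 0 < lam := splam_gt0 S.
Let LF0 : 0 <= LF. Proof. exact: addr_ge0. Qed.

Lemma small_dyad : exists m0, forall p, (m0 <= p)%N -> small_step S (dyad p).
Proof.
have [m1 H1] := dyad_small (anorm_step_gt0 ns).
have [m2 H2] := dyad_small (anorm_step_gt0 nu).
have li : 0 < lam^-1 by rewrite invr_gt0.
have [m3 H3] := dyad_small li.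
exists (maxn m1 (maxn m2 m3)) => p; rewrite !geq_max => /and3P[p1 p2 p3].
split; [exact: dyad_gt0|exact: H1|exact: H2|exact: dyad_le1|].
have := H3 _ p3; rewrite -(ler_pM2r lam0) mulVf // gt_eqF //.
Qed.

(* Mesh 2^-p on the time interval [0, 2^p]. Each Picard iteration gains a factor
   2, so after p + 1 of them the remaining defect is of the order of the mesh. *)
Definition traj (p : nat) (y : 'cV[R]_d) : nat -> 'cV[R]_n :=
  picard S g (dyad p) (4 ^ p) p.+1 y.

Local Notation C1 := (picard_cst r eps cA).
Local Notation C2 := (approx_curv r eps cA C1).

Lemma picard_cst_ge0 : 0 <= C1.
Proof.
by apply: addr_ge0; apply: mulr_ge0 => //; apply: mulr_ge0 => //; exact: ltW.
Qed.

Lemma approx_curv_ge (C : R) : 0 <= C -> C <= approx_curv r eps cA C.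
Proof.
move=> C0; rewrite lerDl; apply: mulr_ge0 => //; apply: addr_ge0 => //.
by apply: mulr_ge0 => //; exact: ltW.
Qed.

Lemma traj_approx p y : small_step S (dyad p) -> ns y < r ->
  approx S g r C1 (dyad p) (4 ^ p) (traj p y).
Proof.
move=> sm yr; apply: picard_approx => //.
by rewrite -/(dyad p) ler_peMl ?ler1n // ltW // dyad_gt0.
Qed.

Lemma traj0 p y : Ls *m traj p y 0 = y.
Proof. by rewrite /traj picard_s. Qed.

Definition rate (C : R) := compare_cst S r eps cA C + 8 * r / lam.

(** In the first half of the window at least 4^p / 2 steps remain before the far end. With x = 2^-p
    lam / 2, [bernoulli_decay] bounds the influence of that end by (4 / lam) 2^-p, hence the summand
    8 r / lam in [rate]. *)
Lemma compare_rate (C : R) p x x' k : 0 <= C -> small_step S (dyad p) ->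
  approx S g r C (dyad p) (4 ^ p) x -> approx S g r C (dyad p) (4 ^ p) x' ->
  Ls *m x 0%N = Ls *m x' 0%N -> (2 * k <= 4 ^ p)%N ->
  N (x k - x' k) <= rate C * dyad p.
Proof.
move=> C0 sm H H' E k2.
have kK : (k <= 4 ^ p)%N by apply: leq_trans k2; rewrite leq_pmull.
apply: le_trans (approx_compare r0 eps0 epslam glip cA0 HcA C0 sm H H' E kK) _.
rewrite /rate [in leRHS]mulrDl lerD2l.
have [D0 _ _ D1 Dlam] := sm; set D := dyad p in D0 D1 Dlam *.
set M := (4 ^ p - k)%N.
have x0 : 0 <= D * lam / 2 by rewrite divr_ge0 // mulr_ge0 // ltW.
have x1 : D * lam / 2 <= 1 by lra.
have B := bernoulli_decay M x0 x1.
have M4 : 4 ^+ p <= 2 * M%:R :> R.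
  rewrite -natrX -natrM ler_nat /M; move: k2 kK; clear.
  by move: (4 ^ p)%N => q; lia.
have DD : 4 ^+ p * D * D = 1.
  by rewrite -mulrA -exprMn -exprMn (_ : 4 * _ = 1) ?expr1n //; field.
have MD : lam / 4 <= M%:R * (D * lam / 2) * D.
  have := ler_wpM2r (ltW D0) (ler_wpM2r (ltW D0) M4); rewrite DD => h.
  have := ler_wpM2l (ltW lam0) h; lra.
have q0 : 0 <= (1 - D * lam / 2) ^+ M by rewrite exprn_ge0 // subr_ge0.
have h5 : (1 - D * lam / 2) ^+ M * (M%:R * (D * lam / 2)) <= 1.
  by apply: le_trans B; rewrite ler_wpM2l // lerDr.
have := ler_wpM2r (ltW D0) h5; rewrite mul1r => h6.
have := ler_wpM2l q0 MD; rewrite [leRHS]mulrA => /le_trans/(_ h6).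
move: (_ ^+ M) => q; rewrite (_ : 8 * r / lam * D = 2 * r * (D * (4 / lam))); last by ring.
move=> h; rewrite ler_wpM2l ?mulr_ge0 ?(ltW r0) //.
rewrite -ler_pdivrMr ?divr_gt0 // invf_div //.
Qed.

Definition traj_cst := rate C2 + approx_speed r eps cA C1.

(** Every second point of the finer trajectory is an approximate solution on the coarser mesh with
    the same stable datum, so [compare_rate] applies. The grid indices of [t] on the two meshes then
    differ by at most one fine step. *)
Lemma traj_cauchy p y (t : R) : small_step S (dyad p) -> small_step S (dyad p.+1) ->
  ns y < r -> 0 <= t -> 2 * t <= 2 ^+ p ->
  N (traj p y (dstep t p) - traj p.+1 y (dstep t p.+1)) <= traj_cst * dyad p.
Proof.
move=> sm sm' yr t0 tp; have C10 := picard_cst_ge0; have C12 := approx_curv_ge C10.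
have [D0 _ _ D1 _] := sm; have [D0' _ _ D1' _] := sm'.
have H := approx_le C12 (traj_approx sm yr); have H' := traj_approx sm' yr.
have HH : approx S g r C2 (dyad p) (4 ^ p) (fun k => traj p.+1 y (2 * k)%N).
  split=> k kK; first by exact: (proj1 H' _ (pow4_double kK)).
  have := approx_multi (k := (2 * k)%N) (l := 2) g0 r0 eps0 glip cA0 HcA C10 D0' D1' H'.
  by rewrite -dyadS addnC -mulnS; apply; exact: pow4_double.
have k2 : (2 * dstep t p <= 4 ^ p)%N.
  have /andP[h _] := dstep_itv p t0.
  rewrite -(ler_nat R) natrM natrX -(ler_pM2r D0).
  apply: (@le_trans _ _ (2 * t)); first by rewrite -mulrA ler_wpM2l.
  apply: le_trans tp _; have -> : 4 ^+ p = 2 ^+ p * 2 ^+ p :> R.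
    by rewrite -exprMn; congr (_ ^+ p); ring.
  by rewrite -mulrA dyadV mulr1.
have E : Ls *m traj p y 0 = Ls *m traj p.+1 y (2 * 0)%N by rewrite muln0 !traj0.
have h1 := compare_rate (le_trans C10 C12) sm H HH E k2.
have /andP[a1 a2] := dstepS p t0.
have h2 : N (traj p.+1 y (2 * dstep t p)%N - traj p.+1 y (dstep t p.+1)) <=
    approx_speed r eps cA C1 * dyad p.
  rewrite bnormBC -(subnKC a1).
  apply: le_trans (approx_step g0 r0 eps0 glip cA0 HcA C10 D0' D1' H' _) _.
    rewrite subnKC //; apply: leq_trans a2 _; apply: leq_ltn_trans k2 _.
    by rewrite ltn_exp2l.
  have sp0 : 0 <= approx_speed r eps cA C1.
    by apply: addr_ge0 => //; apply: mulr_ge0 => //; exact: ltW.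
  rewrite ler_wpM2l // (dyadS p) ler_wpM2r ?(ltW D0') // ler_nat.
  by rewrite leq_subLR; apply: leq_trans a2 _; rewrite addn2.
rewrite /traj_cst mulrDl.
have -> : traj p y (dstep t p) - traj p.+1 y (dstep t p.+1) =
  (traj p y (dstep t p) - traj p.+1 y (2 * dstep t p)%N) +
  (traj p.+1 y (2 * dstep t p)%N - traj p.+1 y (dstep t p.+1)) by rewrite addrA subrK.
by apply: le_trans (bnormD _ _ _) _; exact: lerD.
Qed.

Lemma limit_traj y : ns y < r -> exists u : R -> 'cV[R]_n, forall t, 0 <= t ->
  exists m1, forall p, (m1 <= p)%N -> small_step S (dyad p) /\ 2 * t <= 2 ^+ p /\
    N (u t - traj p y (dstep t p)) <= 2 * traj_cst * dyad p.
Proof.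
move=> yr; have [m0 Hm0] := small_dyad.
suff H (t : R) : exists v : 'cV[R]_n, 0 <= t -> exists m1, forall p, (m1 <= p)%N ->
    small_step S (dyad p) /\ 2 * t <= 2 ^+ p /\ N (v - traj p y (dstep t p)) <= 2 * traj_cst * dyad p.
  by exists (fun t => projT1 (cid (H t))) => t; case: cid.
have [t0|tn] := boolP (0 <= t); last by exists 0.
have ti : 0 < (2 * t + 1)^-1 by rewrite invr_gt0; lra.
have [m2 Hm2] := dyad_small ti.
have H2 p : (m2 <= p)%N -> 2 * t <= 2 ^+ p.
  move=> /Hm2; have p2 : 0 < 2 ^+ p :> R by rewrite exprn_gt0.
  rewrite -(ler_pM2l p2) dyadV ler_pdivlMr ?mul1r; last by lra.
  by lra.
pose m1 := maxn m0 m2.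
have Hc p : (m1 <= p)%N ->
    N (traj p y (dstep t p) - traj p.+1 y (dstep t p.+1)) <= traj_cst * dyad p.
  rewrite geq_max => /andP[p0 p2].
  by apply: traj_cauchy => //; [exact: Hm0|apply: Hm0; exact: leqW|exact: H2].
have [u Hu] := geo_limit Hc.
exists u => _; exists m1 => p mp; have := mp; rewrite geq_max => /andP[p0 p2].
by split; [exact: Hm0|split; [exact: H2|exact: Hu]].
Qed.

End Limit.

Section LimitProps.
Context {R : realType} {n d m : nat} {A : 'M[R]_n} (S : splitting A d m).
Local Notation Ls := (spLs S).
Local Notation Lu := (spLu S).
Local Notation lam := (splam S).
Local Notation ns := (sp_ns S).
Local Notation nu := (sp_nu S).
Local Notation N := (bnorm S).

Lemma anorm_eq0 p (B : 'M[R]_p) l (nn : adapted_norm B l) y : nn y <= 0 -> y = 0.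
Proof.
move=> y0; have E : nn y = 0 by apply/eqP; rewrite eq_le y0 anorm_ge0.
by apply/eqP; rewrite -normr_le0; have := anorm_ge nn y; rewrite E mulr0.
Qed.

Lemma bnorm_eq0 x : N x <= 0 -> x = 0.
Proof.
move=> x0; rewrite -(sp_decomp S x).
rewrite (anorm_eq0 (le_trans (ns_bnorm S x) x0)) (anorm_eq0 (le_trans (nu_bnorm S x) x0)).
by rewrite !mulmx0 addr0.
Qed.

Variables (g : 'cV[R]_n -> 'cV[R]_n) (r eps cA : R).
Hypotheses (g0 : g 0 = 0) (r0 : 0 < r) (eps0 : 0 <= eps) (epslam : eps <= lam / 4)
  (glip : forall x x', N x < r -> N x' < r -> N (g x - g x') <= eps * N (x - x'))
  (cA0 : 0 <= cA) (HcA : forall x, N (A *m x) <= cA * N x).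
Local Notation F := (fun x : 'cV[R]_n => A *m x + g x).
Local Notation LF := (cA + eps).
Local Notation C1 := (picard_cst r eps cA).
Local Notation C2 := (approx_curv r eps cA C1).
Local Notation K2 := (2 * traj_cst S r eps cA).

Let LF0 : 0 <= LF. Proof. exact: addr_ge0. Qed.

Let C10 : 0 <= C1. Proof. exact: picard_cst_ge0. Qed.
Let C20 : 0 <= C2. Proof. by apply: le_trans C10 _; exact: approx_curv_ge. Qed.

Definition is_limit (y : 'cV[R]_d) (u : R -> 'cV[R]_n) := forall t, 0 <= t ->
  exists m1, forall p, (m1 <= p)%N -> small_step S (dyad p) /\ 2 * t <= 2 ^+ p /\
    N (u t - traj S g p y (dstep t p)) <= K2 * dyad p.

Lemma dstep_range (t : R) p : 0 <= t -> 2 * t <= 2 ^+ p -> (2 * dstep t p <= 4 ^ p)%N.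
Proof.
move=> t0 tp; have /andP[h _] := dstep_itv p t0.
rewrite -(ler_nat R) natrM natrX -(ler_pM2r (dyad_gt0 p)).
apply: (@le_trans _ _ (2 * t)); first by rewrite -mulrA ler_wpM2l.
apply: le_trans tp _; have -> : 4 ^+ p = 2 ^+ p * 2 ^+ p :> R.
  by rewrite -exprMn; congr (_ ^+ p); ring.
by rewrite -mulrA dyadV mulr1.
Qed.

Lemma dstep_range' (t : R) p : 0 <= t -> 2 * t <= 2 ^+ p -> (dstep t p <= 4 ^ p)%N.
Proof.
by move=> t0 tp; apply: leq_trans (dstep_range t0 tp); rewrite leq_pmull.
Qed.

Variables (y : 'cV[R]_d) (u : R -> 'cV[R]_n).
Hypotheses (yr : ns y < r) (Hu : is_limit y u).

Let K20 : 0 <= K2.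
Proof.
have [m1 H] := Hu (lexx 0); have [_ [_ h]] := H m1 (leqnn _).
by have := le_trans (bnorm_ge0 S _) h; rewrite pmulr_lge0 // dyad_gt0.
Qed.

Lemma limit_le t : 0 <= t -> N (u t) <= ns y.
Proof.
move=> t0; have [m1 H] := Hu t0; apply: (@le_dyad _ _ _ K2 m1) => p mp.
have [sm [tp h]] := H p mp.
have h' := picard_le g0 r0 eps0 epslam glip p.+1 sm yr (dstep_range' t0 tp).
rewrite -{1}[u t](subrK (traj S g p y (dstep t p))).
by apply: le_trans (bnormD _ _ _) _; rewrite addrC; exact: lerD.
Qed.

Lemma limit_lt t : 0 <= t -> N (u t) < r.
Proof. by move=> t0; apply: le_lt_trans yr; exact: limit_le. Qed.

(** [approx_multi] survives the passage to the limit, and a quadratic remainder makes the limit a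
    solution of the differential equation. *)
Lemma limit_curv s t : 0 <= s -> s <= t ->
  N (u t - u s - (t - s) *: F (u s)) <= C2 * (t - s) ^+ 2.
Proof.
move=> s0 st; have t0 := le_trans s0 st.
have [m1 H1] := Hu t0; have [m2 H2] := Hu s0.
(* Collects the errors made in replacing [u] by the trajectory and t - s by a multiple [w] of the
   mesh; all are proportional to the mesh. *)
pose KK := 2 * K2 + (t - s) * (LF * K2) + LF * r + C2 * (2 * (t - s) + 1).
apply: (@le_dyad _ _ _ KK (maxn m1 m2)) => p; rewrite geq_max => /andP[p1 p2].
have [sm [tp ht]] := H1 p p1; have [_ [sp hs]] := H2 p p2.
have [D0 _ _ D1 _] := sm.
set k := dstep s p in hs; set kt := dstep t p in ht.
have kkt : (k <= kt)%N by exact: dstep_le.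
set X := traj S g p y in hs ht.
have HX : approx S g r C1 (dyad p) (4 ^ p) X by exact: traj_approx.
have ktK : (kt <= 4 ^ p)%N by exact: dstep_range'.
have Nk : N (X k) < r by apply: (proj1 HX); exact: leq_trans ktK.
have := @approx_multi R n d m A S g r eps cA g0 r0 eps0 glip cA0 HcA C1 (dyad p) (4 ^ p) X k (kt - k) C10 D0 D1 HX.
rewrite subnKC // => /(_ ktK).
set w := (kt - k)%:R * dyad p => hm.
have /andP[a1 a2] := dstep_itv p s0; have /andP[b1 b2] := dstep_itv p t0.
have wE : w = kt%:R * dyad p - k%:R * dyad p by rewrite /w natrB // mulrBl.
have w1 : w - (t - s) <= dyad p by move: a1 a2 b1 b2; rewrite -/k -/kt -!natr1 wE !mulrDl !mul1r; lra.
have w2 : t - s - w <= dyad p by move: a1 a2 b1 b2; rewrite -/k -/kt -!natr1 wE !mulrDl !mul1r; lra.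
have w0 : 0 <= w by rewrite mulr_ge0 // ltW.
have -> : u t - u s - (t - s) *: F (u s) = (X kt - X k - w *: F (X k)) +
   ((u t - X kt) - (u s - X k)) + ((w - (t - s)) *: F (X k) - (t - s) *: (F (u s) - F (X k))).
  rewrite /= ; move: (A *m u s + g (u s)) (A *m X k + g (X k)) => v v'.
  by apply/matrixP => i j; rewrite !mxE; ring.
have e1 : N ((w - (t - s)) *: F (X k)) <= dyad p * (LF * r).
  rewrite bnormZ; apply: ler_pM => //; first exact: bnorm_ge0.
    by rewrite ler_norml; lra.
  apply: le_trans (box_field_le g0 r0 glip HcA Nk) _.
  by rewrite ler_wpM2l // ltW.
have e2 : N ((t - s) *: (F (u s) - F (X k))) <= (t - s) * (LF * (K2 * dyad p)).
  rewrite bnormZ ger0_norm ?subr_ge0 // ler_wpM2l ?subr_ge0 //.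
  apply: le_trans (box_field_lip glip HcA (limit_lt s0) Nk) _.
  by rewrite ler_wpM2l.
have e3 := le_trans (bnormB S (u t - X kt) (u s - X k)) (lerD ht hs).
have e4 := le_trans (bnormB S ((w - (t - s)) *: F (X k)) _) (lerD e1 e2).
apply: le_trans (bnormD _ _ _) _; apply: le_trans (lerD (bnormD _ _ _) (lexx _)) _.
apply: le_trans (lerD (lerD hm e3) e4) _.
have w3 : w ^+ 2 <= (t - s) ^+ 2 + (2 * (t - s) + 1) * dyad p.
  have ts0 : 0 <= t - s by rewrite subr_ge0.
  have gen (a b D : R) : 0 <= a -> 0 <= b -> 0 < D -> D <= 1 -> a - b <= D ->
      a ^+ 2 <= b ^+ 2 + (2 * b + 1) * D.
    move=> ha hb hD hD1 hab; have h : a <= b + D by lra.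
    have := ler_pM ha ha h h; rewrite -expr2; nra.
  exact: gen.
have := ler_wpM2l C20 w3; rewrite mulrDr /KK; move: C2 K2 => c2 k2 hw.
rewrite (_ : c2 * (t - s) ^+ 2 + _ = c2 * (t - s) ^+ 2 + c2 * ((2 * (t - s) + 1) * dyad p) +
  (k2 * dyad p + k2 * dyad p) + (dyad p * (LF * r) + (t - s) * (LF * (k2 * dyad p)))).
  by rewrite !lerD2r.
by ring.
Qed.

Lemma limit_s0 : Ls *m u 0 = y.
Proof.
apply/eqP; rewrite -subr_eq0; apply/eqP/(anorm_eq0 (nn := ns)).
have [m1 H1] := Hu (lexx 0); apply: (@le_dyad _ _ _ K2 m1) => p mp.
have [_ [_ h]] := H1 p mp; rewrite add0r; apply: le_trans h; rewrite dstep0.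
by rewrite -{1}(traj0 S g p y) -mulmxBr ns_bnorm.
Qed.

Lemma limit_u_le e : 0 <= e -> (forall x, N x <= ns y -> N (g x) <= lam * e * N x) ->
  nu (Lu *m u 0) <= e * ns y.
Proof.
move=> e0 He; have [m1 H1] := Hu (lexx 0); apply: (@le_dyad _ _ _ K2 m1) => p mp.
have [sm [_ h]] := H1 p mp; rewrite dstep0 in h.
have h' := picard_u_le g0 r0 eps0 epslam glip p.+1 sm yr (leq0n (4 ^ p)) e0 He.
rewrite -{1}[u 0](subrK (traj S g p y 0)) mulmxDr.
apply: le_trans (anormD _ _ _) _; rewrite addrC; apply: lerD => //.
exact: le_trans (nu_bnorm _ _) h.
Qed.

Lemma limit_u_cvg i : (Lu *m traj S g p y 0) i 0 @[p --> \oo] --> (Lu *m u 0) i 0.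
Proof.
have [m1 H1] := Hu (lexx 0).
have [c c1 [_ HNi _ _ _]] := bnorm_cst S; have [cu cu0 Hcu] := mx_bounded Lu.
have c0 : 0 <= c := le_trans ler01 c1.
apply/cvgrPdist_le => e e0.
have p0 : 0 < e / (cu * (c * K2) + 1).
  by rewrite divr_gt0 // ltr_wpDl // mulr_ge0 // mulr_ge0.
have [m2 H2] := dyad_small p0; exists (maxn m1 m2) => // p /=.
rewrite geq_max => /andP[p1 p2]; have [_ [_ h]] := H1 p p1; rewrite dstep0 in h.
have -> : (Lu *m u 0) i 0 - (Lu *m traj S g p y 0) i 0 = (Lu *m (u 0 - traj S g p y 0)) i 0.
  by rewrite mulmxBr !mxE.
apply: le_trans (cV_entry_le _ _) _; apply: le_trans (Hcu _) _.
apply: le_trans (ler_wpM2l cu0 (HNi _)) _.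
apply: le_trans (ler_wpM2l cu0 (ler_wpM2l c0 h)) _.
have := H2 p p2; rewrite ler_pdivlMr; last by rewrite ltr_wpDl // mulr_ge0 // mulr_ge0.
move=> hh; apply: le_trans hh.
rewrite [leLHS](_ : _ = dyad p * (cu * (c * K2))); last by ring.
by rewrite ler_wpM2l ?lerDl // ltW // dyad_gt0.
Qed.

(** On every fine mesh the given sequence and the Picard trajectory have the same stable datum; once
    both defects are bounded with [CC], [compare_rate] at index 0 brings their starting points
    together. *)
Lemma limit_unique (C : R) x0 m0 : 0 <= C -> Ls *m x0 = y ->
  (forall p, (m0 <= p)%N -> exists2 x, x 0%N = x0 & approx S g r C (dyad p) (4 ^ p) x) ->
  x0 = u 0.
Proof.
move=> C0 Ly H; apply/eqP; rewrite -subr_eq0; apply/eqP/bnorm_eq0.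
have [m1 H1] := Hu (lexx 0).
pose CC := C + C1.
apply: (@le_dyad _ _ _ (rate S r eps cA CC + K2) (maxn m0 m1)) => p.
rewrite geq_max => /andP[p0 p1]; rewrite add0r mulrDl.
have [sm [_ h]] := H1 p p1; have [x E Hx] := H p p0; rewrite dstep0 in h.
have CC0 : 0 <= CC by exact: addr_ge0.
have HX : approx S g r CC (dyad p) (4 ^ p) (traj S g p y).
  have C1CC : C1 <= CC by rewrite lerDr.
  exact: approx_le C1CC (traj_approx g0 r0 eps0 epslam glip cA0 HcA sm yr).
have Hx' : approx S g r CC (dyad p) (4 ^ p) x by apply: approx_le Hx; rewrite lerDl.
have E' : Ls *m x 0%N = Ls *m traj S g p y 0 by rewrite traj0 E.
have := compare_rate r0 eps0 epslam glip cA0 HcA CC0 sm Hx' HX E' (leq0n _ : (2 * 0 <= 4 ^ p)%N).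
rewrite E => h2.
have -> : x0 - u 0 = (x0 - traj S g p y 0) - (u 0 - traj S g p y 0) by rewrite opprB addrA subrK.
by apply: le_trans (bnormB _ _ _) _; exact: lerD.
Qed.

End LimitProps.

(** * Derivatives along an interval, and orbits *)

Section WithinDerivative.
Context {R : realType} {n : nat}.
Implicit Types (J : set R) (u : R -> 'cV[R]_n).

Lemma has_deriv_withinP J u t w : has_deriv_within J u t w <->
  forall e, 0 < e -> exists2 dl, 0 < dl & forall s, J s -> s != t -> `|s - t| < dl ->
    `|u s - u t - (s - t) *: w| <= e * `|s - t|.
Proof.
have E s : s != t -> `|w - (s - t)^-1 *: (u s - u t)| * `|s - t| = `|u s - u t - (s - t) *: w|.
  move=> st; rewrite mulrC -normrZ scalerBr scalerA divff ?subr_eq0 // scale1r.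
  by rewrite distrC.
rewrite /has_deriv_within; split.
  move=> /(@cvgrPdist_le _ _ _ (within J t^')) H e e0.
  have := H e e0; rewrite /within /dnbhs /= => /nbhs_ballP[dl dl0 Hd].
  exists dl => // s Js st sd; rewrite -E // ler_wpM2r //.
  by apply: Hd => //; rewrite -ball_normE /= distrC.
move=> H; apply/(@cvgrPdist_le _ _ _ (within J t^')) => e e0.
have [dl dl0 Hd] := H e e0; apply/nbhs_ballP; exists dl => // s.
rewrite -ball_normE /= distrC => sd st Js.
have st0 : 0 < `|s - t| by rewrite normr_gt0 subr_eq0.
by rewrite -(ler_pM2r st0) E //; exact: Hd.
Qed.

Lemma has_deriv_within_sub J J' u t w : J' `<=` J ->
  has_deriv_within J u t w -> has_deriv_within J' u t w.
Proof.
move=> JJ /has_deriv_withinP H; apply/has_deriv_withinP => e e0.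
have [dl dl0 Hd] := H e e0; exists dl => // s Js; exact: Hd (JJ _ Js).
Qed.

Lemma has_deriv_within_ext J u u' t w : J t -> (forall s, J s -> u s = u' s) ->
  has_deriv_within J u t w -> has_deriv_within J u' t w.
Proof.
move=> Jt E /has_deriv_withinP H; apply/has_deriv_withinP => e e0.
have [dl dl0 Hd] := H e e0; exists dl => // s Js; rewrite -!E //; exact: Hd.
Qed.

(** One-sided derivatives at the end points still give continuity on the closed interval. The
    intermediate time depends on the coordinate [i]. *)
Lemma within_mvt (a b : R) u w : a <= b ->
  (forall t, a <= t <= b -> has_deriv_within [set t | a <= t <= b] u t (w t)) ->
  forall s t i, a <= s -> s <= t -> t <= b ->
  exists2 c, s <= c <= t & u t i 0 - u s i 0 = (t - s) * w c i 0.
Proof.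
move=> ab H s t i as_ st tb.
pose f (x : R) : R := u x i 0.
have Hf x : a <= x <= b -> forall e, 0 < e -> exists2 dl, 0 < dl & forall z, a <= z <= b ->
    z != x -> `|z - x| < dl -> `|f z - f x - (z - x) * w x i 0| <= e * `|z - x|.
  move=> xab e e0; have /has_deriv_withinP /(_ e e0) [dl dl0 Hd] := H x xab.
  exists dl => // z zab zx zd; apply: le_trans (Hd z zab zx zd).
  by have := cV_entry_le (u z - u x - (z - x) *: w x) i; rewrite !mxE.
have df x : x \in `]s, t[ -> is_derive x 1 f (w x i 0).
  rewrite in_itv /= => /andP[sx xt].
  have xab : a <= x <= b by apply/andP; split; lra.
  suff L : h^-1 *: ((f \o shift x) (h *: (1 : R)) - f x) @[h --> 0^'] --> w x i 0.
    by apply: DeriveDef; [apply/cvg_ex; exists (w x i 0)|apply/cvg_lim].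
  apply/cvgrPdist_le => e e0; have [dl dl0 Hd] := Hf x xab e e0.
  near=> h.
  have h0 : h != 0 by near: h; exact: nbhs_dnbhs_neq.
  have hd : `|h| < dl by near: h; exact: dnbhs0_lt.
  have h1 : `|h| < x - s by near: h; apply: dnbhs0_lt; rewrite subr_gt0.
  have h2 : `|h| < t - x by near: h; apply: dnbhs0_lt; rewrite subr_gt0.
  have hn : 0 < `|h| by rewrite normr_gt0.
  rewrite -(ler_pM2r hn) /= [h%:A]mulr1 mulrC -normrM mulrBr mulVKf //.
  have := Hd (h + x); rewrite addrK => Hd'; rewrite distrC; apply: Hd' => //.
    by move: h1 h2; rewrite !ltr_norml => /andP[? ?] /andP[? ?]; apply/andP; split; lra.
  by rewrite -subr_eq0 addrK.
have cf : {within `[s, t], continuous f}.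
  apply/subspace_continuousP => x; rewrite /= in_itv /= => /andP[sx xt].
  have xab : a <= x <= b by apply/andP; split; lra.
  have [dl dl0 Hd] := Hf x xab 1 ltr01.
  apply/(@cvgrPdist_le _ _ _ (within _ (nbhs x))) => e e0.
  pose k := 1 + `|w x i 0|; have k0 : 0 < k by rewrite ltr_pwDl.
  apply/nbhs_ballP; exists (Num.min dl (e / k)) => [|z]; first by rewrite /= lt_min dl0 divr_gt0.
  rewrite -ball_normE /= distrC lt_min => /andP[zd ze]; rewrite in_itv /= => /andP[sz zt].
  have [->|zx] := eqVneq z x; first by rewrite subrr normr0 ltW.
  have zab : a <= z <= b by apply/andP; split; lra.
  have h1 := Hd z zab zx zd; rewrite mul1r in h1.
  rewrite distrC; apply: (@le_trans _ _ (`|z - x| * k)); last first.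
    by rewrite -ler_pdivlMr // ltW.
  have -> : f z - f x = (f z - f x - (z - x) * w x i 0) + (z - x) * w x i 0 by ring.
  by apply: le_trans (ler_normD _ _) _; rewrite normrM /k mulrDr mulr1 lerD2r.
have [c] := MVT_segment st df cf; rewrite in_itv /= => cst E.
by exists c => //; rewrite -/(f t) -/(f s) E mulrC.
Unshelve. all: by end_near. Qed.

End WithinDerivative.

Section Orbits.
Context {R : realType} {n d m : nat} {A : 'M[R]_n} (S : splitting A d m).
Local Notation Ls := (spLs S).
Local Notation lam := (splam S).
Local Notation ns := (sp_ns S).
Local Notation N := (bnorm S).

Variables (g : 'cV[R]_n -> 'cV[R]_n) (r eps cA : R).
Hypotheses (g0 : g 0 = 0) (r0 : 0 < r) (eps0 : 0 <= eps) (epslam : eps <= lam / 4)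
  (glip : forall x x', N x < r -> N x' < r -> N (g x - g x') <= eps * N (x - x'))
  (cA0 : 0 <= cA) (HcA : forall x, N (A *m x) <= cA * N x).
Local Notation F := (fun x : 'cV[R]_n => A *m x + g x).
Local Notation LF := (cA + eps).
Local Notation V := [set x : 'cV[R]_n | N x < r].

Let LF0 : 0 <= LF. Proof. exact: addr_ge0. Qed.

(** Bounded speed makes the field Lipschitz in time along an orbit, and mean values give the
    quadratic remainder. The constant is uniform in [T] and [u], since orbits are sampled on the
    growing windows [0, 2^p]. *)
Lemma orbit_curv : exists2 C : R, 0 <= C & forall T u, 0 <= T ->
  integral_curve V F [set t | 0 <= t <= T] u ->
  forall s t, 0 <= s -> s <= t -> t <= T ->
    N (u t - u s - (t - s) *: F (u s)) <= C * (t - s) ^+ 2.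
Proof.
have [c c1 [HN HNi _ _ _]] := bnorm_cst S; have c0 : 0 <= c := le_trans ler01 c1.
pose B := c * (LF * r); have B0 : 0 <= B by rewrite !mulr_ge0 // ltW.
exists (c * (c * (LF * (c * B)))); first by do 4![apply: mulr_ge0 => //].
move=> T u T0 Hu s t s0 st tT.
have HV x : 0 <= x <= T -> N (u x) < r by move=> xT; exact: (Hu x xT).1.
have subE (v v' : 'cV[R]_n) i : (v - v') i 0 = v i 0 - v' i 0 by rewrite !mxE.
have mvt := within_mvt T0 (fun x xT => proj2 (Hu x xT)).
have speed x : s <= x -> x <= T -> `|u x - u s| <= (x - s) * B.
  move=> sx xT; apply: cV_norm_le => [|i]; first by rewrite mulr_ge0 // subr_ge0.
  have [z /andP[z1 z2] Ez] := mvt s x i s0 sx xT.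
  rewrite subE Ez normrM ger0_norm ?subr_ge0 // ler_wpM2l ?subr_ge0 //.
  have zT : 0 <= z <= T by apply/andP; split; lra.
  apply: le_trans (cV_entry_le _ _) _; apply: le_trans (HNi _) _; rewrite ler_wpM2l //.
  apply: le_trans (box_field_le g0 r0 glip HcA (HV z zT)) _.
  by rewrite ler_wpM2l // ltW // HV.
have rhs0 : 0 <= c * (LF * (c * B)) by do 3![apply: mulr_ge0 => //].
apply: le_trans (HN _) _; rewrite -[leRHS]mulrA ler_wpM2l //.
apply: cV_norm_le => [|i]; first exact: mulr_ge0 rhs0 (sqr_ge0 _).
have [z /andP[z1 z2] Ez] := mvt s t i s0 st tT.
have -> : (u t - u s - (t - s) *: F (u s)) i 0 = (t - s) * (F (u z) - F (u s)) i 0.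
  by rewrite (subE (u t - u s)) (subE (u t)) (subE (F (u z))) Ez mulrBr; congr (_ - _); rewrite mxE.
rewrite normrM ger0_norm ?subr_ge0 //.
rewrite [leRHS](_ : _ = (t - s) * (c * (LF * (c * ((t - s) * B))))); last by ring.
rewrite ler_wpM2l ?subr_ge0 //.
have zT : 0 <= z <= T by apply/andP; split; lra.
have sT : 0 <= s <= T by apply/andP; split; lra.
apply: le_trans (cV_entry_le _ _) _; apply: le_trans (HNi _) _; rewrite ler_wpM2l //.
apply: le_trans (box_field_lip glip HcA (HV z zT) (HV s sT)) _; rewrite ler_wpM2l //.
apply: le_trans (HN _) _; rewrite ler_wpM2l //; apply: le_trans (speed z z1 _) _; first by lra.
by rewrite ler_wpM2r //; lra.
Qed.

Lemma sample_approx (C T dl : R) u K : 0 <= C -> 0 <= T -> 0 <= dl -> K%:R * dl <= T ->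
  (forall t, 0 <= t <= T -> N (u t) < r) ->
  (forall s t, 0 <= s -> s <= t -> t <= T ->
    N (u t - u s - (t - s) *: F (u s)) <= C * (t - s) ^+ 2) ->
  approx S g r C dl K (fun k => u (k%:R * dl)).
Proof.
move=> C0 T0 dl0 KT HV H.
have rng k : (k <= K)%N -> 0 <= k%:R * dl <= T.
  move=> kK; rewrite mulr_ge0 //=; apply: le_trans KT.
  by rewrite ler_wpM2r // ler_nat.
split=> k kK; first exact: HV (rng k kK).
have E : k.+1%:R * dl - k%:R * dl = dl by rewrite -natr1; ring.
have /andP[k1 k2] := rng k (ltnW kK); have /andP[k3 k4] := rng k.+1 kK.
have := H (k%:R * dl) (k.+1%:R * dl) k1 _ k4; rewrite E; apply.
by rewrite ler_wpM2r // ler_nat.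
Qed.

(** Sampled at mesh T 2^-p, both orbits are approximate solutions with the same start, and
    [approx_unique] bounds their distance at time T by a constant times 2^-p. *)
Lemma orbit_unique T u u' : 0 <= T ->
  integral_curve V F [set t | 0 <= t <= T] u ->
  integral_curve V F [set t | 0 <= t <= T] u' -> u 0 = u' 0 -> u T = u' T.
Proof.
move=> T0 Hu Hu' E; have [C C0 HC] := orbit_curv.
apply/eqP; rewrite -subr_eq0; apply/eqP/(bnorm_eq0 (S := S)).
apply: (@le_dyad _ _ _ (2 * C * T ^+ 2 * expR (LF * T)) 0) => p _; rewrite add0r.
have dl0 : 0 <= T * dyad p by rewrite mulr_ge0 // ltW // dyad_gt0.
have TT : (2 ^ p)%:R * (T * dyad p) = T by rewrite natrX mulrCA dyadV mulr1.
have [->|Tn] := eqVneq T 0.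
  by rewrite E subrr bnorm0 expr0n mulr0 !mul0r.
have dl1 : 0 < T * dyad p by rewrite mulr_gt0 ?dyad_gt0 // lt_neqAle eq_sym Tn.
have HV v : integral_curve V F [set t | 0 <= t <= T] v -> forall t, 0 <= t <= T -> N (v t) < r.
  by move=> Hv t tT; exact: (Hv t tT).1.
have K_le : (2 ^ p)%:R * (T * dyad p) <= T by rewrite TT.
have S1 := sample_approx C0 T0 dl0 K_le (HV _ Hu) (HC T u T0 Hu).
have S2 := sample_approx C0 T0 dl0 K_le (HV _ Hu') (HC T u' T0 Hu').
have E0 : u (0%:R * (T * dyad p)) = u' (0%:R * (T * dyad p)) by rewrite mul0r.
have := approx_unique eps0 glip cA0 HcA C0 dl1 S1 S2 E0; rewrite TT.
move=> /le_trans; apply.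
have ex : (1 + T * dyad p * LF) ^+ (2 ^ p) <= expR (LF * T).
  have h : 1 + T * dyad p * LF <= expR (T * dyad p * LF) by exact: expR_ge1Dx.
  have h0 : 0 <= 1 + T * dyad p * LF by rewrite addr_ge0 // mulr_ge0.
  apply: le_trans (lerXn2r (2 ^ p) _ _ h) _; rewrite ?nnegrE ?expR_ge0 //.
  rewrite -expRM_natl (_ : _ * _ = LF * T) //.
  by rewrite -[in RHS]TT natrX; ring.
have pre : 2 * C * (T * dyad p) ^+ 2 * (2 ^ p)%:R = 2 * C * T ^+ 2 * dyad p.
  rewrite exprMn [dyad p ^+ 2]expr2 natrX.
  transitivity (2 * C * T ^+ 2 * dyad p * (2 ^+ p * dyad p)); first by ring.
  by rewrite dyadV mulr1.
have pre0 : 0 <= 2 * C * T ^+ 2 * dyad p.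
  rewrite mulr_ge0 ?(ltW (dyad_gt0 _)) //.
  by apply: mulr_ge0; [exact: mulr_ge0|exact: sqr_ge0].
by rewrite pre [leRHS]mulrAC; apply: ler_wpM2l.
Qed.

Lemma flows_toE t x z : 0 <= t -> flows_to V F t x z <->
  exists u, [/\ u 0 = x, integral_curve V F [set s | 0 <= s <= t] u & u t = z].
Proof.
by move=> t0; rewrite /flows_to (min_idPl t0) (max_idPr t0).
Qed.

Lemma flow_eq t x z : 0 <= t -> flows_to V F t x z -> flow V F t x = z.
Proof.
move=> t0 Hz; rewrite /flow; have := xgetI 0 Hz.
move=> /(flows_toE _ _ t0) [u [u0 Hu <-]].
move: Hz => /(flows_toE _ _ t0) [u' [u'0 Hu' <-]].
by apply: orbit_unique => //; rewrite u0 u'0.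
Qed.

Variables (y : 'cV[R]_d) (u : R -> 'cV[R]_n).
Hypotheses (yr : ns y < r) (Hu : is_limit S g r eps cA y u).
Local Notation J := [set t : R | 0 <= t].

(** For t < s the two times are exchanged in [limit_curv], and [F (u t)] is replaced by [F (u s)] at
    the cost of the Lipschitz constant. *)
Lemma limit_taylor : exists2 C, 0 <= C & forall s t, 0 <= s -> 0 <= t -> `|t - s| <= 1 ->
  N (u t - u s - (t - s) *: F (u s)) <= C * `|t - s| ^+ 2.
Proof.
pose C2 := approx_curv r eps cA (picard_cst r eps cA).
have C20 : 0 <= C2.
  by apply: le_trans (picard_cst_ge0 r0 eps0 cA0) _; apply: approx_curv_ge => //; exact: picard_cst_ge0.
have curv := limit_curv g0 r0 eps0 epslam glip cA0 HcA yr Hu.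
have uV := limit_lt g0 r0 eps0 epslam glip yr Hu.
have r1 : 0 <= LF * r by rewrite mulr_ge0 // ltW.
exists (C2 + LF * (LF * r + C2)).
  by apply: addr_ge0 => //; apply: mulr_ge0 => //; exact: addr_ge0.
move=> s t s0 t0; have [st|ts] := leP s t.
  rewrite ger0_norm ?subr_ge0 // => ts1; apply: le_trans (curv s t s0 st) _.
  by rewrite ler_wpM2r ?sqr_ge0 // lerDl; apply: mulr_ge0 => //; exact: addr_ge0.
rewrite ltr0_norm ?subr_lt0 // opprB => ts1.
have h := curv t s t0 (ltW ts).
have st0 : 0 <= s - t by rewrite subr_ge0 ltW.
have sp : N (u s - u t) <= (s - t) * (LF * r + C2).
  rewrite -[u s - u t](subrK ((s - t) *: F (u t))).
  apply: le_trans (bnormD _ _ _) _; rewrite mulrDr addrC; apply: lerD.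
    rewrite bnormZ ger0_norm // ler_wpM2l //.
    apply: le_trans (box_field_le g0 r0 glip HcA (uV t t0)) _.
    by rewrite ler_wpM2l // ltW // uV.
  apply: le_trans h _; rewrite mulrC ler_wpM2r // expr2 ler_piMr //.
have -> : u t - u s - (t - s) *: F (u s) =
    (s - t) *: (F (u s) - F (u t)) - (u s - u t - (s - t) *: F (u t)).
  move: (F (u s)) (F (u t)) => v v'; apply/matrixP => i j; rewrite !mxE; ring.
apply: le_trans (bnormB _ _ _) _; rewrite mulrDl addrC; apply: lerD => //.
rewrite bnormZ ger0_norm // expr2 mulrA [X in _ <= X]mulrC ler_wpM2l //.
apply: le_trans (box_field_lip glip HcA (uV s s0) (uV t t0)) _.
by rewrite -mulrA ler_wpM2l // mulrC.
Qed.

Lemma limit_has_deriv K t : K `<=` J -> 0 <= t -> has_deriv_within K u t (F (u t)).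
Proof.
move=> KJ t0; have [c c1 [_ HNi _ _ _]] := bnorm_cst S; have c0 : 0 <= c := le_trans ler01 c1.
have [C C0 H] := limit_taylor; apply/has_deriv_withinP => e e0.
have k0 : 0 < c * C + 1 by rewrite ltr_wpDl // mulr_ge0.
exists (Num.min 1 (e / (c * C + 1))) => [|s /KJ s0 _]; first by rewrite lt_min ltr01 divr_gt0.
rewrite lt_min => /andP[s1 se]; apply: le_trans (HNi _) _.
apply: le_trans (ler_wpM2l c0 (H t s t0 s0 (ltW s1))) _.
rewrite expr2 mulrA mulrA ler_wpM2r //.
move: se; rewrite ltr_pdivlMr // => /ltW; apply: le_trans.
by rewrite mulrC ler_wpM2l // lerDl.
Qed.

Lemma limit_flow t : 0 <= t -> flows_to V F t (u 0) (u t).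
Proof.
move=> t0; apply/flows_toE => //; exists u; split=> // s /= /andP[s0 _]; split.
  exact: (limit_lt g0 r0 eps0 epslam glip yr Hu).
by apply: limit_has_deriv => // z /= /andP[].
Qed.

Lemma limit_C1b : C1b J (fun t => flow V F t (u 0)).
Proof.
have E t : 0 <= t -> u t = flow V F t (u 0).
  by move=> t0; rewrite (flow_eq t0 (limit_flow t0)).
have [c c1 [HN HNi _ _ _]] := bnorm_cst S; have c0 : 0 <= c := le_trans ler01 c1.
have uV := limit_lt g0 r0 eps0 epslam glip yr Hu.
exists (fun t => F (u t)); split.
- move=> t t0; apply: (has_deriv_within_ext t0 E); exact: limit_has_deriv.
- apply/subspace_continuousP => t /= t0.
  have [C C0 H] := limit_taylor.
  apply/(@cvgrPdist_le _ _ _ (within _ (nbhs t))) => e e0.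
  pose k := c * (LF * (LF * r + C)) + 1.
  have k00 : 0 <= c * (LF * (LF * r + C)).
    by apply: mulr_ge0 => //; apply: mulr_ge0 => //; apply: addr_ge0 => //; apply: mulr_ge0 => //; exact: ltW.
  have k0 : 0 < k by rewrite ltr_wpDl.
  apply/nbhs_ballP; exists (Num.min 1 (e / k)) => [|s]; first by rewrite /= lt_min ltr01 divr_gt0.
  rewrite -ball_normE /= distrC lt_min => /andP[s1 se] s0.
  rewrite distrC; apply: le_trans (HNi _) _.
  apply: le_trans (ler_wpM2l c0 (box_field_lip glip HcA (uV s s0) (uV t t0))) _.
  have sp : N (u s - u t) <= `|s - t| * (LF * r + C).
    rewrite -[u s - u t](subrK ((s - t) *: F (u t))).
    apply: le_trans (bnormD _ _ _) _; rewrite mulrDr addrC; apply: lerD.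
      rewrite bnormZ ler_wpM2l //.
      apply: le_trans (box_field_le g0 r0 glip HcA (uV t t0)) _.
      by rewrite ler_wpM2l // ltW // uV.
    apply: le_trans (H t s t0 s0 (ltW s1)) _.
    by rewrite mulrC ler_wpM2r // expr2 ler_piMr // ltW.
  apply: le_trans (ler_wpM2l c0 (ler_wpM2l LF0 sp)) _.
  move: se; rewrite ltr_pdivlMr // => /ltW; apply: le_trans.
  rewrite (_ : c * (LF * (_ * _)) = `|s - t| * (c * (LF * (LF * r + C)))); last by ring.
  by rewrite ler_wpM2l // lerDl.
- exists (c * r); split; first exact: num_real.
  move=> M BM t /= t0; apply: le_trans (ltW BM).
  have h : `|u t| <= c * r.
    by apply: le_trans (HNi _) _; rewrite ler_wpM2l // ltW // uV.
  by rewrite -(E t t0).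
- exists (c * (LF * r)); split; first exact: num_real.
  move=> M BM t /= t0; apply: le_trans (ltW BM).
  have h : `|F (u t)| <= c * (LF * r).
    apply: le_trans (HNi _) _; rewrite ler_wpM2l //.
    apply: le_trans (box_field_le g0 r0 glip HcA (uV t t0)) _.
    by rewrite ler_wpM2l // ltW // uV.
  exact: h.
Qed.

(** The orbit stays in the box by definition of [W_loc], so for every p its samples on [0, 2^p] are
    approximate solutions, with a constant free of p. *)
Lemma W_loc_limit x : W_loc V F J x -> Ls *m x = y -> x = u 0.
Proof.
move=> [_ Hf _] Lx; have [C C0 HC] := orbit_curv.
have H p : (0 <= p)%N -> exists2 v, v 0%N = x & approx S g r C (dyad p) (4 ^ p) v.
  move=> _; have T0 : 0 <= 2 ^+ p :> R by rewrite exprn_ge0.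
  have [z /(flows_toE _ _ T0) [v [v0 Hv _]]] := Hf _ T0.
  exists (fun k => v (k%:R * dyad p)); first by rewrite mul0r.
  apply: (sample_approx C0 T0).
  - by rewrite ltW // dyad_gt0.
  - rewrite natrX (_ : 4 ^+ p = 2 ^+ p * 2 ^+ p) -?mulrA ?dyadV ?mulr1 //.
    by rewrite -exprMn; congr (_ ^+ p); ring.
  - by move=> t tT; exact: (Hv t tT).1.
  - exact: HC.
have L := limit_unique g0 r0 eps0 epslam glip cA0 HcA yr Hu.
exact: (L C x 0%N C0 Lx H).
Qed.

Lemma limit_W_loc : W_loc V F J (u 0).
Proof.
split; first exact: (limit_lt g0 r0 eps0 epslam glip yr Hu).
  by move=> t t0; exists (u t); exact: limit_flow.
exact: limit_C1b.
Qed.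

End Orbits.

(** * Spectral splitting of a hyperbolic matrix *)

Section AdaptedNormExists.
Context {R : realType}.
Import ComplexField.Normc.

Lemma normc_real (x : R) : normc (x%:C)%C = `|x|.
Proof. by rewrite /normc /= expr0n addr0 sqrtr_sqr. Qed.

Lemma normc_ge0 (z : complex R) : 0 <= normc z.
Proof. by case: z => a b; rewrite sqrtr_ge0. Qed.

Lemma normc_sum I (s : seq I) (f : I -> complex R) :
  normc (\sum_(i <- s) f i) <= \sum_(i <- s) normc (f i).
Proof.
elim: s => [|i s IH]; first by rewrite !big_nil normc0.
by rewrite !big_cons; apply: le_trans (le_normcD _ _) _; rewrite lerD2l.
Qed.

(** The square of the modulus is 1 + 2 dl Re l + dl^2 |l|^2 <= 1 - 8 mu dl + 4 mu dl, which is at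
    most (1 - 2 mu dl)^2. *)
Lemma normc_euler (l : complex R) (mu dl : R) : 0 <= dl -> complex.Re l <= - (4 * mu) ->
  2 * mu * dl <= 1 -> dl * normc l ^+ 2 <= 4 * mu ->
  normc (1 + (dl%:C)%C * l) <= 1 - 2 * mu * dl.
Proof.
case: l => a b /= dl0 Ha Hd.
rewrite sqr_sqrtr ?addr_ge0 ?sqr_ge0 // => H.
have p : 0 <= 1 - 2 * mu * dl by lra.
rewrite -[leRHS](ger0_norm p) -sqrtr_sqr ler_wsqrtr //.
rewrite !(mul0r, subr0, addr0, add0r).
have h1 := ler_wpM2l dl0 H; have h2 := ler_wpM2l dl0 Ha.
have h3 : 0 <= (mu * dl) ^+ 2 by rewrite sqr_ge0.
nra.
Qed.

Lemma adapted_norm_weaken d (B : 'M[R]_d) lam lam' : lam' <= lam ->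
  adapted_norm B lam -> adapted_norm B lam'.
Proof.
move=> ll [N c st H1 H2 H3 H4 H5 H6].
have N0 y : 0 <= N y.
  have NN : N (- y) = N y by rewrite -scaleN1r H2 normrN normr1 mul1r.
  have Z : N 0 = 0 by rewrite -(scale0r (0 : 'cV[R]_d)) H2 normr0 mul0r.
  by have := H1 y (- y); rewrite subrr Z NN; lra.
apply: (@AdaptedNorm _ _ _ _ N c st) => // dl y dl0 ds.
apply: le_trans (H6 dl y dl0 ds) _; rewrite ler_wpM2r // lerD2l lerN2.
by rewrite ler_wpM2l.
Qed.

(* Triangularize B over the complex numbers and weight the coordinates by powers
   of a small kap, so that the off-diagonal terms become negligible. *)
Lemma adapted_norm_exists d (B : 'M[R]_d) :
  (forall l : complex R, eigenvalue (complexify B) l -> complex.Re l < 0) ->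
  exists2 lam : R, 0 < lam & inhabited (adapted_norm B lam).
Proof.
move=> Hl; have [d0|dpos] := posnP d.
  subst d; exists 1 => //; constructor.
  have y0 (y : 'cV[R]_0) : `|y| = 0.
    by rewrite (_ : y = 0) ?normr0 //; apply/matrixP => -[].
  by apply: (@AdaptedNorm _ _ _ _ (fun=> 0) 1 1) => *; rewrite ?addr0 ?mulr0 ?y0 ?mulr0.
have [U Uu tr] := Schur (complexify B) dpos.
have Uun : U \in unitmx by exact: unitarymx_unit.
set T := conjmx U (complexify B) in tr.
have TE : T = U *m complexify B *m invmx U by rewrite /T conjumx.
have TU : T *m U = U *m complexify B by rewrite TE mulmxKV.
have Tlt (i j : 'I_d) : (i < j)%N -> T i j = 0 by move/is_trig_mxP: tr; exact.
have Tii i : complex.Re (T i i) < 0.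
  apply: Hl; have : eigenvalue T (T i i).
    rewrite eigenvalue_root_char char_poly_trig // /root horner_prod.
    by rewrite (bigD1 i) //= !hornerE subrr mul0r.
  move=> /eigenvalueP[v vT v0]; apply/eigenvalueP; exists (v *m U).
    by rewrite -mulmxA -TU mulmxA vT scalemxAl.
  apply: contra v0 => /eqP vU; apply/eqP.
  by rewrite -[v](mulmxK Uun) vU mul0mx.
pose m0 : R := \big[Num.min/1]_(i < d) (- complex.Re (T i i)).
have m0p : 0 < m0.
  by apply/bigmin_gtP; split=> // i _; rewrite oppr_gt0.
(* A quarter of the gap: the diagonal contracts at rate 2 mu, and the off-diagonal terms take back
   at most mu. *)
pose mu : R := m0 / 4.
have mup : 0 < mu by rewrite divr_gt0.
have Tmu i : complex.Re (T i i) <= - (4 * mu).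
  have : m0 <= - complex.Re (T i i) by exact: bigmin_le_cond.
  by rewrite /mu mulrC divfK // lerNr.
pose K := \sum_(i < d) \sum_(j < d) normc (T i j).
have K0 : 0 <= K by rewrite sumr_ge0 // => i _; rewrite sumr_ge0 // => j _; exact: normc_ge0.
have Krow i : \sum_(j < d) normc (T i j) <= K.
  rewrite /K [leRHS](bigD1 i) //= lerDl sumr_ge0 // => i' _.
  by rewrite sumr_ge0 // => j _; exact: normc_ge0.
have Kent i j : normc (T i j) <= K.
  apply: le_trans (Krow i); rewrite (bigD1 j) //= lerDl sumr_ge0 // => j' _.
  exact: normc_ge0.
(* Chosen for kap K <= mu; adding mu to the denominator keeps it positive and [kap] at most 1. *)
pose kap : R := mu / (mu + K).
have muK : 0 < mu + K by rewrite ltr_wpDr.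
have kap0 : 0 < kap by rewrite divr_gt0.
have kap1 : kap <= 1 by rewrite ler_pdivrMr // mul1r lerDl.
have kapK : kap * K <= mu.
  by rewrite /kap mulrAC ler_pdivrMr // ler_wpM2l ?(ltW mup) // lerDr ltW.
clearbody kap mu.
pose w (y : 'cV[R]_d) (i : 'I_d) : complex R := (U *m complexify y) i 0.
pose N (y : 'cV[R]_d) := \big[Num.max/0]_(i < d) (kap ^+ i * normc (w y i)).
have N0 y : 0 <= N y by exact: bigmax_ge_id.
have Nle y (i : 'I_d) : kap ^+ i * normc (w y i) <= N y by exact: (le_bigmax _ (fun i : 'I_d => kap ^+ i * normc (w y i))).
have kapX (i : nat) : 0 <= kap ^+ i by rewrite exprn_ge0 // ltW.
have kapX1 (i : nat) : kap ^+ i <= 1 by rewrite exprn_ile1 // ltW.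
have cD : {morph (@complexify R d 1) : y z / y + z} by move=> y z; rewrite /complexify map_mxD.
have cZ (c : R) y : @complexify R d 1 (c *: y) = (c%:C)%C *: complexify y.
  by rewrite /complexify map_mxZ.
have wD y z i : w (y + z) i = w y i + w z i by rewrite /w cD mulmxDr mxE.
have wZ (c : R) y i : w (c *: y) i = (c%:C)%C * w y i by rewrite /w cZ -scalemxAr mxE.
have wB y i : w (B *m y) i = \sum_j T i j * w y j.
  rewrite /w; have -> : complexify (B *m y) = complexify B *m complexify y.
    by rewrite /complexify map_mxM.
  by rewrite mulmxA -TU -mulmxA mxE.
pose CU := \sum_(i < d) \sum_(j < d) normc (U i j).
pose CV := \sum_(i < d) \sum_(j < d) normc (invmx U i j) * (kap ^+ j)^-1.
have CU0 : 0 <= CU by rewrite sumr_ge0 // => i _; rewrite sumr_ge0 // => j _; exact: normc_ge0.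
have CV0 : 0 <= CV.
  by rewrite sumr_ge0 // => i _; rewrite sumr_ge0 // => j _; rewrite mulr_ge0 ?normc_ge0 ?invr_ge0.
(* The two step conditions of [normc_euler], for all diagonal entries at once. *)
pose st := Num.min (2 * mu + 1)^-1 (4 * mu / (K ^+ 2 + 1)).
exists mu => //; constructor.
apply: (@AdaptedNorm _ _ _ _ N (CU + CV) st).
- move=> y z; apply: bigmax_le => [|i _]; first by rewrite addr_ge0.
  rewrite wD; apply: (@le_trans _ _ (kap ^+ i * normc (w y i) + kap ^+ i * normc (w z i))).
    by rewrite -mulrDr ler_wpM2l // le_normcD.
  by rewrite lerD.
- have le c y : N (c *: y) <= `|c| * N y.
    apply: bigmax_le => [|i _]; first by rewrite mulr_ge0.
    by rewrite wZ normcM normc_real mulrCA ler_wpM2l.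
  move=> c y; apply/eqP; rewrite eq_le le /=.
  have [->|c0] := eqVneq c 0; first by rewrite normr0 mul0r.
  rewrite -ler_pdivlMl ?normr_gt0 // -normfV.
  by apply: le_trans (le _ _); rewrite scalerA mulVf // scale1r.
- move=> y; apply: bigmax_le => [|i _]; first by rewrite mulr_ge0 // addr_ge0.
  apply: (@le_trans _ _ (normc (w y i))); first by rewrite ler_piMl ?normc_ge0.
  apply: (@le_trans _ _ (CU * `|y|)); last by rewrite ler_wpM2r // lerDl.
  rewrite /w mxE; apply: le_trans (normc_sum _ _) _.
  rewrite /CU mulr_suml [leRHS](bigD1 i) //= -[leLHS]addr0; apply: lerD; last first.
    by rewrite sumr_ge0 // => i' _; rewrite mulr_ge0 // sumr_ge0 // => j _; exact: normc_ge0.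
  rewrite mulr_suml; apply: ler_sum => j _.
  by rewrite normcM mxE normc_real ler_wpM2l ?normc_ge0 // cV_entry_le.
- move=> y; apply: cV_norm_le => [|i]; first by rewrite mulr_ge0 // addr_ge0.
  apply: (@le_trans _ _ (CV * N y)); last by rewrite ler_wpM2r // lerDr.
  have -> : `|y i 0| = normc ((invmx U *m (U *m complexify y)) i 0).
    by rewrite mulKmx // mxE normc_real.
  rewrite mxE; apply: le_trans (normc_sum _ _) _.
  rewrite /CV mulr_suml [leRHS](bigD1 i) //= -[leLHS]addr0; apply: lerD; last first.
    rewrite sumr_ge0 // => i' _; rewrite mulr_ge0 // sumr_ge0 // => j _.
    by rewrite mulr_ge0 ?normc_ge0 ?invr_ge0.
  rewrite mulr_suml; apply: ler_sum => j _.
  rewrite normcM -mulrA ler_wpM2l ?normc_ge0 // -/(w y j).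
  by rewrite ler_pdivlMl ?exprn_gt0.
- by rewrite lt_min invr_gt0 divr_gt0 ?mulr_gt0 ?ltr_wpDl ?sqr_ge0 //; lra.
move=> dl y dl0; rewrite le_min => /andP[ds1 ds2].
have q1 : 2 * mu * dl <= 1.
  have p : 0 < 2 * mu + 1 by lra.
  have := ler_wpM2l (ltW p) ds1; rewrite divff ?lt0r_neq0 //; lra.
have q2 i : dl * normc (T i i) ^+ 2 <= 4 * mu.
  have p : 0 < K ^+ 2 + 1 by rewrite ltr_wpDl // sqr_ge0.
  have h : dl * (K ^+ 2 + 1) <= 4 * mu by rewrite -ler_pdivlMr.
  apply: le_trans h; rewrite ler_wpM2l //; apply: (@le_trans _ _ (K ^+ 2)); last by rewrite lerDl.
  by rewrite lerXn2r ?nnegrE ?normc_ge0.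
have q3 : 0 <= 1 - dl * mu by have := mulr_ge0 dl0 (ltW mup); lra.
apply: bigmax_le => [|i _]; first by rewrite mulr_ge0.
have -> : w (y + dl *: (B *m y)) i = (1 + (dl%:C)%C * T i i) * w y i +
    (dl%:C)%C * \sum_(j < d | j != i) T i j * w y j.
  by rewrite wD wZ wB (bigD1 i) //=; ring.
apply: (@le_trans _ _ (kap ^+ i * (normc (1 + (dl%:C)%C * T i i) * normc (w y i)) +
    kap ^+ i * (dl * \sum_(j < d | j != i) normc (T i j) * normc (w y j)))).
  rewrite -mulrDr ler_wpM2l //; apply: le_trans (le_normcD _ _) _.
  rewrite !normcM lerD2l normc_real ger0_norm // ler_wpM2l //.
  rewrite -big_filter; apply: le_trans (normc_sum _ _) _; rewrite big_filter.
  by apply: ler_sum => j _; rewrite normcM.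
have t1 : kap ^+ i * (normc (1 + (dl%:C)%C * T i i) * normc (w y i)) <= (1 - 2 * mu * dl) * N y.
  rewrite mulrCA; apply: ler_pM => //; [exact: normc_ge0|by rewrite mulr_ge0 ?normc_ge0|].
  exact: normc_euler.
have t2 : kap ^+ i * (dl * \sum_(j < d | j != i) normc (T i j) * normc (w y j)) <= dl * mu * N y.
  rewrite mulrCA -mulrA ler_wpM2l // mulr_sumr.
  apply: (@le_trans _ _ (\sum_(j < d) normc (T i j) * (kap * N y))); last first.
    rewrite -mulr_suml mulrA ler_wpM2r //; apply: le_trans kapK.
    by rewrite mulrC ler_wpM2l // ltW.
  rewrite [leRHS](bigID (fun j => j != i)) /= -[leLHS]addr0; apply: lerD; last first.
    by rewrite sumr_ge0 // => j _; rewrite mulr_ge0 ?normc_ge0 // mulr_ge0 // ltW.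
  apply: ler_sum => j ji; have [ij|] := ltnP i j.
    by rewrite Tlt // normc0 mul0r mulr0 mul0r.
  rewrite leq_eqVlt => /orP[/eqP E|ji'].
    by case/eqP: ji; apply: val_inj.
  rewrite mulrCA ler_wpM2l ?normc_ge0 //.
  (* [T] is lower triangular, so only j < i matters and the weight of i carries at least one factor
     [kap] more than that of j. *)
  have -> : kap ^+ i = kap * kap ^+ (i - j).-1 * kap ^+ j.
    by rewrite -exprS -exprD prednK ?subn_gt0 // subnK // ltnW.
  rewrite -!mulrA ler_wpM2l ?(ltW kap0) //.
  by rewrite -[leRHS]mul1r; apply: ler_pM => //; apply: mulr_ge0 => //; exact: normc_ge0.
apply: le_trans (lerD t1 t2) _; have := N0 y; move: (N y) => v v0; nra.
Qed.

End AdaptedNormExists.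

Section Spectral.
Context {R : realType}.
Implicit Types (l : complex R).

Lemma char_poly_trmx (F : comNzRingType) n (A : 'M[F]_n) : char_poly A^T = char_poly A.
Proof.
rewrite /char_poly -[RHS]det_tr; congr (\det _); apply/matrixP => i j.
by rewrite !mxE eq_sym.
Qed.

Lemma eigenvalue_trmx (F : fieldType) n (A : 'M[F]_n) : eigenvalue A^T =1 eigenvalue A.
Proof. by move=> a; rewrite !eigenvalue_root_char char_poly_trmx. Qed.

Lemma complexify_trmx m n (A : 'M[R]_(m, n)) : complexify A^T = (complexify A)^T.
Proof. by apply/matrixP => i j; rewrite !mxE. Qed.

Lemma complexifyM m n p (A : 'M[R]_(m, n)) (B : 'M[R]_(n, p)) :
  complexify (A *m B) = complexify A *m complexify B.
Proof. exact: map_mxM. Qed.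

Lemma complexify_inj m n : injective (@complexify R m n).
Proof.
by move=> A B /matrixP AB; apply/matrixP => i j; have := AB i j; rewrite !mxE => -[].
Qed.

Lemma complexify0 m n : complexify (0 : 'M[R]_(m, n)) = 0.
Proof. exact: map_mx0. Qed.

Lemma complexifyD m n (A B : 'M[R]_(m, n)) : complexify (A + B) = complexify A + complexify B.
Proof. exact: map_mxD. Qed.

Lemma complexify1 n : complexify (1%:M : 'M[R]_n) = 1%:M.
Proof. exact: map_mx1. Qed.

Lemma coprimep_horner_mx0 (F : fieldType) n m (g : 'M[F]_n.+1) (W : 'M[F]_(m, n.+1)) (p q : {poly F}) :
  coprimep p q -> W *m horner_mx g p = 0 -> W *m horner_mx g q = 0 -> W = 0.
Proof.
move=> /Bezout_eq1_coprimepP[[u v]] /= uv Wp Wq.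
have h : horner_mx g (u * p + v * q) = 1%:M by rewrite uv rmorph1.
rewrite -[W]mulmx1 -h rmorphD /= mulmxDr.
by rewrite ![_ * p]mulrC ![_ * q]mulrC !rmorphM /= -!mulmxE !mulmxA Wp Wq !mul0mx addr0.
Qed.

(** (X - l)(X - conj l), with real coefficients. A real [l] gives a double root, which is harmless
    because only divisibility by the characteristic polynomial is used. *)
Definition quad l : {poly R} := 'X^2 - (2 * complex.Re l) *: 'X +
  (complex.Re l ^+ 2 + complex.Im l ^+ 2)%:P.

Lemma map_quad l : map_poly (real_complex R) (quad l) =
  ('X - l%:P) * ('X - (Complex (complex.Re l) (- complex.Im l))%:P).
Proof.
case: l => a b /=; rewrite /quad rmorphD rmorphB /= map_polyXn linearZ /= map_polyX map_polyC /=.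
set x := Complex a b; set y := Complex a (- b).
have -> : ((2 * a)%:C)%C = x + y by apply/eqP; rewrite eq_complex /=; apply/andP; split; apply/eqP; ring.
have -> : ((a ^+ 2 + b ^+ 2)%:C)%C = x * y by apply/eqP; rewrite eq_complex /=; apply/andP; split; apply/eqP; ring.
by rewrite -mul_polyC polyCD polyCM; ring.
Qed.

Lemma root_quad l z : root (map_poly (real_complex R) (quad l)) z ->
  complex.Re z = complex.Re l.
Proof.
by rewrite map_quad rootM !root_XsubC => /orP[] /eqP ->.
Qed.

(* The product of the real polynomials quad l over the eigenvalues l lying on one
   side of the imaginary axis has all its roots on that side, so the two products
   are coprime, and the characteristic polynomial divides their product. *)
Lemma spectral_split n (B : 'M[R]_n) :
  (forall l, eigenvalue (complexify B) l -> complex.Re l != 0) ->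
  exists E F : 'M[R]_n, [/\ E + F = 1%:M, E *m F = 0, F *m E = 0, E *m B = B *m E
    & forall l, (complex.Re l < 0 -> geigenspace (complexify B) l *m complexify F = 0) /\
                (0 < complex.Re l -> geigenspace (complexify B) l *m complexify E = 0)].
Proof.
case: n B => [|n] B hyp.
  exists 0, 0; split; [by apply/matrixP => -[]..|].
  by move=> l; split=> _; apply/matrixP => -[].
have [rs Hrs] := closed_field_poly_normal (char_poly (complexify B)).
rewrite (monicP (char_poly_monic _)) scale1r in Hrs.
have rsE l : l \in rs -> complex.Re l != 0.
  by move=> lr; apply: hyp; rewrite eigenvalue_root_char Hrs root_prod_XsubC.
pose pm (b : pred R) : {poly R} := \prod_(l <- rs | b (complex.Re l)) quad l.
have root_pm b z : root (map_poly (real_complex R) (pm b)) z -> b (complex.Re z).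
  rewrite /pm; elim/big_rec: _ => [|l p bl IH]; first by rewrite rmorph1 (negbTE (root1 _)).
  by rewrite rmorphM /= rootM => /orP[/root_quad ->|/IH].
pose ps := pm (fun r => r < 0); pose pu := pm (fun r => 0 < r).
have cop : coprimep ps pu.
  rewrite -(coprimep_map (real_complex R)); apply: Pdiv.ClosedField.root_coprimep => z /root_pm z0.
  by apply/negP => /root_pm; rewrite ltNge (ltW z0).
have chpp : char_poly B %| ps * pu.
  rewrite -(dvdp_map (real_complex R)) map_char_poly -/(complexify B) Hrs rmorphM /= /ps /pu /pm.
  rewrite !rmorph_prod /= (bigID (fun l => complex.Re l < 0)) /=; apply: dvdp_mul.
    apply: (big_rec2 (fun x y => x %| y)) => // l x y _ xy.
    by rewrite map_quad -mulrA dvdp_mul // dvdp_mull.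
  rewrite big_seq_cond [X in _ %| X]big_seq_cond.
  rewrite (eq_bigl (fun l => (l \in rs) && (0 < complex.Re l))); last first.
    by move=> l; case lr: (l \in rs) => //=; rewrite -leNgt lt0r rsE.
  apply: (big_rec2 (fun x y => x %| y)) => // l x y _ xy.
  by rewrite map_quad -mulrA dvdp_mul // dvdp_mull.
have [[u v] /= uv] := Bezout_eq1_coprimepP _ _ cop.
pose hB := horner_mx B.
have hC p : complexify (hB p) = horner_mx (complexify B) (map_poly (real_complex R) p).
  exact: map_horner_mx.
have hM p q : hB p *m hB q = hB (p * q) by rewrite /hB rmorphM.
have pp0 p : hB (p * (ps * pu)) = 0.
  have [q ->] := dvdpP _ _ chpp.
  by rewrite mulrA /hB rmorphM /= Cayley_Hamilton mulr0.
(* The product is annihilated by (X - l)^(n+1), by definition of the generalized eigenspace, and by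
   [p], by Cayley-Hamilton; these are coprime, so it vanishes. *)
have key p l w : coprimep (map_poly (real_complex R) p) ('X - l%:P) ->
    (exists k, w * p = k * (ps * pu)) ->
    geigenspace (complexify B) l *m complexify (hB w) = 0.
  move=> cpl [k wp]; have cpl' := coprimep_expr n.+1 cpl.
  apply: (@coprimep_horner_mx0 _ _ _ (complexify B) _ _ _ cpl').
    rewrite -mulmxA -hC -complexifyM hM wp.
    by rewrite pp0 complexify0 mulmx0.
  rewrite hC -mulmxA [X in _ *m X](_ : _ = horner_mx (complexify B) (('X - l%:P) ^+ n.+1) *m
    horner_mx (complexify B) (map_poly (real_complex R) w)); last first.
    by rewrite !mulmxE -!rmorphM mulrC.
  rewrite mulmxA.
  by rewrite /geigenspace /kermxpoly mulmx_ker mul0mx.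
exists (hB (v * pu)), (hB (u * ps)); split.
- by rewrite /hB -rmorphD addrC uv rmorph1.
- by rewrite hM (_ : v * pu * (u * ps) = (u * v) * (ps * pu)); [exact: pp0|ring].
- by rewrite hM (_ : u * ps * (v * pu) = (u * v) * (ps * pu)); [exact: pp0|ring].
- exact: comm_horner_mx.
move=> l; split=> l0.
  apply: (key pu) => //; last by exists u; ring.
  rewrite coprimep_sym; apply: Pdiv.ClosedField.root_coprimep => z; rewrite root_XsubC => /eqP ->.
  by apply/negP => /root_pm; rewrite ltNge ltW.
apply: (key ps) => //; last by exists v; ring.
rewrite coprimep_sym; apply: Pdiv.ClosedField.root_coprimep => z; rewrite root_XsubC => /eqP ->.
by apply/negP => /root_pm; rewrite ltNge ltW.
Qed.

(** The size of the matrix exceeds no exponent used in [geigenspace] and is at least every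
    multiplicity, so the characteristic polynomial divides the product of the (X - l)^(n+1) over
    distinct roots; the kernels of coprime factors add up. *)
Lemma geigenspace_full n (B : 'M[complex R]_n) : exists s : seq (complex R),
  (forall l, l \in s -> eigenvalue B l) /\ (1%:M <= \sum_(l <- s) geigenspace B l)%MS.
Proof.
case: n B => [|n] B; first by exists [::]; split=> //; rewrite thinmx0 sub0mx.
have [rs Hrs] := closed_field_poly_normal (char_poly B).
rewrite (monicP (char_poly_monic _)) scale1r in Hrs.
exists (undup rs); split=> [l|].
  by rewrite mem_undup eigenvalue_root_char Hrs root_prod_XsubC.
set s := undup rs; have us : uniq s by exact: undup_uniq.
pose p_ (i : 'I_(size s)) := ('X - (s`_i)%:P) ^+ n.+1 : {poly complex R}.
have := @kermxpoly_prod _ _ B _ xpredT p_.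
rewrite (big_nth 0) big_mkord => H; rewrite -H.
  rewrite /kermxpoly (_ : horner_mx _ _ = 0) ?kermx0 //.
  have /dvdpP[q ->] : char_poly B %| \prod_i p_ i; last first.
    by rewrite rmorphM /= Cayley_Hamilton mulr0.
  rewrite Hrs -(big_mkord xpredT (fun i => ('X - (s`_i)%:P) ^+ n.+1)).
  rewrite -(big_nth 0 xpredT (fun z => ('X - z%:P) ^+ n.+1)).
  rewrite -big_undup_iterop_count -/s.
  apply: (big_rec2 (fun x y => x %| y)) => // z x y _ xy; apply: dvdp_mul => //.
  rewrite -[iterop _ _ _ _]/(_ ^+ _) dvdp_exp2l //.
  apply: leq_trans (count_size _ _) _.
  by rewrite -ltnS -(size_prod_XsubC rs id) -Hrs size_char_poly.
move=> i j _ _ ij; rewrite /p_ coprimep_expl // coprimep_expr // coprimep_XsubC root_XsubC.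
by rewrite nth_uniq // eq_sym.
Qed.

(** Turns the definition over the complex numbers into the range of a real projection. For the
    converse inclusion, x is decomposed over all generalized eigenspaces and [E] removes those on
    the wrong side. *)
Lemma spectral_space_range n (A E F : 'M[R]_n) (b : pred R) : E + F = 1%:M ->
  (forall l, b (complex.Re l) -> geigenspace (complexify A^T) l *m complexify F = 0) ->
  (forall l, eigenvalue (complexify A) l -> ~~ b (complex.Re l) ->
     geigenspace (complexify A^T) l *m complexify E = 0) ->
  spectral_space A b = [set x | x^T *m E = x^T].
Proof.
move=> EF HF HE; apply/seteqP; split=> x /=.
  move=> [s [Hs]]; rewrite -!complexify_trmx => xs.
  have W0 : (\sum_(l <- s) geigenspace (complexify A^T) l)%MS *m complexify F = 0.
    apply/sub_kermxP; rewrite big_seq; elim/big_rec: _ => [|l W ls IH]; first exact: sub0mx.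
    by rewrite addsmx_sub IH andbT; apply/sub_kermxP/HF; apply: (Hs l ls).2.
  have /submxP[D xD] := xs.
  have /complexify_inj xF : complexify (x^T *m F) = complexify 0.
    by rewrite complexifyM xD -mulmxA W0 mulmx0 complexify0.
  by rewrite -[RHS]mulmx1 -EF mulmxDr xF addr0.
move=> xE; have [s0 [Hs0 full]] := geigenspace_full (complexify A^T).
have Hs0' l : l \in s0 -> eigenvalue (complexify A) l.
  by move=> /Hs0; rewrite complexify_trmx eigenvalue_trmx.
exists [seq l <- s0 | b (complex.Re l)]; split=> [l|].
  by rewrite mem_filter => /andP[bl /Hs0'].
rewrite -!complexify_trmx big_filter.
have {full} := submx_trans (submx1 (complexify x^T)) full.
rewrite (bigID (fun l => b (complex.Re l))) /= => /sub_addsmxP[[u v] /= xuv].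
set S1 := (\sum_(_ <- _ | _) _)%MS in xuv *; set S2 := (\sum_(_ <- _ | _) _)%MS in xuv.
have S2E : S2 *m complexify E = 0.
  apply/sub_kermxP; rewrite /S2 big_seq_cond; elim/big_rec: _ => [|l W /andP[ls bl] IH].
    exact: sub0mx.
  by rewrite addsmx_sub IH andbT; apply/sub_kermxP/HE => //; exact: Hs0'.
have S1F : S1 *m complexify F = 0.
  apply/sub_kermxP; rewrite /S1; elim/big_rec: _ => [|l W bl IH]; first exact: sub0mx.
  by rewrite addsmx_sub IH andbT; apply/sub_kermxP/HF.
have S1E : S1 *m complexify E = S1.
  by rewrite -[RHS]mulmx1 -complexify1 -EF complexifyD mulmxDr S1F addr0.
rewrite -xE complexifyM xuv mulmxDl -!mulmxA S2E mulmx0 addr0 S1E.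
exact: submxMl.
Qed.

End Spectral.

Section HyperbolicSplitting.
Context {R : realType}.

(** A rank factorization E = P L of an idempotent has L P = 1, so L and P are coordinates and basis
    of its range, and commutation with E lets A pass to L A P. *)
Lemma idempotent_factor (F : fieldType) n (E A : 'M[F]_n) : E *m E = E -> A *m E = E *m A ->
  [/\ row_base E *m col_base E = 1%:M, row_base E *m A = row_base E *m A *m col_base E *m row_base E
    & A *m col_base E = col_base E *m (row_base E *m A *m col_base E)].
Proof.
move=> EE AE; have LP : row_base E *m col_base E = 1%:M.
  apply: (row_full_inj (col_base_full E)); apply: (row_free_inj (row_base_free E)) => /=.
  by rewrite mulmx1 mulmxA !mulmx_base -mulmxA mulmx_base.
suff gen d (P : 'M[F]_(n, d)) L : L *m P = 1%:M -> P *m L = E ->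
    L *m A = L *m A *m P *m L /\ A *m P = P *m (L *m A *m P).
  by have [] := gen _ _ _ LP (mulmx_base E).
move=> {}LP PL.
have LE : L *m E = L by rewrite -PL mulmxA LP mul1mx.
have EP : E *m P = P by rewrite -PL -mulmxA LP mulmx1.
split; first by rewrite -[RHS]mulmxA PL -mulmxA AE mulmxA LE.
by rewrite !mulmxA PL -AE -mulmxA EP.
Qed.

(** An eigenvector of the restricted matrix, carried to the whole space, is fixed by the projection;
    this will exclude eigenvalues on the wrong side. Row vectors are used to agree with
    [geigenspace]. *)
Lemma eigenvalue_restriction n d (A : 'M[R]_n) (As : 'M[R]_d) (P : 'M[R]_(n, d)) (L : 'M[R]_(d, n)) l :
  L *m P = 1%:M -> A *m P = P *m As -> eigenvalue (complexify As) l ->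
  exists w : 'rV[complex R]_n, [/\ w != 0, w *m complexify A^T = l *: w
    & w *m complexify (P *m L)^T = w].
Proof.
move=> LP AP; rewrite -eigenvalue_trmx -complexify_trmx => /eigenvalueP[v vA v0].
have PL : P^T *m L^T = 1%:M by rewrite -trmx_mul LP trmx1.
have vPL : v *m complexify P^T *m complexify L^T = v.
  by rewrite -mulmxA -complexifyM PL complexify1 mulmx1.
exists (v *m complexify P^T); split.
- by apply: contraNneq v0 => v0; rewrite -vPL v0 mul0mx.
- by rewrite -mulmxA -complexifyM -trmx_mul AP trmx_mul complexifyM mulmxA vA scalemxAl.
- by rewrite trmx_mul complexifyM mulmxA vPL.
Qed.

Lemma hyperbolic_splitting n (A : 'M[R]_n) : hyperbolic A ->
  exists d m (S : splitting A d m),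
    stable_space A = [set spP S *m y | y in setT] /\
    unstable_space A = [set spQ S *m z | z in setT].
Proof.
move=> hyp; have [|E [F [EF EF0 FE0 EA geig]]] := @spectral_split _ _ A^T.
  by move=> l; rewrite complexify_trmx eigenvalue_trmx; exact: hyp.
have FEs : F + E = 1%:M by rewrite addrC.
have FA : F *m A^T = A^T *m F.
  have -> : F = 1%:M - E by rewrite -EF addrC addKr.
  by rewrite mulmxBl mulmxBr mul1mx mulmx1 EA.
have EE : E *m E = E by rewrite -[RHS]mulmx1 -EF mulmxDr EF0 addr0.
have FF : F *m F = F by rewrite -[RHS]mulmx1 -EF mulmxDr FE0 add0r.
have stE : stable_space A = [set x | x^T *m E = x^T].
  apply: (@spectral_space_range _ _ A E F (fun r => r < 0)) => // l; first by move=> ?; exact: (geig l).1.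
  by move=> ev; rewrite -leNgt => l0; apply: (geig l).2; rewrite lt0r l0 hyp.
have unE : unstable_space A = [set x | x^T *m F = x^T].
  apply: (@spectral_space_range _ _ A F E (fun r => 0 < r)) => // l; first by move=> ?; exact: (geig l).2.
  by move=> ev; rewrite -leNgt => l0; apply: (geig l).1; rewrite lt_neqAle l0 hyp.
have TT (X Y : 'M[R]_n) : X^T *m Y^T = (Y *m X)^T by rewrite trmx_mul.
have EET : E^T *m E^T = E^T by rewrite TT EE.
have FFT : F^T *m F^T = F^T by rewrite TT FF.
have AE : A *m E^T = E^T *m A by rewrite -[A]trmxK !TT EA.
have AF : A *m F^T = F^T *m A by rewrite -[A]trmxK !TT FA.
have [LP LA AP] := idempotent_factor EET AE.
have [MQ MA AQ] := idempotent_factor FFT AF.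
set P := col_base E^T in LP LA AP; set L := row_base E^T in LP LA AP.
set Q := col_base F^T in MQ MA AQ; set M := row_base F^T in MQ MA AQ.
have PL : P *m L = E^T by exact: mulmx_base.
have QM : Q *m M = F^T by exact: mulmx_base.
set As := L *m A *m P in LA AP; set Au := M *m A *m Q in MA AQ.
have geig1 (w : 'rV[complex R]_n) l :
    w *m complexify A^T = l *: w -> (w <= geigenspace (complexify A^T) l)%MS.
  by move=> wA; apply: submx_trans (eigenspace_sub_geigen _ _); apply/eigenspaceP.
have evA (w : 'rV[complex R]_n) l : w != 0 -> w *m complexify A^T = l *: w ->
    complex.Re l != 0.
  move=> w0 wA; apply: hyp; rewrite -eigenvalue_trmx -complexify_trmx.
  by apply/eigenvalueP; exists w.
(* An eigenvalue of [As] with positive real part would have an eigenvector both fixed and killed by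
   [E]. *)
have [|lams lams0 [Ns]] := @adapted_norm_exists _ _ As.
  move=> l /(eigenvalue_restriction LP AP)[w [w0 wA]]; rewrite PL trmxK => wE.
  have := evA _ _ w0 wA; case: ltgtP => // l0 _.
  have /submxP[D wD] := geig1 _ _ wA.
  by case/eqP: w0; rewrite -wE wD -mulmxA (geig l).2 // mulmx0.
have [|lamu lamu0 [Nu]] := @adapted_norm_exists _ _ (- Au).
  move=> l /= ev; have {ev} : eigenvalue (complexify Au) (- l).
    move/eigenvalueP: ev => [v vA v0]; apply/eigenvalueP; exists v => //.
    by rewrite scaleNr -vA -[X in _ = - (v *m X)]/(map_mx _ _) map_mxN mulmxN opprK.
  move=> /(eigenvalue_restriction MQ AQ)[w [w0 wA]]; rewrite QM trmxK => wF.
  have := evA _ _ w0 wA; rewrite raddfN oppr_eq0 /=; case: ltgtP => // l0 _.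
  have /submxP[D wD] := geig1 _ _ wA.
  by case/eqP: w0; rewrite -wF wD -mulmxA (geig _).1 ?mulmx0 // raddfN oppr_lt0.
pose lam := Num.min lams lamu.
have lamls : lam <= lams by rewrite ge_min lexx.
have Ns' := adapted_norm_weaken lamls Ns.
have lamle : lam <= lamu by rewrite ge_min lexx orbT.
have Nu' := adapted_norm_weaken lamle Nu.
have lam0 : 0 < lam by rewrite lt_min lams0.
have LQ : L *m Q = 0.
  apply: (row_full_inj (col_base_full E^T)); apply: (row_free_inj (row_base_free F^T)) => /=.
  by rewrite mulmx0 mul0mx mulmxA PL -mulmxA QM TT FE0 trmx0.
have MP : M *m P = 0.
  apply: (row_full_inj (col_base_full F^T)); apply: (row_free_inj (row_base_free E^T)) => /=.
  by rewrite mulmx0 mul0mx mulmxA QM -mulmxA PL TT EF0 trmx0.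
have PLQM : P *m L + Q *m M = 1%:M by rewrite PL QM -linearD /= EF trmx1.
exists _, _, (Splitting LP MQ LQ MP PLQM LA MA lam0 Ns' Nu'); rewrite stE unE /=.
split; apply/seteqP; split=> x /=.
- move=> xE; exists (L *m x) => //; rewrite mulmxA PL.
  by rewrite -[LHS]trmxK trmx_mul trmxK xE trmxK.
- move=> [y _ <-]; rewrite -[X in _ *m X]trmxK; rewrite -trmx_mul; congr (_^T).
  by rewrite -[X in X *m _]PL -mulmxA [L *m _]mulmxA LP mul1mx.
- move=> xF; exists (M *m x) => //; rewrite mulmxA QM.
  by rewrite -[LHS]trmxK trmx_mul trmxK xF trmxK.
- move=> [y _ <-]; rewrite -[X in _ *m X]trmxK; rewrite -trmx_mul; congr (_^T).
  by rewrite -[X in X *m _]QM -mulmxA [M *m _]mulmxA MQ mul1mx.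
Qed.

Lemma splitting_dim n d m (A : 'M[R]_n) (S : splitting A d m) :
  (d + m = n)%N /\ \rank (row_mx (spP S) (spQ S)) = n.
Proof.
have e1 : row_mx (spP S) (spQ S) *m col_mx (spLs S) (spLu S) = 1%:M.
  by rewrite mul_row_col spPQ.
have e2 : col_mx (spLs S) (spLu S) *m row_mx (spP S) (spQ S) = 1%:M.
  by rewrite mul_col_row spLsP spLsQ spLuP spLuQ -scalar_mx_block.
have r1 : \rank (row_mx (spP S) (spQ S)) = n.
  apply/eqP; rewrite eqn_leq rank_leq_row /=.
  by have := mxrankM_maxl (row_mx (spP S) (spQ S)) (col_mx (spLs S) (spLu S)); rewrite e1 mxrank1.
split=> //; apply/eqP; rewrite eqn_leq; apply/andP; split.
  have := mxrankM_maxr (col_mx (spLs S) (spLu S)) (row_mx (spP S) (spQ S)).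
  by rewrite e2 mxrank1 r1.
by rewrite -{1}r1 rank_leq_col.
Qed.

(* Reversing time exchanges the stable and the unstable directions. *)
Definition splitting_opp n d m (A : 'M[R]_n) (S : splitting A d m) : splitting (- A) m d.
Proof.

refine (@Splitting R n (- A) m d (spQ S) (spP S) (spLu S) (spLs S) (- spAu S) (- spAs S)
  (spLuQ S) (spLsP S) (spLuP S) (spLsQ S) _ _ _ (splam S) (splam_gt0 S) (sp_nu S)
  (@AdaptedNorm R d (- - spAs S) (splam S) (sp_ns S) (anorm_cst (sp_ns S)) (anorm_step (sp_ns S))
    (anormD (sp_ns S)) (anormZ (sp_ns S)) (anorm_le (sp_ns S)) (anorm_ge (sp_ns S))
    (anorm_step_gt0 (sp_ns S)) _)).
- by rewrite addrC spPQ.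
- by rewrite mulmxN mulNmx spLuA.
- by rewrite mulmxN mulNmx spLsA.
- by move=> dl y; rewrite opprK; exact: anorm_contr.
(* Kept transparent, so that [bnorm_opp] reduces to the symmetry of the maximum. *)
Defined.

Lemma bnorm_opp n d m (A : 'M[R]_n) (S : splitting A d m) x :
  bnorm (splitting_opp S) x = bnorm S x.
Proof. exact: maxC. Qed.

End HyperbolicSplitting.

(** * Gevrey regularity of the local stable set *)

Section LocalData.
Context {R : realType} {n : nat}.
Implicit Types (f : 'cV[R]_n -> R) (g : 'cV[R]_n -> 'cV[R]_n) (U : set 'cV[R]_n).

Lemma iter_partialN U f s x : open U -> smooth_on U f -> U x ->
  iter_partial s (fun z => - f z) x = - iter_partial s f x.
Proof.
move=> oU sf; elim: s x => [//|i s IH] x Ux; rewrite /iter_partial /=.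
rewrite (partial_ext i oU IH Ux) /partial deriveN //.
exact: (sf s x Ux).2.
Qed.

Lemma gevrey_onN beta U f : open U -> gevrey_on beta U f ->
  gevrey_on beta U (fun x => - f x).
Proof.
move=> oU [sf gf]; split=> [s x Ux|K cK KU].
  have [cf df] := sf s x Ux.
  have E : \near x, - iter_partial s f x = iter_partial s (fun z => - f z) x.
    by apply: filterS (open_nbhs_nbhs (conj oU Ux)) => z Uz; rewrite (iter_partialN _ oU sf Uz).
  split=> [|i].
    suff : iter_partial s (fun z => - f z) y @[y --> x] --> - iter_partial s f x.
      by rewrite -(iter_partialN s oU sf Ux).
    by apply: cvg_trans (near_eq_cvg E) _; exact: cvgN.
  by apply: near_eq_derivable E _; exact: derivableN.
have [M [C H]] := gf K cK KU; exists M, C => k x Kx.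
by rewrite /multi_partial (iter_partialN _ oU sf) ?normrN; [exact: H|exact: KU].
Qed.

(** Reassembling [g] from its coordinates proves it differentiable, so that the hypothesis on ['d g]
    determines its directional derivatives. *)
Lemma partial_eq0 g : (forall l, differentiable (fun x => g x l 0) 0) ->
  (forall v, 'd g (0 : 'cV[R]_n) v = 0) ->
  forall l i, partial i (fun x => g x l 0) 0 = 0.
Proof.
move=> dgl dg0 l i.
have dg : differentiable g 0.
  rewrite (_ : g = \sum_(l < n) (fun x => g x l 0 *: (delta_mx l 0 : 'cV[R]_n))).
    by apply: differentiable_sum => k; exact: differentiableZl.
  rewrite funeqE => x; apply/colP => k; rewrite fct_sumE summxE (bigD1 k) //= !mxE !eqxx mulr1.
  by rewrite big1 ?addr0 // => k' kk'; rewrite !mxE eq_sym (negbTE kk') mulr0.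
have dv : derivable g 0 (delta_mx i 0) by exact: diff_derivable.
have := derive_mx dv; rewrite deriveE // dg0 => /matrixP /(_ l 0).
by rewrite !mxE.
Qed.

Lemma gevrey_local_bounds beta U g : open_nbhs (0 : 'cV[R]_n) U -> gevrey_map_on beta U g ->
  exists r0 M C : R, [/\ 0 < r0, 0 <= M, 0 <= C, [set x | `|x| <= r0] `<=` U
    & forall l s x, `|x| <= r0 -> differentiable (iter_partial s (fun x => g x l 0)) x /\
       `|iter_partial s (fun x => g x l 0) x| <= M * C ^+ size s * (size s)`!%:R `^ beta].
Proof.
move=> [oU U0] gg.
have [r0 r00 r0U] : exists2 r0 : R, 0 < r0 & [set x : 'cV[R]_n | `|x| <= r0] `<=` U.
  have /nbhs_ballP[e /= e0 eU] := open_nbhs_nbhs (conj oU U0).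
  exists (e / 2); first by rewrite divr_gt0.
  move=> x /= xe; apply: eU; rewrite -ball_normE /= sub0r normrN.
  by apply: le_lt_trans xe _; lra.
have /choice[MC HMC] (l : 'I_n) : exists MC : R * R, [/\ 0 <= MC.1, 0 <= MC.2
    & forall s x, `|x| <= r0 -> differentiable (iter_partial s (fun x => g x l 0)) x /\
       `|iter_partial s (fun x => g x l 0) x| <= MC.1 * MC.2 ^+ size s * (size s)`!%:R `^ beta].
  by have [M [C H]] := gevrey_words oU (gg l) r0U; exists (M, C).
have M0 l : 0 <= (MC l).1 by have [] := HMC l.
have C0 l : 0 <= (MC l).2 by have [] := HMC l.
exists r0, (\sum_l (MC l).1), (\sum_l (MC l).2); split=> //; try exact: sumr_ge0.
move=> l s x xr; have [_ _ H] := HMC l; have [Hd Hb] := H s x xr; split=> //.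
apply: le_trans Hb _; rewrite ler_wpM2r ?powR_ge0 //; apply: ler_pM => //; first exact: exprn_ge0.
  by rewrite (bigD1 l) //= lerDl sumr_ge0.
rewrite lerXn2r ?nnegrE ?sumr_ge0 //.
by rewrite (bigD1 l) //= lerDl sumr_ge0.
Qed.

Lemma small_partials beta U g : open_nbhs (0 : 'cV[R]_n) U -> gevrey_map_on beta U g ->
  (forall l i, partial i (fun x => g x l 0) 0 = 0) ->
  forall e : R, 0 < e -> exists2 r0 : R, 0 < r0 &
    forall l i x, `|x| <= r0 -> `|partial i (fun x => g x l 0) x| <= e.
Proof.
move=> [oU U0] gg dg0 e e0.
pose Pr (li : 'I_n * 'I_n) (x : 'cV[R]_n) := `|partial li.2 (fun x => g x li.1 0) x| <= e.
have H : \forall x \near nbhs (0 : 'cV[R]_n), forall li, Pr li x.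
  apply: (@filter_forall _ _ Pr) => -[l i].
  have [sf _] := gg l; have [cf _] := sf [:: i] 0 U0.
  have /(@cvgrPdist_le _ _ _ (nbhs (0 : 'cV[R]_n))) /(_ e e0) := cf.
  by apply: filterS => x; rewrite /Pr /iter_partial /= dg0 sub0r normrN.
have /nbhs_ballP[e' /= e'0 H'] := H.
exists (e' / 2); first by rewrite divr_gt0.
move=> l i x xe; apply: (H' x _ (l, i)); rewrite -ball_normE /= sub0r normrN.
by apply: le_lt_trans xe _; lra.
Qed.

Lemma norm_vector_lipschitz g (r0 e : R) :
  (forall l x, `|x| <= r0 -> differentiable (fun x => g x l 0) x) ->
  (forall l i x, `|x| <= r0 -> `|partial i (fun x => g x l 0) x| <= e) ->
  0 <= e -> forall x y, `|x| <= r0 -> `|y| <= r0 -> `|g x - g y| <= n%:R * e * `|x - y|.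
Proof.
move=> dg He e0 x y xr yr; apply: cV_norm_le => [|l]; first by rewrite !mulr_ge0.
rewrite !mxE; apply: (@lipschitz_partial R n (fun x => g x l 0)) => t /andP[t0 t1].
have zr : `|t *: (x - y) + y| <= r0.
  have -> : t *: (x - y) + y = t *: x + (1 - t) *: y.
    by rewrite scalerBr scalerBl scale1r -addrA; congr (_ + _); rewrite addrC.
  apply: le_trans (ler_normD _ _) _; rewrite !normrZ (ger0_norm t0).
  have t1' : 0 <= 1 - t by lra.
  rewrite (ger0_norm t1').
  have := ler_wpM2l t0 xr; have := ler_wpM2l t1' yr; lra.
by split=> [|i]; [exact: dg|exact: He].
Qed.

End LocalData.

Section StableManifold.
Context {R : realType} {n d m : nat} {A : 'M[R]_n} (S : splitting A d m).
Local Notation P := (spP S).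
Local Notation Q := (spQ S).
Local Notation Ls := (spLs S).
Local Notation Lu := (spLu S).
Local Notation lam := (splam S).
Local Notation ns := (sp_ns S).
Local Notation nu := (sp_nu S).
Local Notation N := (bnorm S).

Lemma open_bnorm_ball r : open [set x | N x < r].
Proof.
have cL p (B : 'M[R]_(p, n)) : continuous (mulmx B : 'cV[R]_n -> 'cV[R]_p).
  exact: cV_linear_continuous.
have -> : [set x | N x < r] =
    (mulmx Ls @^-1` [set y | ns y < r]) `&` (mulmx Lu @^-1` [set z | nu z < r]).
  by apply/seteqP; split=> x /=; rewrite /bnorm gt_max => /andP.
apply: openI; (apply: open_comp => [x _|]; first exact: cL); first exact: open_anorm_ball.
exact: (@open_anorm_ball R n m d (- A) (splitting_opp S)).
Qed.

Lemma gbound_gevrey (beta a rho b0 : R) j : 0 <= a -> 0 <= rho -> 0 <= b0 ->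
  gbound beta a rho b0 j <= (a + b0) * rho ^+ j * j`!%:R `^ beta.
Proof.
move=> a0 rho0 b00; rewrite /gbound; case: j => [|j] /=.
  by rewrite expr0 mulr1 powR1 mulr1 lerDr.
rewrite mulrC ler_wpM2r ?powR_ge0 //.
have j1 : (j.+1%:R ^+ 2)^-1 <= 1 :> R by rewrite invf_le1 ?exprn_gt0 // exprn_ege1 // ler1n.
have aj : 0 <= a * rho ^+ j.+1 by rewrite mulr_ge0 ?exprn_ge0.
apply: le_trans (ler_wpM2l aj j1) _; rewrite mulr1 mulrDl lerDl mulr_ge0 //.
exact: exprn_ge0.
Qed.

Lemma is_deriveP (c : R -> 'cV[R]_n) v : is_derive (0 : R) 1 c v <->
  forall e, 0 < e -> exists2 dl, 0 < dl & forall s, s != 0 -> `|s| < dl ->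
    `|c s - c 0 - s *: v| <= e * `|s|.
Proof.
have E : (fun h : R => h^-1 *: ((c \o shift 0) (h *: (1 : R)) - c 0)) =
    (fun s : R => (s - 0)^-1 *: (c s - c 0)).
  by rewrite funeqE => h /=; rewrite addr0 subr0 [h *: 1]mulr1.
have HW : has_deriv_within setT c 0 v <->
    (h^-1 *: ((c \o shift 0) (h *: (1 : R)) - c 0) @[h --> 0^'] --> v).
  by rewrite E /has_deriv_within withinET.
have [H1 H2] := has_deriv_withinP setT c 0 v; split=> [dc0|H].
  have H : has_deriv_within setT c 0 v by apply/HW; case: dc0 => dc <-; exact: dc.
  move=> e e0; have [dl dl0 Hd] := H1 H e e0; exists dl => // s s0 sd.
  by have := Hd s I s0; rewrite !subr0; apply.
have /HW L : has_deriv_within setT c 0 v.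
  apply: H2 => e e0; have [dl dl0 Hd] := H e e0; exists dl => // s _ s0.
  by rewrite !subr0; exact: Hd.
by apply: DeriveDef; [apply/cvg_ex; exists v|apply/cvg_lim].
Qed.

Variables (beta : R) (Omega : set 'cV[R]_n) (g : 'cV[R]_n -> 'cV[R]_n).
Hypotheses (beta1 : 1 <= beta) (Omega0 : open_nbhs (0 : 'cV[R]_n) Omega)
  (gg : gevrey_map_on beta Omega g) (g0 : g 0 = 0)
  (dg0 : forall l i, partial i (fun x => g x l 0) 0 = 0).
Local Notation F := (fun x : 'cV[R]_n => A *m x + g x).
Local Notation J := [set t : R | 0 <= t].
Local Notation V r := [set x | N x < r].

Lemma bnorm_small e : 0 < e -> exists2 r : R, 0 < r & forall x, N x <= r -> N (g x) <= e * N x.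
Proof.
move=> e0; have [r0 [M [C [r00 M0 C0 r0O Hg]]]] := gevrey_local_bounds Omega0 gg.
have [c c1 [HN HNi _ _ _]] := bnorm_cst S; have c0 : 0 < c by lra.
pose e1 : R := e / (c * n.+1%:R * c).
have e10 : 0 < e1 by rewrite divr_gt0 // !mulr_gt0.
have e1E : c * n%:R * e1 * c <= e.
  rewrite (_ : _ * c = e * (n%:R / n.+1%:R)).
    by rewrite ler_piMr ?(ltW e0) // ler_pdivrMr // mul1r ler_nat.
  by rewrite /e1; field; rewrite nat1r pnatr_eq0 lt0r_neq0.
clearbody e1.
have [r1 r10 Hr1] := small_partials Omega0 gg dg0 e10.
pose r2 := Num.min r0 r1.
exists (r2 / c); first by rewrite divr_gt0 // lt_min r00.
move=> x xr; have xr2 : `|x| <= r2.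
  by apply: le_trans (HNi x) _; rewrite mulrC -ler_pdivlMr.
have H := @norm_vector_lipschitz R n g r2 e1.
have {}H : `|g x - g 0| <= n%:R * e1 * `|x - 0|.
  apply: H => //; rewrite ?normr0 ?ltW ?lt_min ?r00 //.
    by move=> l z; rewrite le_min => /andP[zr _]; exact: (Hg l [::] z zr).1.
  by move=> l i z; rewrite le_min => /andP[_ zr]; exact: Hr1.
rewrite g0 !subr0 in H.
apply: le_trans (HN _) _; apply: le_trans (ler_wpM2l (ltW c0) H) _.
apply: le_trans (_ : c * (n%:R * e1 * (c * N x)) <= _).
  rewrite ler_wpM2l ?(ltW c0) // ler_wpM2l ?HNi // mulr_ge0 //; exact: ltW.
by rewrite !mulrA ler_wpM2r ?bnorm_ge0.
Qed.

(** The graph function is the unstable part at time 0 of the limit orbit with stable datum y. All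
    radii below [r1] are allowed, so that the stable and unstable sets can later be taken in the
    same box. *)
Lemma stable_graph : exists2 r1 : R, 0 < r1 & forall r, 0 < r -> r <= r1 ->
  V r `<=` Omega /\ exists h : 'cV[R]_d -> 'cV[R]_m,
  [/\ gevrey_map_on beta [set y | ns y < r] h,
      W_loc (V r) F J = [set P *m y + Q *m h y | y in [set y | ns y < r]]
    & forall e, 0 < e -> exists2 s : R, 0 < s &
        forall y, ns y < r -> ns y <= s -> nu (h y) <= e * ns y].
Proof.
have [r0 [M [C [r00 M0 C0 r0O Hg]]]] := gevrey_local_bounds Omega0 gg.
have [c c1 [HN HNi HA HL HPQ]] := bnorm_cst S; have c0 : 0 < c by lra.
have lam0 := splam_gt0 S.
pose K1 : R := c ^+ 2 * n.+1%:R.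
have K10 : 0 < K1 by rewrite mulr_gt0 // exprn_gt0.
(* Makes the Lipschitz constant [eps] of [g] in the box norm at most lam / 4; n + 1 in [K1] keeps
   the denominator positive when n = 0. *)
pose epsg : R := lam / (4 * K1).
have epsg0 : 0 < epsg by rewrite divr_gt0 // mulr_gt0.
have epsgE : K1 * epsg = lam / 4 by rewrite /epsg; field; rewrite lt0r_neq0.
clearbody epsg.
have [r1 r10 Hr1] := small_partials Omega0 gg dg0 epsg0.
pose eps : R := c * (n%:R * epsg * c).
have eps0 : 0 <= eps by rewrite !mulr_ge0 ?(ltW c0) ?(ltW epsg0).
have epsle : eps <= K1 * epsg.
  have -> : K1 * epsg = eps + c ^+ 2 * epsg by rewrite /K1 /eps -natr1; ring.
  by rewrite lerDl mulr_ge0 ?sqr_ge0 // ltW.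
pose X : R := 16 * c * M * (n%:R * C * (2 * c)) ^+ 2.
have X0 : 0 <= X by rewrite mulr_ge0 ?sqr_ge0 // mulr_ge0 // mulr_ge0 // ltW.
pose Y : R := 16 * n%:R * C * (2 * c).
have Y0 : 0 <= Y by rewrite mulr_ge0 // ?mulr_ge0 // ltW.
(* A small a makes the derivatives of g of order at least two negligible in the
   Gevrey estimate; rho is then taken large enough for the identity map. *)
pose a : R := Num.min (lam / 2 / (X + 1)) (Y + 1)^-1.
have X1 : 0 < X + 1 by lra.
have Y1 : 0 < Y + 1 by lra.
have a0 : 0 < a by rewrite lt_min invr_gt0 Y1 andbT !divr_gt0.
have aX : X * a <= lam / 2.
  have : a <= lam / 2 / (X + 1) by rewrite ge_min lexx.
  by rewrite ler_pdivlMr //; lra.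
have aY : Y * a <= 1.
  have : a <= (Y + 1)^-1 by rewrite ge_min lexx orbT.
  by move=> /(ler_wpM2l (ltW Y1)); rewrite divff ?lt0r_neq0 //; lra.
pose rho : R := `|anorm_cst ns| / a.
have rho0 : 0 <= rho by rewrite divr_ge0 // ltW.
have rhoE i : ns (delta_mx i 0) <= a * rho.
  rewrite /rho mulrC divfK ?lt0r_neq0 //; apply: le_trans (anorm_le _ _) _.
  apply: le_trans (ler_wpM2r (normr_ge0 _) (ler_norm _)) _.
  by rewrite ler_piMr // norm_delta_mx.
pose r2 : R := Num.min r0 r1.
have r20 : 0 < r2 by rewrite lt_min r00.
exists (r2 / c); first by rewrite divr_gt0.
move=> r rpos rle.
have Vle x : N x < r -> `|x| <= r2.
  move=> xr; apply: le_trans (HNi x) _; rewrite mulrC -ler_pdivlMr //.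
  by apply: le_trans rle; exact: ltW.
have Vle0 x : N x < r -> `|x| <= r0 by move/Vle; rewrite le_min => /andP[].
have Vle1 x : N x < r -> `|x| <= r1 by move/Vle; rewrite le_min => /andP[].
split; first by move=> x /Vle0; exact: r0O.
have glip x x' : N x < r -> N x' < r -> N (g x - g x') <= eps * N (x - x').
  move=> /Vle xr /Vle x'r.
  have H : `|g x - g x'| <= n%:R * epsg * `|x - x'|.
    apply: (@norm_vector_lipschitz R n g r2 epsg) => //; last exact: ltW.
      by move=> l z; rewrite le_min => /andP[zr _]; exact: (Hg l [::] z zr).1.
    by move=> l i z; rewrite le_min => /andP[_ zr]; exact: Hr1.
  apply: le_trans (HN _) _; rewrite /eps -[leRHS]mulrA ler_wpM2l ?(ltW c0) //.
  by apply: le_trans H _; rewrite -[leRHS]mulrA ler_wpM2l ?HNi // mulr_ge0 // ltW.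
have epslam : eps <= lam / 4 by rewrite -epsgE.
have cA0 := ltW c0.
pose b0 : R := Num.max r (c * M / lam).
have b00 : 0 <= b0 by rewrite le_max ltW.
have rb0 : r <= b0 by rewrite le_max lexx.
have b0M : c * M <= lam * b0.
  by rewrite [leRHS]mulrC -ler_pdivrMr // le_max lexx orbT.
(* Half of lam a is spent on the linear term, by the choice of [epsg], and half on the quadratic
   one, by the choice of [a]. *)
have closes : c * (epsg * n%:R * (2 * c * a) + 16 * M * (n%:R * C * (2 * c * a)) ^+ 2) <= lam * a.
  rewrite (_ : c * _ = 2 * eps * a + X * a * a); last by rewrite /eps /X; ring.
  have := ler_wpM2r (ltW a0) aX; have := ler_wpM2r (ltW a0) epslam; lra.
have small : 16 * n%:R * C * (2 * c * a) <= 1 by rewrite [leLHS](_ : _ = Y * a) // /Y; ring.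
have Hpic := picard_maj g0 rpos eps0 epslam glip beta1 c1 M0 C0 (ltW epsg0) (ltW a0) rho0 HL HPQ
  (fun l s x xr => Hg l s x (Vle0 x xr)) (fun l i x xr => Hr1 l i x (Vle1 x xr))
  small rb0 b0M closes rhoE.
have /choice[u Hu] (y : 'cV[R]_d) : exists u, ns y < r -> is_limit S g r eps c y u.
  have [yr|yr] := ltP (ns y) r; last by exists (fun=> 0).
  by have [u Hu] := limit_traj g0 rpos eps0 epslam glip cA0 HA yr; exists u.
have oO : open [set y | ns y < r] by exact: open_anorm_ball.
pose h y := Lu *m u y 0.
have uE y : ns y < r -> u y 0 = P *m y + Q *m h y.
  by move=> yr; rewrite -[LHS](sp_decomp S) (limit_s0 (Hu y yr)).
exists h; split.
- move=> i; have [m0 Hm0] := small_dyad S.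
  (* The index is shifted by [m0] because the uniform bounds hold for small steps. *)
  pose f_ p (y : 'cV[R]_d) : R := (Lu *m traj S g (m0 + p) y 0%N) i 0.
  pose k := `|anorm_cst nu|.
  pose phi j := k * gbound beta a rho b0 j.
  have Hf p q : maj q [set y | ns y < r] Num.norm (f_ p) phi.
    have sm : small_step S (dyad (m0 + p)) by apply: Hm0; exact: leq_addr.
    have [M1 M2] := Hpic _ _ (m0 + p).+1 0%N q sm (leq0n (4 ^ (m0 + p))).
    pose Le p' (B : 'M[R]_(m, p')) (w : 'cV[R]_p') : R := (B *m w) i 0.
    have linLe p' B : linear (@Le p' B).
      by move=> t v w; rewrite /Le mulmxDr -scalemxAr !mxE.
    (* A zero map on the stable side lets [maj_lin] extract one coordinate of the unstable part. *)
    pose L1 : {linear 'cV[R]_d -> R} := HB.pack (Le d 0) (GRing.isLinear.Build _ _ _ _ (Le d 0) (linLe d 0)).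
    pose L2 : {linear 'cV[R]_m -> R} := HB.pack (Le m 1%:M) (GRing.isLinear.Build _ _ _ _ (Le m 1%:M) (linLe m 1%:M)).
    have cL1 : continuous L1 by exact: cV_linear_continuous.
    have cL2 : continuous L2 by exact: cV_linear_continuous.
    have k0 : 0 <= k by exact: normr_ge0.
    have Hle w1 w2 : `|L1 w1 + L2 w2| <= 0 * ns w1 + k * nu w2.
      rewrite /= /Le mul0mx mxE add0r mul1mx mul0r add0r.
      apply: le_trans (cV_entry_le _ _) _; apply: le_trans (anorm_ge nu _) _.
      by rewrite ler_wpM2r ?anorm_ge0 // ler_norm.
    have Hm := maj_lin cL1 cL2 (lexx 0) k0 Hle oO M1 M2.
    apply: (maj_ext oO _ (maj_le _ Hm)) => [x _|j _].
      by rewrite /= /Le mul0mx mul1mx mxE add0r.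
    by rewrite mul0r add0r.
  have cv y : ns y < r -> f_ p y @[p --> \oo] --> h y i 0.
    move=> yr; have := @limit_u_cvg R n d m A S g r eps c y (u y) (Hu y yr) i.
    by rewrite -(cvg_shiftn m0); under eq_fun do rewrite addnC.
  have [sh Hh] := lim_smooth_on (f := fun y => h y i 0) oO Hf cv.
  split=> // Ks _ KO; exists (k * (a + b0)), rho => w x Kx.
  have -> : multi_order w = size (flatten [seq nseq (w i) i | i <- enum 'I_d]).
    rewrite size_flatten /shape -map_comp sumnE big_map big_enum /=.
    by apply: eq_bigr => j _; rewrite size_nseq.
  apply: le_trans (Hh _ x (KO x Kx)) _; rewrite /phi -!mulrA ler_wpM2l ?normr_ge0 //.
  by rewrite mulrA; apply: gbound_gevrey => //; exact: ltW.
- apply/seteqP; split=> x /=.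
    move=> xW; have [xr _ _] := xW; have yr : ns (Ls *m x) < r := le_lt_trans (ns_bnorm S x) xr.
    exists (Ls *m x) => //; rewrite -uE //.
    by rewrite -(W_loc_limit g0 rpos eps0 epslam glip cA0 HA yr (Hu _ yr) xW erefl).
  move=> [y yr <-]; rewrite -uE //.
  exact: (limit_W_loc g0 rpos eps0 epslam glip cA0 HA yr (Hu y yr)).
- move=> e e0; have [s s0 Hs] := bnorm_small (mulr_gt0 lam0 e0).
  exists s => // y yr ys.
  apply: (limit_u_le g0 rpos eps0 epslam glip yr (Hu y yr) (ltW e0)) => x xy.
  by apply: Hs; exact: le_trans ys.
Qed.

End StableManifold.

(** * Tangent space of the graph at the origin *)

Section GraphTangent.
Context {R : realType} {n d m : nat} {A : 'M[R]_n} (S : splitting A d m).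
Local Notation P := (spP S).
Local Notation Q := (spQ S).
Local Notation Ls := (spLs S).
Local Notation Lu := (spLu S).
Local Notation ns := (sp_ns S).
Local Notation nu := (sp_nu S).
Local Notation N := (bnorm S).
Variables (r : R) (h : 'cV[R]_d -> 'cV[R]_m).
Hypotheses (r0 : 0 < r) (h0 : forall e, 0 < e -> exists2 s : R, 0 < s &
        forall y, ns y < r -> ns y <= s -> nu (h y) <= e * ns y).
Local Notation W := [set P *m y + Q *m h y | y in [set y | ns y < r]].

Lemma graph_zero : h 0 = 0.
Proof.
have [s s0 Hs] := h0 ltr01; apply: (@anorm_eq0 R m _ _ nu).
by have := Hs 0; rewrite anorm0 mulr0; apply => //; exact: ltW.
Qed.

Lemma graph_W0 : W 0.
Proof. by exists 0; rewrite /= ?anorm0 // graph_zero !mulmx0 addr0. Qed.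

(** A curve in the graph has unstable part o(t), since its stable part is O(t) and h is
    superlinearly small; conversely t y lifted to the graph has velocity P y. *)
Lemma graph_tangent : tangent_space W 0 = [set P *m y | y in setT].
Proof.
have [k k1 [HN HNi _ HL HPQ]] := bnorm_cst S; have k0 : 0 < k by lra.
apply/seteqP; split=> v /=.
  move=> [c [c0 Wc /is_deriveP dc]].
  suff L0 : Lu *m v = 0.
    by exists (Ls *m v) => //; rewrite -[RHS](sp_decomp S) L0 mulmx0 addr0.
  apply: (@anorm_eq0 R m _ _ nu).
  have key e : 0 < e -> e <= 1 -> nu (Lu *m v) <= e * (k * (`|v| + 2)).
    move=> e0 e1; have [s s0 Hs] := h0 e0; have [dl dl0 Hd] := dc e e0.
    have /nbhs_ballP[dw /= dw0 Hw] := Wc.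
    (* The bounds make the derivative estimate valid at t, keep [c t] in the graph, and bring its
       stable part into the range where h is at most e times its argument. *)
    pose T : R := Num.min (Num.min dl dw) (s / (k * (`|v| + 1))).
    have v1 : 0 < `|v| + 1 by rewrite ltr_wpDl.
    have kv : 0 < k * (`|v| + 1) by rewrite mulr_gt0.
    have T0 : 0 < T by rewrite !lt_min dl0 dw0 divr_gt0.
    pose t : R := T / 2; have t0 : 0 < t by rewrite divr_gt0.
    have tT : t < T by rewrite /t; lra.
    have tdl : `|t| < dl by rewrite gtr0_norm //; apply: lt_le_trans tT _; rewrite !ge_min lexx.
    have tdw : t < dw by apply: lt_le_trans tT _; rewrite !ge_min lexx orbT.
    have ts : t * (k * (`|v| + 1)) <= s.
      rewrite -ler_pdivlMr //; apply: le_trans (ltW tT) _; by rewrite ge_min lexx orbT.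
    have [y yr cy] : W (c t).
      by apply: Hw; rewrite /ball /= sub0r normrN gtr0_norm.
    have := Hd t (lt0r_neq0 t0) tdl; rewrite c0 subr0 (gtr0_norm t0) => Et.
    have yE : y = Ls *m c t by rewrite -cy sp_Ls.
    have hE : h y = Lu *m c t by rewrite -cy sp_Lu.
    have ct : `|c t| <= t * (`|v| + 1).
      rewrite -[c t](subrK (t *: v)); apply: le_trans (ler_normD _ _) _.
      rewrite normrZ (gtr0_norm t0); have := ler_wpM2r (ltW t0) e1; lra.
    have yle : ns y <= t * (k * (`|v| + 1)).
      rewrite yE; apply: le_trans (HL _).1 _.
      by rewrite mulrCA ler_wpM2l // ltW.
    have hy : nu (h y) <= e * (t * (k * (`|v| + 1))).
      apply: le_trans (Hs y yr (le_trans yle ts)) _.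
      by rewrite ler_wpM2l // ltW.
    have tv : t * nu (Lu *m v) <= nu (h y) + k * (e * t).
      rewrite -[X in X * nu _](gtr0_norm t0) -anormZ scalemxAr.
      rewrite -[t *: v](subKr (c t)) mulmxBr hE.
      apply: le_trans (anormD _ _ _) _; rewrite anormN lerD2l.
      by apply: le_trans (HL _).2 _; rewrite ler_wpM2l // ltW.
    rewrite -(ler_pM2l t0); apply: le_trans tv _; apply: le_trans (lerD hy (lexx _)) _.
    by rewrite le_eqVlt; apply/orP; left; apply/eqP; ring.
  have K0 : 0 < k * (`|v| + 2) by rewrite mulr_gt0 // ltr_wpDl.
  apply/ler_addgt0Pr => e e0; rewrite add0r.
  pose e' : R := Num.min 1 (e / (k * (`|v| + 2))).
  have e'0 : 0 < e' by rewrite lt_min ltr01 divr_gt0.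
  have e'1 : e' <= 1 by rewrite ge_min lexx.
  apply: le_trans (key e' e'0 e'1) _.
  by rewrite -ler_pdivlMr // ge_min lexx orbT.
move=> [y _ <-]; exists (fun t => P *m (t *: y) + Q *m h (t *: y)); split.
- by rewrite scale0r graph_zero !mulmx0 addr0.
- have y1 : 0 < ns y + 1 by rewrite ltr_wpDl ?anorm_ge0.
  apply/nbhs_ballP; exists (r / (ns y + 1)) => [|t]; first exact: divr_gt0.
  rewrite /ball /= sub0r normrN => tr; exists (t *: y) => //=.
  rewrite anormZ; apply: le_lt_trans (_ : `|t| * (ns y + 1) < r).
    by rewrite ler_wpM2l // lerDl.
  by rewrite -ltr_pdivlMr.
- apply/is_deriveP => e e0; rewrite scale0r graph_zero !mulmx0 addr0.
  have y1 : 0 < ns y + 1 by rewrite ltr_wpDl ?anorm_ge0.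
  pose e1 : R := e / (k * (ns y + 1)).
  have ky : 0 < k * (ns y + 1) by rewrite mulr_gt0.
  have [s s0 Hs] := h0 (divr_gt0 e0 ky : 0 < e1).
  exists (Num.min s (r / 2) / (ns y + 1)).
    by rewrite divr_gt0 // lt_min s0 divr_gt0.
  move=> t t0; rewrite ltr_pdivlMr // => tl.
  have ty : ns (t *: y) < Num.min s (r / 2).
    by rewrite anormZ; apply: le_lt_trans tl; rewrite ler_wpM2l // lerDl.
  have [tys tyr] : ns (t *: y) < s /\ ns (t *: y) < r / 2.
    by move: ty; rewrite lt_min => /andP.
  have H : nu (h (t *: y)) <= e1 * ns (t *: y) by apply: Hs; [apply: lt_trans tyr _; have := r0; lra|exact: ltW].
  have -> : P *m (t *: y) + Q *m h (t *: y) - 0 - t *: (P *m y) = P *m 0 + Q *m h (t *: y).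
    by rewrite -scalemxAr subr0 [X in X - _]addrC addrK mulmx0 add0r.
  apply: le_trans (HNi _) _; rewrite bnorm_PQ anorm0 (max_r (anorm_ge0 _ _)).
  apply: le_trans (ler_wpM2l (ltW k0) H) _; rewrite anormZ.
  apply: (@le_trans _ _ (k * (e1 * (`|t| * (ns y + 1))))).
    rewrite ler_wpM2l ?(ltW k0) // ler_wpM2l //; first by rewrite ltW // divr_gt0.
    by rewrite ler_wpM2l // lerDl.
  rewrite le_eqVlt; apply/orP; left; apply/eqP; rewrite /e1; field.
  by rewrite !lt0r_neq0.
Qed.

Lemma graph_gevrey_manifold beta : gevrey_map_on beta [set y | ns y < r] h ->
  W `<=` [set x | N x < r] -> gevrey_manifold beta W.
Proof.
move=> gh WV; have [dm rk] := splitting_dim S.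
exists d, m; split=> // p Wp.
exists P, Q, [set x | N x < r], [set y | ns y < r], h; split => //.
- by split; [exact: open_bnorm_ball|exact: WV].
- exact: open_anorm_ball.
- by apply/seteqP; split=> x; [case|move=> Wx; split=> //; exact: WV].
Qed.

End GraphTangent.

(** * Reversal of time *)

Section TimeReversal.
Context {R : realType} {n : nat}.
Implicit Types (F : 'cV[R]_n -> 'cV[R]_n) (V : set 'cV[R]_n) (J : set R) (u : R -> 'cV[R]_n).

Definition reverse J : set R := [set t | J (- t)].

Lemma has_deriv_within_reverse J u t w : has_deriv_within J u t w ->
  has_deriv_within (reverse J) (fun s => u (- s)) (- t) (- w).
Proof.
move=> /has_deriv_withinP H; apply/has_deriv_withinP => e e0.
have [dl dl0 Hd] := H e e0; exists dl => // s Js st sd.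
have E : - s - t = - (s - - t) by rewrite opprB addrC.
have st' : - s != t by rewrite eqr_oppLR.
have -> : u (- - t) = u t by rewrite opprK.
by have := Hd (- s) Js st'; rewrite E normrN scaleNr scalerN; apply.
Qed.

Lemma flows_to_reverse V F t x y : flows_to V F t x y ->
  flows_to V (fun x => - F x) (- t) x y.
Proof.
move=> [u [u0 Hu ut]]; exists (fun s => u (- s)); rewrite oppr0 opprK; split=> // s.
rewrite /= -{1 2}oppr0 -oppr_max -oppr_min => /andP[s1 s2].
have st : Num.min 0 t <= - s <= Num.max 0 t by rewrite lerNr s2 lerNl s1.
have [Vu du] := Hu (- s) st; split=> //.
have := has_deriv_within_reverse du; rewrite opprK; apply: has_deriv_within_sub => z /=.
by rewrite /reverse /= -{1 2}oppr0 -oppr_max -oppr_min => /andP[z1 z2]; rewrite lerNr z2 lerNl z1.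
Qed.

(** The two sets of reachable points are equal, hence so are the points chosen by [xget], even where
    the flow is undefined. *)
Lemma flow_reverse V F t x : flow V (fun x => - F x) (- t) x = flow V F t x.
Proof.
rewrite /flow; congr xget; apply/seteqP; split=> y /= H; last exact: flows_to_reverse.
have := flows_to_reverse H; rewrite opprK.
by rewrite (_ : (fun x0 => - - F x0) = F) // funeqE => z; rewrite opprK.
Qed.

Lemma W_loc_reverse V F J : W_loc V (fun x => - F x) (reverse J) `<=` W_loc V F J.
Proof.
have FF : (fun x => - - F x) = F by rewrite funeqE => z; rewrite opprK.
move=> x [Vx Hf [v [dv cv bu bv]]]; split=> // [t Jt|].
  have [|y /flows_to_reverse] := Hf (- t); first by rewrite /reverse /= opprK.
  by rewrite opprK FF => H; exists y.
have JE t : J t -> reverse J (- t) by rewrite /reverse /= opprK.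
have RR : reverse (reverse J) = J by apply/seteqP; split=> t; rewrite /reverse /= opprK.
exists (fun t => - v (- t)); split.
- move=> t Jt; have := has_deriv_within_reverse (dv _ (JE t Jt)).
  rewrite RR opprK.
  by rewrite (_ : (fun s => _) = (fun t => flow V F t x)) // funeqE => s; rewrite flow_reverse.
- apply/subspace_continuousP => t Jt; apply/(@cvgrPdist_le _ _ _ (within J (nbhs t))) => e e0.
  have /subspace_continuousP /(_ (- t) (JE t Jt)) := cv.
  move=> /(@cvgrPdist_le _ _ _ (within (reverse J) (nbhs (- t)))) /(_ e e0).
  rewrite /within /= => /nbhs_ballP[dl dl0 Hd]; apply/nbhs_ballP; exists dl => // s.
  rewrite /ball /= => ts Js; rewrite -opprB normrN opprK addrC.
  apply: Hd; last exact: JE.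
  by rewrite /ball /= -opprB normrN opprK addrC.
- have [B [Br HB]] := bu; exists B; split; first exact: Br.
  move=> M BM t Jt /=.
  by rewrite -flow_reverse; exact: (HB M BM (- t) (JE t Jt)).
- have [B [Br HB]] := bv; exists B; split; first exact: Br.
  move=> M BM t Jt.
  by rewrite /= normrN; exact: HB M BM (- t) (JE t Jt).
Qed.

Lemma W_loc_opp V F : W_loc V F [set t | t <= 0] = W_loc V (fun x => - F x) [set t | 0 <= t].
Proof.
have FF : (fun x => - - F x) = F by rewrite funeqE => z; rewrite opprK.
have E1 : reverse [set t | t <= 0] = [set t | 0 <= t].
  by apply/seteqP; split=> t; rewrite /reverse /= oppr_le0.
have E2 : reverse [set t | 0 <= t] = [set t | t <= 0].
  by apply/seteqP; split=> t; rewrite /reverse /= oppr_ge0.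
apply/seteqP; split; last by rewrite -E1; exact: W_loc_reverse.
by rewrite -{1}FF -E2; exact: W_loc_reverse.
Qed.

End TimeReversal.

Section HalfTheorem.
Context {R : realType} {n d m : nat} {A : 'M[R]_n} (S : splitting A d m).

Lemma stable_manifold beta Omega (g : 'cV[R]_n -> 'cV[R]_n) : 1 <= beta ->
  open_nbhs (0 : 'cV[R]_n) Omega -> gevrey_map_on beta Omega g -> g 0 = 0 ->
  (forall l i, partial i (fun x => g x l 0) 0 = 0) ->
  exists2 r1 : R, 0 < r1 & forall r, 0 < r -> r <= r1 ->
    let V := [set x | bnorm S x < r] in
    let W := W_loc V (fun x => A *m x + g x) [set t | 0 <= t] in
    [/\ V `<=` Omega, gevrey_manifold beta W, W 0
      & tangent_space W 0 = [set spP S *m y | y in setT]].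
Proof.
move=> beta1 Omega0 gg g0 dg0.
have [r1 r10 H] := stable_graph S beta1 Omega0 gg g0 dg0.
exists r1 => // r r0 rle V W; have [VO [h [gh WE hs]]] := H r r0 rle.
have WV : W `<=` V by move=> x [].
rewrite {}/W {}/V in VO WV *; split=> //; rewrite ?WE in WV *.
- exact: (graph_gevrey_manifold gh WV).
- exact: (graph_W0 r0 hs).
- exact: (graph_tangent r0 hs).
Qed.

End HalfTheorem.

Theorem theorem3p4 (R : realType) (n : nat) (beta : R) (A : 'M[R]_n)
    (Omega : set 'cV[R]_n) (g : 'cV[R]_n -> 'cV[R]_n)
    (beta_ge1 : 1 <= beta)
    (A_hyp : hyperbolic A)
    (Omega0 : open_nbhs (0 : 'cV[R]_n) Omega)
    (g_gevrey : gevrey_map_on beta Omega g)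
    (g0 : g 0 = 0)
    (Dg0 : forall v : 'cV[R]_n, 'd g (0 : 'cV[R]_n) v = 0) :
  exists V : set 'cV[R]_n,
    let F := fun x : 'cV[R]_n => A *m x + g x in
    let Ws := W_loc V F [set t : R | 0 <= t] in
    let Wu := W_loc V F [set t : R | t <= 0] in
    [/\ open_nbhs (0 : 'cV[R]_n) V, V `<=` Omega,
        [/\ gevrey_manifold beta Ws, Ws 0
          & tangent_space Ws 0 = stable_space A]
      & [/\ gevrey_manifold beta Wu, Wu 0
          & tangent_space Wu 0 = unstable_space A]].
Proof.
have [oO O0] := Omega0.
have [d [m [S [-> ->]]]] := hyperbolic_splitting A_hyp.
have dgl l : differentiable (fun x => g x l 0) 0.
  exact: (smooth_on_differentiable [::] oO (g_gevrey l).1 O0).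
have dg0 := partial_eq0 dgl Dg0.
have [rs rs0 Hs] := stable_manifold S beta_ge1 Omega0 g_gevrey g0 dg0.
have ggN : gevrey_map_on beta Omega (fun x => - g x).
  move=> l; rewrite (_ : (fun x => _) = (fun x => - g x l 0)); last by rewrite funeqE => x; rewrite mxE.
  exact: gevrey_onN.
have g0N : - g 0 = 0 by rewrite g0 oppr0.
have dg0N l i : partial i (fun x => (- g x) l 0) 0 = 0.
  rewrite (_ : (fun x => _) = (fun x => - g x l 0)); last by rewrite funeqE => x; rewrite mxE.
  by rewrite /partial deriveN; [rewrite [X in - X]dg0 oppr0|exact: diff_derivable].
have [ru ru0 Hu] := stable_manifold (splitting_opp S) beta_ge1 Omega0 ggN g0N dg0N.
(* By [bnorm_opp] both splittings have the same boxes, so one radius below both bounds gives a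
   common neighborhood. *)
pose r := Num.min rs ru; have r0 : 0 < r by rewrite lt_min rs0.
have rrs : r <= rs by rewrite ge_min lexx.
have rru : r <= ru by rewrite ge_min lexx orbT.
have [VO Ms Ws0 Ts] := Hs r r0 rrs; have [_ Mu Wu0 Tu] := Hu r r0 rru.
exists [set x | bnorm S x < r] => F Ws Wu.
have VE : [set x | bnorm (splitting_opp S) x < r] = [set x | bnorm S x < r].
  by apply/seteqP; split=> x /=; rewrite bnorm_opp.
have WuE : Wu = W_loc [set x | bnorm S x < r] (fun x => - A *m x + - g x) [set t | 0 <= t].
  by rewrite /Wu W_loc_opp; congr W_loc; rewrite funeqE => x; rewrite /F opprD mulNmx.
rewrite VE in Mu Wu0 Tu; rewrite -WuE in Mu Wu0 Tu.
split; [|exact: VO|exact: And3 Ms Ws0 Ts|exact: And3 Mu Wu0 Tu].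
by split; [exact: open_bnorm_ball|rewrite /= bnorm0].
Qed.
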